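(* Let $m,k,\ell\in\mathbb N$ with $k+\ell$ odd, $\hbar\in\mathbb R\setminus\{0\}$ and $\sigma\in\mathbb Z_2$. The Schrödinger representation of the Heisenberg supergroup $\mathrm H_{2m|k,\ell}$ with parameter $\hbar$ and parity $\sigma$ is graded-irreducible.
   Context: **Superspaces.** Fix a unital supercommutative real $\mathbb Z_2$-graded algebra $\mathcal A=\mathcal A_0\oplus\mathcal A_1$ with $\mathcal A/\mathcal N_{\mathcal A}\simeq\mathbb R$ ($\mathcal N_{\mathcal A}$ = nilpotent elements; the quotient map is the body map) and such that for each $n\ge1$ there are $a_1,\dots,a_n\in\mathcal A_1$ with $a_1\cdots a_n\ne0$. $\mathbb R^{m|n}=(\mathcal A_0)^m\times(\mathcal A_1)^n$. **Heisenberg supergroup.** For arbitrary $m,k,\ell\in\mathbb N$ let $\varepsilon\in\{\pm1\}$, $r,s'\in\mathbb N$ with $\varepsilon s'=k-\ell$, $2r+s'=k+\ell$. $\mathrm H_{2m|k,\ell}$ is the supermanifold of $(\mathbf x,t)$, $\mathbf x=(q,p,\xi)\in\mathbb R^{m|r}\times\mathbb R^{m|r}\times\mathbb R^{0|s'}$, $t\in\mathbb R^{1|0}=\mathcal A_0$, with law $(\mathbf x,t)(\mathbf x',t')=(\mathbf x+\mathbf x',t+t'+\tfrac12\omega(\mathbf x,\mathbf x'))$, $\omega(\mathbf x,\mathbf x')=\sum_i(q^ip'^i-q'^ip^i)+\varepsilon\sum_c\xi^c\xi'^c$. Its body is the classical Heisenberg group $\mathrm H_{2m}$ (real $q,p\in\mathbb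 R^m$, $t\in\mathbb R$). **Schrödinger representation, $k+\ell$ even.** Put $s=s'/2$, $\zeta^c=\xi^c+i\xi^{c+s}$ ($1\le c\le s$). $\mathcal H_S=L^2(\mathbb R^{m|r})\otimes Hol(\mathbb C^{0|s})\simeq L^2(\mathbb R^m)\otimes\bigwedge\mathbb C^{r+s}$, i.e. functions $\varphi(q,\zeta)$ whose components along the odd variables $q^{m+1},\dots,q^{m+r},\zeta^1,\dots,\zeta^s$ lie in $L^2(\mathbb R^m)$, $\mathbb Z_2$-graded by the degree in the odd variables, with its natural Hilbert topology. (As a Hilbert superspace, of parity $r$ mod 2, it carries the superhermitian inner product $\langle\varphi,\psi\rangle=(2i)^s\int dq\,d\zeta\,d\bar\zeta\,\overline{\varphi}\psi e^{\frac{i\hbar\varepsilon}{2}\zeta\bar\zeta}$, Berezin integral.) For $g=(q,p,\xi,t)$, $$(U(g)\varphi)(q_0,\zeta_0)=e^{i\hbar\left(t+(\frac12q-q_0)p+\frac\varepsilon2(\frac12\zeta-\zeta_0)\bar\zeta\right)}\varphi(q_0-q,\zeta_0-\zeta)$$ for $\varphi$ in the space $\mathcal H_S^\infty$ of smooth vectors of $U_0$, where $U_0$ is the representation of the body $\mathrm H_{2m}$ on $\mathcal H_S$ given by the same formula. **Schrödinger representation, $k+\ell$ odd.** The one of parity $0$ is the restriction to $\mathrm H_{2m|k,\ell}$ of the Schrödinger representation with parameter $\hbar$ of $\mathrm H_{2m|k,\ell+1}$ if $\max(k,\ell+1)$ is even, and of $\mathrm H_{2m|k+1,\ell}$ otherwise;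 the one of parity $1$ is the restriction of that of $\mathrm H_{2m|k+1,\ell}$ if $\max(k,\ell+1)$ is odd, and of $\mathrm H_{2m|k,\ell+1}$ otherwise. Here $\mathrm H_{2m|k,\ell}$ is embedded by adding one odd coordinate $\omega$-orthogonal to the others: in diagonal odd coordinates $\omega$ reads $\sum_{\alpha\le k}x^\alpha x'^\alpha-\sum_{k<\alpha\le k+\ell}x^\alpha x'^\alpha$, and a term of sign $+$ (to get $k+1$) or $-$ (to get $\ell+1$) is added. **Graded-irreducibility.** The infinitesimal representation $U_*$ on $\mathcal H_S^\infty$ is $dU_0$ on the Lie algebra of the body; for an odd coordinate direction $e$ of the supergroup, $U_*(e)$ is defined by $U(ae)=\mathbf 1+a\,U_*(e)$, where $ae$ is the group element with the single non-zero coordinate $a\in\mathcal A_1$. The representation is graded-irreducible if there is no closed graded subspace $F$ (i.e. $F=(F\cap\mathcal H_{S,0})\oplus(F\cap\mathcal H_{S,1})$) with $0\ne F\ne\mathcal H_S$, $U_0(g)F\subseteq F$ for all $g\in\mathrm H_{2m}$, and $U_*(X)(F\cap\mathcal H_S^\infty)\subseteq F\cap\mathcal H_S^\infty$ for all even and odd $X$ in the Lie superalgebra of $\mathrm H_{2m|k,\ell}$. *)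

(* Defs.v *)
From HB Require Import structures.
From mathcomp Require Import all_boot all_order all_algebra.
From mathcomp Require Import complex ring.
From mathcomp Require Import all_classical all_reals all_analysis.
Set Implicit Arguments.
Unset Strict Implicit.
Unset Printing Implicit Defensive.
Import Order.TTheory GRing.Theory Num.Theory.
Import numFieldNormedType.Exports.
Local Open Scope classical_set_scope.
Local Open Scope ring_scope.

(* The sigma-algebra on 'rV[R]_m is the one generated by the coordinates,
   i.e. the Borel sigma-algebra of R^m. *)
Definition row_display : measure_display.
Proof. exact: default_measure_display. Qed.

Section RowMeasurable.
Variables (R : realType) (m : nat).

Definition row_coord (i : 'I_m) (x : 'rV[R]_m) : R := x ord0 i.

Let row0 : g_sigma_preimage row_coord set0.
Proof. exact: sigma_algebra0. Qed.

Let rowC A : g_sigma_preimage row_coord A -> g_sigma_preimage row_coord (~` A).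
Proof. exact: sigma_algebraC. Qed.

Let rowU (F : (set 'rV[R]_m)^nat) :
  (forall i, g_sigma_preimage row_coord (F i)) ->
  g_sigma_preimage row_coord (\bigcup_i (F i)).
Proof. exact: sigma_algebra_bigcup. Qed.

HB.instance Definition _ := @isMeasurable.Build row_display
  'rV[R]_m (g_sigma_preimage row_coord) row0 rowC rowU.

End RowMeasurable.

Lemma measurable_row_coord (R : realType) m i :
  measurable_fun setT (@row_coord R m i).
Proof.
move=> _ B mB; rewrite setTI; apply: sub_sigma_algebra => /=.
rewrite -bigcup_seq/=; exists i => /=; first by rewrite mem_index_enum.
by exists B => //; rewrite setTI.
Qed.

Lemma measurable_fun_row (R : realType) d (T : measurableType d) m
    (f : T -> 'rV[R]_m) :
  (forall i, measurable_fun setT (fun x => f x ord0 i)) ->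
  measurable_fun setT f.
Proof.
move=> mf.
suff prefS : g_sigma_preimage (fun i => @row_coord R m i \o f) `<=` measurable.
  move: prefS; rewrite g_sigma_preimage_comp => prefS _ A mA.
  by apply: prefS; exists A.
apply: smallest_sub; first exact: sigma_algebra_measurable.
case: m => [|m] in f mf *; first by rewrite big_ord0.
rewrite -bigcup_mkord_ord; apply: bigcup_sub => i Ii.
by move=> A [B mB <-]; exact: mf.
Qed.

Definition row_cons (R : realType) m (z : measurableTypeR R * 'rV[R]_m) : 'rV[R]_m.+1 :=
  row_mx ((z.1)%:M : 'M[R]_1) z.2.

Definition row_uncons (R : realType) m (x : 'rV[R]_m.+1) : measurableTypeR R * 'rV[R]_m :=
  (x ord0 ord0, \row_i x ord0 (lift ord0 i)).

Lemma row_cons0 (R : realType) m (z : measurableTypeR R * 'rV[R]_m) : row_cons z ord0 ord0 = z.1.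
Proof.
rewrite /row_cons (_ : ord0 = lshift m (ord0 : 'I_1)); last exact/val_inj.
by rewrite (row_mxEl ((z.1)%:M : 'M[R]_1)) mxE eqxx mulr1n.
Qed.

Lemma row_consS (R : realType) m (z : measurableTypeR R * 'rV[R]_m) i :
  row_cons z ord0 (lift ord0 i) = z.2 ord0 i.
Proof.
rewrite /row_cons (_ : lift ord0 i = rshift 1 i); last exact/val_inj.
by rewrite (row_mxEr ((z.1)%:M : 'M[R]_1)).
Qed.

Lemma row_consK (R : realType) m : cancel (@row_cons R m) (@row_uncons R m).
Proof.
move=> z; rewrite /row_uncons row_cons0 [RHS]surjective_pairing; congr pair.
by apply/rowP => i; rewrite mxE row_consS.
Qed.

Lemma row_unconsK (R : realType) m : cancel (@row_uncons R m) (@row_cons R m).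
Proof.
move=> x; apply/rowP => i.
by case: (unliftP ord0 i) => [j ->|->]; rewrite ?row_consS ?row_cons0 // mxE.
Qed.

Lemma measurable_row_cons (R : realType) m :
  measurable_fun setT (@row_cons R m).
Proof.
apply: measurable_fun_row => i.
case: (unliftP ord0 i) => [j ->|->].
  under eq_fun do rewrite row_consS.
  exact: (measurableT_comp (@measurable_row_coord R m j) measurable_snd).
under eq_fun do rewrite row_cons0.
exact: measurable_fst.
Qed.

Lemma measurable_row_uncons (R : realType) m :
  measurable_fun setT (@row_uncons R m).
Proof.
apply/measurable_fun_pairP; split; first exact: measurable_row_coord.
apply: measurable_fun_row => i /=.
rewrite [X in measurable_fun _ X](_ : _ = row_coord (lift ord0 i)).
  exact: measurable_row_coord.
by apply/funext => x /=; rewrite mxE.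
Qed.

HB.instance Definition _ (R : realType) m :=
  isMeasurableFun.Build _ _ _ _ (@row_cons R m) (@measurable_row_cons R m).

Section RowConsMeasure.
Variables (R : realType) (m : nat).
Variable mu : {sigma_finite_measure set 'rV[R]_m -> \bar R}.

Definition row_cons_measure : set 'rV[R]_m.+1 -> \bar R :=
  pushforward (@lebesgue_measure R \x mu)%E (@row_cons R m).

Let row_cons_measure0 : row_cons_measure set0 = 0%E.
Proof. exact: measure0. Qed.

Let row_cons_measure_ge0 A : (0 <= row_cons_measure A)%E.
Proof. exact: measure_ge0. Qed.

Let row_cons_measure_sigma_additive : semi_sigma_additive row_cons_measure.
Proof. exact: measure_semi_sigma_additive. Qed.

HB.instance Definition _ := isMeasure.Build _ _ _ row_cons_measure
  row_cons_measure0 row_cons_measure_ge0 row_cons_measure_sigma_additive.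

Let row_cons_measure_sigma_finite : sigma_finite setT row_cons_measure.
Proof.
have /sigma_finiteP[F [TF ndF Foo]] := sigma_finiteT (@lebesgue_measure R).
have /sigma_finiteP[G [TG ndG Goo]] := sigma_finiteT mu.
exists (fun n => @row_uncons R m @^-1` (F n `*` G n)).
  rewrite -preimage_bigcup (_ : \bigcup_i _ = setT) ?preimage_setT //.
  rewrite -setXTT TF TG predeqE => -[x y]; split.
    by move=> [n _ []/= ? ?]; split; exists n.
  move=> [/= [n _ Fnx] [k _ Gky]]; exists (maxn n k) => //; split.
  - by move: x Fnx; exact/subsetPset/ndF/leq_maxl.
  - by move: y Gky; exact/subsetPset/ndG/leq_maxr.
move=> k; have [mF Fk] := Foo k; have [mG Gk] := Goo k.
have mFG : measurable (F k `*` G k) by exact: measurableX.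
split.
  by rewrite -[X in measurable X]setTI; exact: (@measurable_row_uncons R m).
rewrite /row_cons_measure /pushforward -comp_preimage (_ : _ \o _ = id).
  by rewrite preimage_id product_measure1E// lte_mul_pinfty// ge0_fin_numE.
by apply/funext => z; exact: row_consK.
Qed.

HB.instance Definition _ := Measure_isSigmaFinite.Build _ _ _ row_cons_measure
  row_cons_measure_sigma_finite.

End RowConsMeasure.

Fixpoint lebesgue_row (R : realType) m :
    {sigma_finite_measure set 'rV[R]_m -> \bar R} :=
  if m is n.+1 then row_cons_measure (lebesgue_row R n) else \d_(0 : 'rV[R]_0).

(* [lebesgue_row] is characterized by its values on boxes. *)
Lemma lebesgue_row_box (R : realType) m (A : 'I_m -> set R) :
  (forall i, measurable (A i)) ->
  lebesgue_row R m [set x : 'rV[R]_m | forall i, A i (x ord0 i)] =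
  (\prod_(i < m) lebesgue_measure (A i))%E.
Proof.
elim: m A => [|m IH] A mA.
  rewrite big_ord0 /= diracE; apply/eqP; rewrite eqe.
  by rewrite mem_set // => -[].
rewrite big_ord_recl -IH //.
transitivity ((lebesgue_measure \x lebesgue_row R m)%E
    (A ord0 `*` [set x : 'rV[R]_m | forall i, A (lift ord0 i) (x ord0 i)])).
  congr ((_ \x _)%E _); apply/seteqP; split => -[a x] /= => [Ax|[Aa Ax] i].
    split; first by have := Ax ord0; rewrite row_cons0.
    by move=> i; have := Ax (lift ord0 i); rewrite row_consS.
  by case: (unliftP ord0 i) => [j ->|->]; rewrite ?row_consS ?row_cons0.
suff mB : measurable [set x : 'rV[R]_m | forall i, A (lift ord0 i) (x ord0 i)].
  by rewrite product_measure1E //; exact: (mA ord0).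
rewrite [X in measurable X](_ : _ =
  \big[setI/setT]_(i < m) (row_coord i @^-1` A (lift ord0 i))).
  apply: bigsetI_measurable => i _; rewrite -[X in measurable X]setTI.
  exact: measurable_row_coord.
apply/seteqP; split => x /=.
  by move=> Ax; elim/big_ind: _ => //= i _; exact: Ax.
by move=> + i; rewrite (bigD1 i) //= => -[].
Qed.

(* [sa_part b] is the homogeneous part of parity [b]. A unital map to R is
   onto, so [sa_bodyP] says that the body map induces A / nilpotents = R. *)
Record superalgebra (R : realType) := Superalgebra {
  sa_alg :> algType R;
  sa_part : bool -> set sa_alg;
  sa_body : {lrmorphism sa_alg -> R^o};
  sa_part0 : forall b, sa_part b 0;
  sa_partP : forall b (c : R) x y,
    sa_part b x -> sa_part b y -> sa_part b (c *: x + y);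
  sa_split : forall x, exists x0 x1,
    [/\ sa_part false x0, sa_part true x1 & x = x0 + x1];
  sa_inter : forall x, sa_part false x -> sa_part true x -> x = 0;
  sa_part1 : sa_part false 1;
  sa_partM : forall b c x y,
    sa_part b x -> sa_part c y -> sa_part (b (+) c) (x * y);
  sa_comm : forall b c x y,
    sa_part b x -> sa_part c y -> x * y = (-1) ^+ (b && c) * (y * x);
  sa_bodyP : forall x, sa_body x = 0 <-> exists n, x ^+ n = 0;
  sa_odd_free : forall n, (0 < n)%N -> exists a : 'I_n -> sa_alg,
    (forall i, sa_part true (a i)) /\ \prod_(i < n) a i != 0
}.

(* Complexification of a real algebra: [(x, y)] stands for x + i y. *)
Definition cplx (A : Type) : Type := (A * A)%type.

Section ComplexificationRing.
Variable A : nzRingType.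

HB.instance Definition _ := GRing.Zmodule.copy (cplx A) (A * A)%type.

Definition cplx_one : cplx A := (1, 0).
Definition cplx_mul (z w : cplx A) : cplx A :=
  (z.1 * w.1 - z.2 * w.2, z.1 * w.2 + z.2 * w.1).

Let cplx_mulA : associative cplx_mul.
Proof.
move=> [a b] [c d] [e f]; rewrite /cplx_mul /=; congr pair.
  rewrite !mulrBr !mulrBl !mulrDr !mulrDl !mulrA !opprD -!addrA.
  by congr (_ + _); rewrite [RHS]addrC -addrA.
rewrite !mulrBr !mulrBl !mulrDr !mulrDl !mulrA -!addrA.
by congr (_ + _); rewrite [RHS]addrC -addrA.
Qed.

Let cplx_mul1l : left_id cplx_one cplx_mul.
Proof. by move=> [a b]; rewrite /cplx_mul /= !mul1r !mul0r subr0 addr0. Qed.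

Let cplx_mul1r : right_id cplx_one cplx_mul.
Proof. by move=> [a b]; rewrite /cplx_mul /= !mulr1 !mulr0 subr0 add0r. Qed.

Let cplx_mulDl : left_distributive cplx_mul +%R.
Proof.
move=> [a b] [c d] [e f]; rewrite /cplx_mul /=; congr pair => /=.
  by rewrite !mulrDl opprD addrACA.
by rewrite !mulrDl addrACA.
Qed.

Let cplx_mulDr : right_distributive cplx_mul +%R.
Proof.
move=> [a b] [c d] [e f]; rewrite /cplx_mul /=; congr pair => /=.
  by rewrite !mulrDr opprD addrACA.
by rewrite !mulrDr addrACA.
Qed.

Let cplx_oner_neq0 : cplx_one != 0.
Proof. by apply/eqP => -[] /eqP; rewrite oner_eq0. Qed.

HB.instance Definition _ := GRing.Zmodule_isNzRing.Build (cplx A)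
  cplx_mulA cplx_mul1l cplx_mul1r cplx_mulDl cplx_mulDr cplx_oner_neq0.

Definition cplx_re (x : A) : cplx A := (x, 0).
Definition cplx_conj (z : cplx A) : cplx A := (z.1, - z.2).

End ComplexificationRing.

Section Grassmann.
Variables (R : realType) (A : superalgebra R).
Local Notation AC := (cplx A).

Definition nil_part (x : A) : A := x - (sa_body A x : R)%:A.

Definition of_complex (c : R[i]) : AC := ((complex.Re c)%:A, (complex.Im c)%:A).

Definition cplx_body (z : AC) : R[i] := Complex (sa_body A z.1) (sa_body A z.2).

Definition expC (c : R[i]) : R[i] :=
  (expR (complex.Re c))%:C%C *
  Complex (cos (complex.Im c)) (sin (complex.Im c)).

(* exp (body + n) = exp (body) * sum of the n^k/k!, for n nilpotent. The
   truncation order is any K with n^K = 0; the sum does not depend on it. *)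
Definition super_exp (z : AC) : AC :=
  let n := z - of_complex (cplx_body z) in
  let K := xget 0%N [set K | n ^+ K = 0] in
  of_complex (expC (cplx_body z)) *
  \sum_(k < K) of_complex (k`!%:R^-1) * n ^+ k.

Definition partial_der m (i : 'I_m) (f : 'rV[R]_m -> R[i]) : 'rV[R]_m -> R[i] :=
  fun x => Complex
    (derive1 (fun h : R => complex.Re (f (x + h *: delta_mx 0 i))) 0)
    (derive1 (fun h : R => complex.Im (f (x + h *: delta_mx 0 i))) 0).

(* Value of a smooth function of m real variables at a point of (A_0)^m, by
   Taylor expansion at the body of the point. The truncation order is any K
   such that all products of K nilpotent parts vanish; the sum does not
   depend on it. *)
Definition even_ext m (f : 'rV[R]_m -> R[i]) (x : 'I_m -> A) : AC :=
  let K := xget 0%N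
    [set K | forall w : K.-tuple 'I_m, \prod_(i <- w) nil_part (x i) = 0] in
  \sum_(k < K) \sum_(w : k.-tuple 'I_m)
    of_complex (k`!%:R^-1 *
      foldr (@partial_der m) f w (\row_i (sa_body A (x i) : R))) *
    cplx_re (\prod_(i <- w) nil_part (x i)).

End Grassmann.

(* Functions of m even and n odd variables: [phi q I] is the coefficient of
   the product, in increasing order, of the odd variables of index in [I]. *)
Definition superfun (R : realType) (m n : nat) := 'rV[R]_m -> {set 'I_n} -> R[i].

(* Functions of points with coordinates in A: even ones in A_0, odd ones in
   the complexification of A_1. *)
Definition pointfun (R : realType) (A : superalgebra R) (m n : nat) :=
  ('I_m -> A) -> ('I_n -> cplx A) -> cplx A.

Definition eval_superfun (R : realType) (A : superalgebra R) m n
    (phi : superfun R m n) : pointfun A m n := fun x theta =>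
  \sum_(I : {set 'I_n}) even_ext (phi^~ I) x * \prod_(i in I) theta i.

Section HeisenbergSupergroup.
Variables (R : realType).

Definition qp_odd_dim (k l : nat) : nat := minn k l.                    (* r *)
Definition xi_dim (k l : nat) : nat := (maxn k l - minn k l)%N.         (* s' *)
Definition heis_sign (k l : nat) : R := if (l <= k)%N then 1 else -1.   (* eps *)

Lemma xi_dimE k l :
  heis_sign k l * (xi_dim k l)%:R = k%:R - l%:R /\
  (2 * qp_odd_dim k l + xi_dim k l = k + l)%N.
Proof.
rewrite /heis_sign /xi_dim /qp_odd_dim; case: leqP => lk; split.
- by rewrite mul1r natrB.
- by rewrite mul2n -addnn -addnA subnKC // addnC.
- by rewrite mulN1r natrB ?opprB // ltnW.
- by rewrite mul2n -addnn -addnA subnKC // ltnW.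
Qed.

Variables (A : superalgebra R).

(* Coordinates (q, p, xi, t) of H_{2m|k,l}; the first m of q and of p are even
   and the others odd, see [heis_point]. When k = l there is no xi and
   [heis_sign] is irrelevant. *)
Record heis (m k l : nat) := Heis {
  hq : 'I_(m + qp_odd_dim k l) -> A;
  hp : 'I_(m + qp_odd_dim k l) -> A;
  hxi : 'I_(xi_dim k l) -> A;
  ht : A
}.

Definition heis_point m k l (g : heis m k l) : Prop :=
  [/\ forall i : 'I_(m + qp_odd_dim k l), sa_part (m <= i)%N (hq g i),
      forall i : 'I_(m + qp_odd_dim k l), sa_part (m <= i)%N (hp g i),
      forall c, sa_part true (hxi g c) & sa_part false (ht g)].

Definition heis_omega m k l (g h : heis m k l) : A :=
  \sum_i (hq g i * hp h i - hq h i * hp g i) +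
  heis_sign k l *: \sum_c hxi g c * hxi h c.

Definition heis_mul m k l (g h : heis m k l) : heis m k l :=
  Heis (fun i => hq g i + hq h i) (fun i => hp g i + hp h i)
    (fun c => hxi g c + hxi h c)
    (ht g + ht h + 2^-1 *: heis_omega g h).

Definition coord_at n (f : 'I_n -> A) (j : nat) : A := oapp f 0 (insub j).

Definition hq_odd m k l (g : heis m k l) := coord_at (fun j => hq g (rshift m j)).
Definition hp_odd m k l (g : heis m k l) := coord_at (fun j => hp g (rshift m j)).
Definition hxi_at m k l (g : heis m k l) := coord_at (hxi g).

(* Diagonal odd coordinates x^a, with x = (q + p) / sqrt 2 for the k signs +
   and x = (q - p) / sqrt 2 for the l signs -, completed by the xi; they are 0
   for out of range indices. See [heis_omega_diag]. *)
Definition diag_plus m k l (g : heis m k l) (a : nat) : A :=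
  if (a < qp_odd_dim k l)%N then
    (Num.sqrt 2 : R)^-1 *: (hq_odd g a + hp_odd g a)
  else if (l < k)%N then hxi_at g (a - qp_odd_dim k l) else 0.

Definition diag_minus m k l (g : heis m k l) (a : nat) : A :=
  if (a < qp_odd_dim k l)%N then
    (Num.sqrt 2 : R)^-1 *: (hq_odd g a - hp_odd g a)
  else if (k < l)%N then hxi_at g (a - qp_odd_dim k l) else 0.

(* The point of H_{2m|K,L} with the same even and diagonal odd coordinates,
   the additional odd coordinates being 0 (k <= K and l <= L). *)
Definition heis_incl m k l K L (g : heis m k l) : heis m K L :=
  let q i := (Num.sqrt 2 : R)^-1 *: (diag_plus g i + diag_minus g i) in
  let p i := (Num.sqrt 2 : R)^-1 *: (diag_plus g i - diag_minus g i) in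
  Heis
    (fun i => match fintype.split i with inl j => hq g (lshift _ j) | inr j => q j end)
    (fun i => match fintype.split i with inl j => hp g (lshift _ j) | inr j => p j end)
    (fun c => if (L <= K)%N then diag_plus g (qp_odd_dim K L + c)
              else diag_minus g (qp_odd_dim K L + c))
    (ht g).

Definition odd_dir (k l : nat) : eqType :=
  ('I_(qp_odd_dim k l) + 'I_(qp_odd_dim k l) + 'I_(xi_dim k l))%type.

Definition odd_point m k l (d : odd_dir k l) (a : A) : heis m k l :=
  Heis
    (fun i => if fintype.split i is inr j then if d == inl (inl j) then a else 0 else 0)
    (fun i => if fintype.split i is inr j then if d == inl (inr j) then a else 0 else 0)
    (fun c => if d == inr c then a else 0)
    0.

End HeisenbergSupergroup.

Section HeisenbergDiagonal.
Variables (R : realType) (A : superalgebra R).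

Lemma coord_atE n (f : 'I_n -> A) (j : 'I_n) : coord_at f j = f j.
Proof. by rewrite /coord_at valK. Qed.

Lemma coord_at_out n (f : 'I_n -> A) j : (n <= j)%N -> coord_at f j = 0.
Proof. by move=> nj; rewrite /coord_at insubF // ltnNge nj. Qed.

Let c2 : R := (Num.sqrt 2)^-1.

Let c2_sq : c2 * c2 *+ 2 = 1.
Proof. by rewrite -invfM -expr2 sqr_sqrtr // -mulr_natr mulVf // pnatr_eq0. Qed.

Let diag_mul (x y z w : A) :
  (c2 *: (x + y)) * (c2 *: (z + w)) - (c2 *: (x - y)) * (c2 *: (z - w)) =
  x * w + y * z.
Proof.
have mulE u v : (x + u) * (z + v) = (x * z + u * v) + (x * v + u * z).
  by rewrite mulrDl !mulrDr [u * z + _]addrC addrACA.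
rewrite -!scalerAl -!scalerAr !scalerA -scalerBr !mulE mulrNN mulrN mulNr.
rewrite -opprD opprB addrC addrA subrK -mulr2n -scaler_nat scalerA mulr_natr.
by rewrite c2_sq scale1r.
Qed.

Let diag_inv (x y : A) :
  c2 *: (c2 *: (x + y) + c2 *: (x - y)) = x /\
  c2 *: (c2 *: (x + y) - c2 *: (x - y)) = y.
Proof.
rewrite -scalerDr -scalerBr !scalerA; split.
  by rewrite addrACA subrr addr0 -mulr2n -scaler_nat scalerA mulr_natr c2_sq scale1r.
by rewrite opprB addrC addrA subrK -mulr2n -scaler_nat scalerA mulr_natr c2_sq scale1r.
Qed.

Lemma heis_omega_diag m k l (g h : heis A m k l) :
  heis_point g -> heis_point h ->
  heis_omega g h =
  \sum_(i < m) (hq g (lshift _ i) * hp h (lshift _ i) -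
                hq h (lshift _ i) * hp g (lshift _ i)) +
  (\sum_(a < k) diag_plus g a * diag_plus h a -
   \sum_(a < l) diag_minus g a * diag_minus h a).
Proof.
move=> [gq gp gx gt] [hhq hhp hx ht_].
rewrite /heis_omega big_split_ord /= -addrA; congr (_ + _).
set r := qp_odd_dim k l.
have qpE : \sum_(j < r) (hq g (rshift m j) * hp h (rshift m j) -
     hq h (rshift m j) * hp g (rshift m j)) =
  \sum_(a < r) diag_plus g a * diag_plus h a -
  \sum_(a < r) diag_minus g a * diag_minus h a.
  rewrite -sumrB; apply: eq_bigr => j _.
  rewrite /diag_plus /diag_minus ltn_ord /hq_odd /hp_odd !coord_atE diag_mul.
  congr (_ + _); rewrite (sa_comm (hhq _) (gp _)) /= leq_addr /=.
  by rewrite expr1 mulN1r opprK.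
rewrite qpE.
have sum_cut N (f : nat -> A) : (r <= N)%N ->
    \sum_(a < N) f a = \sum_(a < r) f a + \sum_(c < N - r) f (r + c)%N.
  move=> rN; rewrite -[in LHS](subnKC rN) big_split_ord /=.
  by congr (_ + _); apply: eq_bigr.
have rk : (r <= k)%N by exact: geq_minl.
have rl : (r <= l)%N by exact: geq_minr.
rewrite (sum_cut k (fun a => diag_plus g a * diag_plus h a)) //.
rewrite (sum_cut l (fun a => diag_minus g a * diag_minus h a)) //.
rewrite opprD addrACA; congr (_ + _).
rewrite /heis_sign; case: (leqP l k) => lk.
  have rE : r = l by rewrite /r /qp_odd_dim (minn_idPr lk).
  have xE : xi_dim k l = (k - r)%N by rewrite /xi_dim (maxn_idPl lk).
  rewrite scale1r [X in _ - X]big1 ?subr0; last first.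
    by move=> [c clt] _; exfalso; rewrite rE subnn in clt.
  rewrite -xE; apply: eq_bigr => c _.
  rewrite /diag_plus -/r ltnNge leq_addr /= addKn /hxi_at !coord_atE.
  case: ltnP => // kl; exfalso; have := leq_trans (ltn_ord c) (eq_leq xE).
  by rewrite rE (eqP (kl : k - l == 0)%N).
have rE : r = k by rewrite /r /qp_odd_dim (minn_idPl (ltnW lk)).
have xE : xi_dim k l = (l - r)%N by rewrite /xi_dim (maxn_idPr (ltnW lk)).
rewrite scaleN1r [X in X - _]big1 ?sub0r; last first.
  by move=> [c clt] _; exfalso; rewrite rE subnn in clt.
rewrite -xE; congr (- _); apply: eq_bigr => c _.
by rewrite /diag_minus -/r ltnNge leq_addr /= addKn /hxi_at !coord_atE lk.
Qed.

Lemma diag_plus_out m k l (g : heis A m k l) a : (k <= a)%N -> diag_plus g a = 0.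
Proof.
move=> ka; rewrite /diag_plus ltnNge (leq_trans (geq_minl k l) ka) /=.
case: ltnP => // lk; rewrite /hxi_at coord_at_out //.
by rewrite /xi_dim /qp_odd_dim (maxn_idPl (ltnW lk)) leq_sub2r.
Qed.

Lemma diag_minus_out m k l (g : heis A m k l) a : (l <= a)%N -> diag_minus g a = 0.
Proof.
move=> ka; rewrite /diag_minus ltnNge (leq_trans (geq_minr k l) ka) /=.
case: ltnP => // lk; rewrite /hxi_at coord_at_out //.
by rewrite /xi_dim /qp_odd_dim (maxn_idPr (ltnW lk)) leq_sub2r.
Qed.

Lemma diag_plus_incl m k l K L (g : heis A m k l) a :
  (k <= K)%N -> (l <= L)%N -> diag_plus (heis_incl K L g) a = diag_plus g a.
Proof.
move=> kK lL; have [aK|Ka] := ltnP a K; last first.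
  by rewrite !diag_plus_out // (leq_trans kK).
rewrite [in LHS]/diag_plus; case: ltnP => ar.
  rewrite /hq_odd /hp_odd (coord_atE _ (Ordinal ar)) (coord_atE _ (Ordinal ar)).
  rewrite /= (unsplitK (inr (Ordinal ar) : 'I_m + _)).
  by rewrite -/c2 (diag_inv _ _).1.
case: ltnP => LK; last first.
  move: ar; rewrite /qp_odd_dim (minn_idPl LK) => Ka.
  by rewrite ltnNge Ka in aK.
have lt : (a - qp_odd_dim K L < xi_dim K L)%N.
  by rewrite /xi_dim (maxn_idPl (ltnW LK)) ltn_sub2r // (leq_ltn_trans ar).
rewrite /hxi_at (coord_atE _ (Ordinal lt)) /= (ltnW LK).
by rewrite subnKC.
Qed.

Lemma diag_minus_incl m k l K L (g : heis A m k l) a :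
  (k <= K)%N -> (l <= L)%N -> diag_minus (heis_incl K L g) a = diag_minus g a.
Proof.
move=> kK lL; have [aL|La] := ltnP a L; last first.
  by rewrite !diag_minus_out // (leq_trans lL).
rewrite [in LHS]/diag_minus; case: ltnP => ar.
  rewrite /hq_odd /hp_odd (coord_atE _ (Ordinal ar)) (coord_atE _ (Ordinal ar)).
  rewrite /= (unsplitK (inr (Ordinal ar) : 'I_m + _)).
  by rewrite -/c2 (diag_inv _ _).2.
case: ltnP => KL; last first.
  move: ar; rewrite /qp_odd_dim (minn_idPr KL) => La.
  by rewrite ltnNge La in aL.
have lt : (a - qp_odd_dim K L < xi_dim K L)%N.
  by rewrite /xi_dim (maxn_idPr (ltnW KL)) ltn_sub2r // (leq_ltn_trans ar).
rewrite /hxi_at (coord_atE _ (Ordinal lt)) /= leqNgt KL /=.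
by rewrite subnKC.
Qed.

Lemma sa_partD b (x y : A) : sa_part b x -> sa_part b y -> sa_part b (x + y).
Proof. by move=> bx b_y; rewrite -[x]scale1r; exact: sa_partP. Qed.

Lemma sa_partZ b (c : R) (x : A) : sa_part b x -> sa_part b (c *: x).
Proof. by move=> bx; rewrite -[_ *: x]addr0; apply: sa_partP => //; exact: sa_part0. Qed.

Lemma sa_partB b (x y : A) : sa_part b x -> sa_part b y -> sa_part b (x - y).
Proof. by move=> bx b_y; rewrite -scaleN1r; apply: sa_partD => //; exact: sa_partZ. Qed.

Lemma diag_odd m k l (g : heis A m k l) a : heis_point g ->
  sa_part true (diag_plus g a) /\ sa_part true (diag_minus g a).
Proof.
move=> [gq gp gx gt].
have co n (f : 'I_n -> A) : (forall i, sa_part true (f i)) ->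
    forall j, sa_part true (coord_at f j).
  by move=> fo j; rewrite /coord_at; case: insub => [i|] /=; [exact: fo|exact: sa_part0].
have qo : forall j, sa_part true (hq_odd g j).
  by apply: co => i; have := gq (rshift m i); rewrite /= leq_addr.
have po : forall j, sa_part true (hp_odd g j).
  by apply: co => i; have := gp (rshift m i); rewrite /= leq_addr.
have xo : forall j, sa_part true (hxi_at g j) by exact: co.
rewrite /diag_plus /diag_minus; split.
  case: ifP => _; first by apply/sa_partZ/sa_partD.
  by case: ifP => // _; exact: sa_part0.
case: ifP => _; first by apply/sa_partZ/sa_partB.
by case: ifP => // _; exact: sa_part0.
Qed.

Lemma heis_incl_point m k l K L (g : heis A m k l) :
  heis_point g -> heis_point (heis_incl K L g).
Proof.
move=> gP; have dP a := diag_odd a gP; case: gP => gq gp gx gt.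
split => [i|i|c|] //=.
- case: (fintype.splitP i) => j ij; rewrite ij.
    by have := gq (lshift _ j); rewrite /= leqNgt ltn_ord.
  by rewrite leq_addr; apply/sa_partZ/sa_partD; have [] := dP j.
- case: (fintype.splitP i) => j ij; rewrite ij.
    by have := gp (lshift _ j); rewrite /= leqNgt ltn_ord.
  by rewrite leq_addr; apply/sa_partZ/sa_partB; have [] := dP j.
- by case: ifP => _; have [] := dP (qp_odd_dim K L + c)%N.
Qed.

Lemma heis_incl_omega m k l K L (g h : heis A m k l) :
  (k <= K)%N -> (l <= L)%N -> heis_point g -> heis_point h ->
  heis_omega (heis_incl K L g) (heis_incl K L h) = heis_omega g h.
Proof.
move=> kK lL gP hP.
rewrite !heis_omega_diag //; try exact: heis_incl_point.
have cut N M (f : nat -> A) : (N <= M)%N ->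
    (forall a, (N <= a)%N -> f a = 0) -> \sum_(a < M) f a = \sum_(a < N) f a.
  move=> NM f0; rewrite -(subnKC NM) big_split_ord /= [X in _ + X]big1 ?addr0 //.
  by move=> i _; rewrite f0 // leq_addr.
congr (_ + (_ - _)).
- apply: eq_bigr => i _.
  by rewrite /= (unsplitK (inl i : _ + 'I_(qp_odd_dim K L))).
- rewrite -(cut k K (fun a => diag_plus g a * diag_plus h a)) //.
    by apply: eq_bigr => a _; rewrite !diag_plus_incl.
  by move=> a ka; rewrite diag_plus_out // mul0r.
- rewrite -(cut l L (fun a => diag_minus g a * diag_minus h a)) //.
    by apply: eq_bigr => a _; rewrite !diag_minus_incl.
  by move=> a ka; rewrite diag_minus_out // mul0r.
Qed.

End HeisenbergDiagonal.

(* The body H_{2m}, with coordinates (q, p, t), also used for its Lie algebra: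
   as omega(X, X) = 0, exp is the identity in these coordinates. *)
Definition heis_body (R : realType) (m : nat) :=
  ('rV[R]_m * 'rV[R]_m * R^o)%type.

Definition of_body (R : realType) (A : superalgebra R) m k l
    (g : heis_body R m) : heis A m k l :=
  let real (q : 'rV[R]_m) i :=
    match fintype.split i with inl j => (q ord0 j)%:A | inr _ => 0 end in
  Heis (real g.1.1) (real g.1.2) (fun=> 0) (g.2 : R)%:A.

(* The Hilbert space L^2(R^m) tensor Lambda(C^n). A vector is represented by a
   square integrable function, and two functions represent the same vector
   when the norm of their difference is 0 ([hs_eq]). A closed subspace is
   represented by the set of all the representatives of its vectors. *)
Section HilbertSpace.
Variables (R : realType) (m n : nat).
Implicit Types (phi psi : superfun R m n) (F : set (superfun R m n)).

Definition hs_norm2 phi : \bar R :=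
  (\sum_(I : {set 'I_n}) \int[lebesgue_row R m]_q
     (complex.Re (phi q I) ^+ 2 + complex.Im (phi q I) ^+ 2)%:E)%E.

Definition hs phi : Prop :=
  (forall I, measurable_fun setT (fun q => complex.Re (phi q I)) /\
             measurable_fun setT (fun q => complex.Im (phi q I))) /\
  (hs_norm2 phi < +oo)%E.

Definition hs_eq phi psi : Prop := hs_norm2 (phi - psi) = 0%E.

Definition hs_homog (b : bool) phi : Prop :=
  hs phi /\ forall I : {set 'I_n}, odd #|I| != b ->
    {ae lebesgue_row R m, forall q : 'rV[R]_m, phi q I = 0}.

Definition closed_subspace F : Prop :=
  [/\ F `<=` hs, F 0,
      forall (c : R[i]) phi psi,
        F phi -> F psi -> F ((fun q I => c * phi q I) + psi)
    & forall phi, hs phi ->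
        (forall e : R, 0 < e ->
           exists2 psi, F psi & (hs_norm2 (phi - psi)%R < e%:E)%E) ->
        F phi].

Definition graded_subspace F : Prop := forall phi, F phi ->
  exists phi0 phi1, [/\ F phi0, hs_homog false phi0, F phi1, hs_homog true phi1
    & hs_eq phi (phi0 + phi1)].

(* Smoothness of Hilbert space valued maps on the manifold H_{2m} = R^{2m+1}:
   f is C^(N+1) when all its directional derivatives exist and are C^N. *)
Definition hs_continuous (f : heis_body R m -> superfun R m n) : Prop :=
  forall x, hs_norm2 (f y - f x) @[y --> x] --> 0%E.

Definition hs_derivative (v : heis_body R m)
    (f g : heis_body R m -> superfun R m n) : Prop :=
  forall x, hs_norm2
    ((fun q I => (h^-1)%:C%C * (f (x + h *: v) - f x) q I) - g x) @[h --> 0^']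
    --> 0%E.

Fixpoint hs_Cn (N : nat) (f : heis_body R m -> superfun R m n) : Prop :=
  hs_continuous f /\
  if N is N'.+1 then
    forall v, exists g, [/\ forall x, hs (g x), hs_derivative v f g & hs_Cn N' g]
  else True.

Definition smooth_vector (U0 : heis_body R m -> superfun R m n -> superfun R m n)
    phi : Prop :=
  hs phi /\ forall N, hs_Cn N (U0^~ phi).

End HilbertSpace.

(* The representation of the body on the Hilbert space, and the action of the
   supergroup on the smooth vectors, given by smooth representatives. *)
Record superrep (R : realType) (A : superalgebra R) (m k l n : nat) := Superrep {
  body_rep : heis_body R m -> superfun R m n -> superfun R m n;
  super_rep : heis A m k l -> superfun R m n -> pointfun A m n
}.

Section GradedIrreducible.
Variables (R : realType) (A : superalgebra R) (m k l r s : nat).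
Variable U : superrep A m k l (r + s).
Implicit Types (phi psi : superfun R m (r + s)).

(* psi = dU_0(X) phi *)
Definition even_generator (X : heis_body R m) phi psi : Prop :=
  hs psi /\
  hs_norm2
    ((fun q I => (h^-1)%:C%C * (body_rep U (h *: X) phi - phi) q I) - psi)
    @[h --> (0 : R)^'] --> 0%E.

(* Values of the odd coordinates (q^{m+1},...,q^{m+r},zeta^1,...,zeta^s): the q
   are in A_1, the zeta in its complexification. *)
Definition odd_values (theta : 'I_(r + s) -> cplx A) : Prop :=
  (forall j, exists2 a, sa_part true a & theta (lshift s j) = cplx_re a) /\
  (forall c, sa_part true (theta (rshift r c)).1 /\
             sa_part true (theta (rshift r c)).2).

(* psi = U_*(e) phi, for e the odd direction d: U(ae) phi = phi + a psi for all
   odd a. The equality is tested at real values of the even variables, where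
   vectors are defined (almost everywhere). *)
Definition odd_generator (d : odd_dir k l) phi psi : Prop :=
  hs psi /\
  forall a : A, sa_part true a ->
  {ae lebesgue_row R m, forall q : 'rV[R]_m, forall theta, odd_values theta ->
    super_rep U (odd_point m d a) phi (fun i => (q ord0 i)%:A) theta =
    eval_superfun phi (fun i => (q ord0 i)%:A) theta +
    cplx_re a * eval_superfun psi (fun i => (q ord0 i)%:A) theta}.

Definition graded_irreducible : Prop :=
  ~ exists F : set (superfun R m (r + s)),
    let Fsmooth phi := F phi /\ smooth_vector (body_rep U) phi in
    [/\ closed_subspace F, graded_subspace F,
        (exists2 phi, F phi & ~ hs_eq phi 0) /\ (exists2 phi, hs phi & ~ F phi),
        forall g phi, F phi -> F (body_rep U g phi)
      & (forall X phi psi, Fsmooth phi -> even_generator X phi psi ->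
           Fsmooth psi) /\
        (forall d phi psi, Fsmooth phi -> odd_generator d phi psi ->
           Fsmooth psi)].

End GradedIrreducible.

Section Schroedinger.
Variables (R : realType) (A : superalgebra R) (hbar : R) (m : nat).

Definition zeta_dim (K L : nat) : nat := (xi_dim K L)./2. (* s *)

(* Schroedinger representation of H_{2m|K,L}, for K + L even. *)
Section EvenCase.
Variables (K L : nat).
Local Notation r := (qp_odd_dim K L).
Local Notation s := (zeta_dim K L).

Definition heis_zeta (g : heis A m K L) (c : nat) : cplx A :=
  (hxi_at g c, hxi_at g (c + s)).

Definition schroedinger_body (g : heis_body R m) (phi : superfun R m (r + s)) :
    superfun R m (r + s) :=
  let: (q, p, t) := g in fun q0 I =>
  expC (Complex 0 (hbar *
    (t + \sum_i (2^-1 * q ord0 i - q0 ord0 i) * p ord0 i))) * phi (q0 - q) I.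

Definition schroedinger_super (g : heis A m K L) (phi : superfun R m (r + s)) :
    pointfun A m (r + s) := fun x theta =>
  let half : cplx A := of_complex A (Complex 2^-1 0) in
  let q0 (i : 'I_(m + r)) :=
    match fintype.split i with inl j => cplx_re (x j) | inr j => theta (lshift s j) end in
  let zeta0 (c : 'I_s) := theta (rshift r c) in
  let phase : cplx A :=
    cplx_re (ht g) +
    \sum_i (half * cplx_re (hq g i) - q0 i) * cplx_re (hp g i) +
    of_complex A (Complex (heis_sign R K L / 2) 0) *
      \sum_(c < s) (half * heis_zeta g c - zeta0 c) * cplx_conj (heis_zeta g c) in
  super_exp (of_complex A (Complex 0 hbar) * phase) *
  eval_superfun phi (fun j => x j - hq g (lshift r j))
    (fun i => match fintype.split i with
              | inl j => theta i - cplx_re (hq g (rshift m j))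
              | inr c => theta i - heis_zeta g c
              end).

Definition schroedinger_even : superrep A m K L (r + s) :=
  Superrep schroedinger_body schroedinger_super.

End EvenCase.

(* Restriction to H_{2m|k,l}, for k + l odd, of the representation of
   H_{2m|k+1,l} (if [plus]) or H_{2m|k,l+1} (otherwise). All these supergroups
   have the same body. *)
Definition over_plus (k : nat) (plus : bool) : nat := (k + plus)%N.
Definition over_minus (l : nat) (plus : bool) : nat := (l + ~~ plus)%N.

Definition schroedinger_odd (k l : nat) (plus : bool) :=
  let U := schroedinger_even (over_plus k plus) (over_minus l plus) in
  @Superrep R A m k l
    (qp_odd_dim (over_plus k plus) (over_minus l plus) +
     zeta_dim (over_plus k plus) (over_minus l plus))
    (body_rep U)
    (fun g => super_rep U (heis_incl (over_plus k plus) (over_minus l plus) g)).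

End Schroedinger.
Section BodyRestriction.
Variables (R : realType) (A : superalgebra R).

Lemma sa_body_scalar (c : R) : sa_body A c%:A = c.
Proof. by rewrite linearZ rmorph1 /= -[_ *: _]/(c * 1) mulr1. Qed.

Lemma nil_part_scalar (c : R) : nil_part (c%:A : A) = 0.
Proof. by rewrite /nil_part sa_body_scalar subrr. Qed.

Lemma of_complexM (c d : R[i]) :
  of_complex A (c * d) = of_complex A c * of_complex A d.
Proof.
case: c d => [a b] [c d].
apply/pair_equal_spec; split => /=.
  by rewrite -!scalerAl !mul1r !scalerA -scalerBl.
by rewrite -!scalerAl !mul1r !scalerA -scalerDl.
Qed.

Lemma of_complexD (c d : R[i]) :
  of_complex A (c + d) = of_complex A c + of_complex A d.
Proof.
case: c d => [a b] [c d].
by apply/pair_equal_spec; split => /=; rewrite scalerDl.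
Qed.

Lemma of_complex1 : of_complex A 1 = 1.
Proof. by apply/pair_equal_spec; split => /=; rewrite ?scale1r ?scale0r. Qed.

Lemma of_complex0 : of_complex A 0 = 0.
Proof. by apply/pair_equal_spec; split => /=; rewrite scale0r. Qed.

Lemma of_complex_sum n (f : 'I_n -> R[i]) :
  of_complex A (\sum_i f i) = \sum_i of_complex A (f i).
Proof.
by elim/big_rec2: _ => [|i y z _ <-]; [exact: of_complex0|rewrite of_complexD].
Qed.

Lemma cplx_re_scalar (c : R) : cplx_re (c%:A : A) = of_complex A (Complex c 0).
Proof. by rewrite /of_complex /= scale0r. Qed.

Lemma cplx_body_of_complex (c : R[i]) : cplx_body (of_complex A c) = c.
Proof. by case: c => a b; rewrite /cplx_body /= !sa_body_scalar. Qed.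

Let first_term (P : nat -> Prop) (f : nat -> cplx A) :
  ~ P 0%N -> P 1%N -> (forall k, (0 < k)%N -> f k = 0) ->
  \sum_(k < xget 0%N [set K | P K]) f k = f 0%N.
Proof.
move=> P0 P1 f0; have := xgetI 0%N (P1 : [set K | P K] 1%N).
case: (xget _ _) => [//|K] _.
by rewrite big_ord_recl big1 ?addr0 // => i _; exact: f0.
Qed.

Lemma super_exp_scalar (c : R[i]) :
  super_exp (of_complex A c) = of_complex A (expC c).
Proof.
rewrite /super_exp cplx_body_of_complex subrr.
rewrite (first_term (P := fun K => (0 : cplx A) ^+ K = 0)
  (f := fun k => of_complex A (k`!%:R^-1) * (0 : cplx A) ^+ k)).
- by rewrite fact0 invr1 of_complex1 expr0 !mulr1.
- by rewrite expr0; apply/eqP; exact: oner_neq0.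
- by rewrite expr1.
- by move=> k k0; rewrite expr0n eqn0Ngt k0 mulr0.
Qed.

Lemma even_ext_real m (f : 'rV[R]_m -> R[i]) (q : 'rV[R]_m) :
  even_ext f (fun i => (q ord0 i)%:A : A) = of_complex A (f q).
Proof.
have prod0 k (w : k.-tuple 'I_m) : (0 < k)%N ->
    \prod_(i <- w) nil_part ((q ord0 i)%:A : A) = 0.
  case: k w => // k w _; rewrite (tuple_eta w) /= big_cons.
  by rewrite nil_part_scalar mul0r.
rewrite /even_ext.
rewrite (first_term
  (P := fun K => forall w : K.-tuple 'I_m,
     \prod_(i <- w) nil_part ((q ord0 i)%:A : A) = 0)
  (f := fun k => \sum_(w : k.-tuple 'I_m) of_complex A (k`!%:R^-1 *
      foldr (@partial_der R m) f w
        (\row_i (sa_body A (q ord0 i)%:A : R))) *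
    cplx_re (\prod_(i <- w) nil_part ((q ord0 i)%:A : A)))).
- rewrite (bigD1 [tuple]) //= [X in _ + X = _]big1 ?addr0.
    rewrite fact0 invr1 mul1r.
    rewrite (_ : \prod_(i <- _) _ = 1 :> A); last exact: big_nil.
    rewrite [X in _ * X](_ : _ = 1) ?mulr1 //.
    congr (of_complex A (f _)).
    by apply/rowP => i; rewrite mxE sa_body_scalar.
  by move=> w /eqP[]; exact: tuple0.
- move=> /(_ [tuple]) /eqP.
  by rewrite (_ : \prod_(i <- _) _ = 1 :> A) ?oner_eq0 //; exact: big_nil.
- by move=> w; exact: prod0.
- move=> k k0; apply: big1 => w _; rewrite prod0 //.
  by rewrite [X in _ * X](_ : _ = 0) ?mulr0 //.
Qed.

Lemma schroedinger_super_body (hbar : R) m K L (g : heis_body R m)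
    (phi : superfun R m (qp_odd_dim K L + zeta_dim K L)) (x : 'rV[R]_m)
    (theta : 'I_(qp_odd_dim K L + zeta_dim K L) -> cplx A) :
  schroedinger_super hbar (of_body A K L g) phi (fun i => (x ord0 i)%:A) theta =
  eval_superfun (schroedinger_body hbar g phi) (fun i => (x ord0 i)%:A) theta.
Proof.
case: g => [[q p] t]; rewrite /schroedinger_super.
set phase := (X in super_exp (_ * X)).
have zeta0 c : heis_zeta (of_body A K L ((q, p), t)) c = 0.
  rewrite /heis_zeta /hxi_at /coord_at /=.
  by do 2 case: insub => //=.
have -> : phase = of_complex A (Complex
    (t + \sum_i (2^-1 * q ord0 i - x ord0 i) * p ord0 i) 0).
  rewrite /phase [X in _ * X]big1 ?mulr0 ?addr0; last first.
    move=> c _; rewrite zeta0 [cplx_conj 0](_ : _ = 0) ?mulr0 //.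
    by rewrite /cplx_conj oppr0.
  rewrite [cplx_re _]cplx_re_scalar.
  rewrite big_split_ord /= [X in _ + (_ + X)]big1 ?addr0; last first.
    move=> j _; rewrite (unsplitK (inr j : 'I_m + _)).
    by rewrite [cplx_re 0](_ : _ = 0 :> cplx A) ?mulr0.
  rewrite [RHS](_ : _ = of_complex A (Complex t 0 +
    \sum_i Complex ((2^-1 * q ord0 i - x ord0 i) * p ord0 i) 0)).
    rewrite of_complexD of_complex_sum; congr (_ + _); apply: eq_bigr => i _.
    rewrite (unsplitK (inl i : _ + 'I_(qp_odd_dim K L))) !cplx_re_scalar.
    rewrite -of_complexM.
    rewrite (_ : of_complex A (Complex (x ord0 i) 0) =
       - of_complex A (Complex (- x ord0 i) 0)); last first.
      by apply/pair_equal_spec; split => /=; rewrite ?scaleNr ?opprK ?scale0r ?oppr0.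
    rewrite opprK -of_complexD -of_complexM; congr (of_complex A _).
    by apply/eqP; rewrite eq_complex /=; apply/andP; split; apply/eqP; ring.
  rewrite (_ : \sum_i Complex _ _ =
    Complex (\sum_i (2^-1 * q ord0 i - x ord0 i) * p ord0 i) 0).
    congr (of_complex A _).
    by apply/eqP; rewrite eq_complex /= addr0 !eqxx.
  elim/big_rec2: _ => [//|i y z _ ->].
  by apply/eqP; rewrite eq_complex /= addr0 !eqxx.
rewrite -of_complexM super_exp_scalar /eval_superfun mulr_sumr.
apply: eq_bigr => I _; rewrite mulrA even_ext_real; congr (_ * _).
  rewrite (_ : (fun j => _) = fun j => ((x - q) ord0 j)%:A); last first.
    apply/funext => j; rewrite /= (unsplitK (inl j : _ + 'I_(qp_odd_dim K L))).
    by rewrite !mxE scalerBl.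
  rewrite even_ext_real -of_complexM; congr (of_complex A (expC _ * _)).
  by apply/eqP; rewrite eq_complex /= !mul0r !mulr0 subr0 add0r !eqxx.
apply: eq_bigr => i _; case: fintype.splitP => j _.
  rewrite /= (unsplitK (inr j : 'I_m + _)).
  by rewrite [cplx_re 0](_ : _ = 0 :> cplx A) // subr0.
by rewrite zeta0 subr0.
Qed.

End BodyRestriction.

(* [schroedinger_choice sigma k l plus]: the restriction with sign [plus] is
   the Schroedinger representation of parity sigma of H_{2m|k,l}. The
   usual rule, transcribed first, selects the same supergroup for both parities and
   matches the parity r mod 2 of the space for sigma = 0 only (see
   [qp_odd_dim_over]). For sigma = 1 both the representation it selects and the
   one whose space has parity 1 are therefore allowed. *)
Definition schroedinger_choice (sigma : bool) (k l : nat) (plus : bool) : bool :=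
  let M := maxn k l.+1 in
  (plus == if sigma then (if odd M then true else false)
           else (if ~~ odd M then false else true)) ||
  (odd (qp_odd_dim (over_plus k plus) (over_minus l plus)) == sigma).

Lemma qp_odd_dim_over (k l : nat) (plus : bool) : odd (k + l) ->
  odd (qp_odd_dim (over_plus k plus) (over_minus l plus)) =
  plus (+) odd (maxn k l.+1).
Proof.
rewrite /qp_odd_dim /over_plus /over_minus oddD /minn /maxn.
case: plus; rewrite /= ?addn0 ?addn1; case: (ltngtP k l) => kl; rewrite ?kl;
  do ?[case: ltnP => ?] => //=; by case: (odd k); case: (odd l).
Qed.

Lemma schroedinger_choice0 (k l : nat) (plus : bool) : odd (k + l) ->
  schroedinger_choice false k l plus = (plus == odd (maxn k l.+1)).
Proof.
move=> kl; rewrite /schroedinger_choice qp_odd_dim_over //.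
by case: plus; case: (odd _).
Qed.

(* Main.v *)
From HB Require Import structures.
Require Import Defs.
From mathcomp Require Import all_boot all_order all_algebra.
From mathcomp Require Import complex ring lra zify.
From mathcomp Require Import all_classical all_reals all_analysis measurable_realfun.
Set Implicit Arguments.
Unset Strict Implicit.
Unset Printing Implicit Defensive.
Import Order.TTheory GRing.Theory Num.Theory.
Import numFieldNormedType.Exports.
Local Open Scope classical_set_scope.
Local Open Scope ring_scope.

(* Let F be a closed graded invariant subspace. The functions h with h F in F
   form an algebra closed under bounded pointwise limits; modulations put the
   sin (a x_i + b) in it, hence signs of coordinates, indicators of Borel sets
   and all bounded measurable functions. Together with translations, averaging
   gives g (x) v in F, where g is a Gaussian and v is the mean of g phi, for
   every phi in F; and g (x) v in F implies f (x) v in F for all f in L^2. So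
   F = L^2 (x) V with V a graded subspace of the exterior algebra. The vectors
   g (x) v are smooth, and an odd direction acts on them by a Clifford
   generator on v. In suitable odd coordinates the k + l generators give all
   creation and annihilation operators but for one index, for which only one
   mixture of the two is available; the grading supplies what is missing, and
   V is zero or everything. *)

(** * Fermionic Fock space *)

(** The grading is what makes the finite-dimensional part work. With N = r + s there are k + l = 2N
    - 1 odd generators; in diagonal coordinates their product is odd, commutes with each of them and
    squares to a nonzero scalar, so its eigenspaces are invariant proper subspaces, which are not
    graded. The projection on the even part makes up for the generator lost in the restriction. On
    the analytic side, an element of F need not be smooth nor a product, while the odd directions
    act on smooth vectors only; Gaussian tensors supply explicit smooth vectors on which the odd
    action does not touch the Gaussian factor. The plain average of phi over translations has no
    meaning in L^2: the weight g(x + a) makes the mean converge, the weight g(x) brings the result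
    back into L^2, and together they leave a bound integrable in the translation a. *)

Section Fock.
Variables (C : fieldType) (n : nat).
Implicit Types (i k : 'I_n) (I J : {set 'I_n}) (v : {set 'I_n} -> C).

(** Sign of moving the odd variable [i] past the variables of smaller index in [J]. The ring is a
    parameter because the sign is needed both among coefficients and in [cplx A]. *)
Definition fsign (S : pzRingType) i J : S := (-1) ^+ #|[set j in J | (j < i)%N]|.

(** On coefficients of the exterior algebra, [create] is left multiplication by the variable [i] and
    [annihilate] is the left derivative with respect to it. *)
Definition create i v J : C := if i \in J then fsign C i J * v (J :\ i) else 0.
Definition annihilate i v J : C :=
  if i \in J then 0 else fsign C i J * v (i |: J).

Lemma fsign_sqr (S : pzRingType) i J : fsign S i J * fsign S i J = 1.
Proof. by rewrite /fsign -expr2 sqrr_sign. Qed.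

Lemma fsignU1 (S : pzRingType) i k J : k \notin J ->
  fsign S i (k |: J) = (-1) ^+ (k < i)%N * fsign S i J.
Proof.
move=> kJ; rewrite /fsign -exprD; congr (_ ^+ _).
case: (ltnP k i) => ki.
  rewrite (_ : [set _ in _ | _] = k |: [set j in J | (j < i)%N]).
    by rewrite cardsU1 !inE (negPf kJ).
  apply/setP => j; rewrite !inE; case: eqP => [->|] //=; by rewrite ki.
rewrite add0n; apply: eq_card => j; rewrite !inE.
by case: eqP => [->|] //=; rewrite (negPf kJ) ltnNge ki.
Qed.

Lemma fsignD1 (S : pzRingType) i J : fsign S i (J :\ i) = fsign S i J.
Proof.
rewrite /fsign; congr (_ ^+ _); apply: eq_card => j; rewrite !inE.
by case: eqP => [->|] //=; rewrite ltnn andbF.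
Qed.

(** Canonical anticommutation relation. For i = k exactly one of the two terms is present. For
    distinct indices both terms reach the same set, and their signs are opposite because exactly one
    of k < i and i < k holds. *)
Lemma annihilate_create i k v J :
  annihilate i (create k v) J + create k (annihilate i v) J = (i == k)%:R * v J.
Proof.
rewrite /annihilate /create.
have [<-|ik] := eqVneq i k.
  have [iJ|iJ] := boolP (i \in J).
    by rewrite finset.setD11 fsignD1 finset.setD1K // mulrA fsign_sqr add0r.
  by rewrite finset.setU11 fsignU1 // ltnn expr0 mul1r mulrA fsign_sqr finset.setU1K // addr0.
rewrite mul0r.
have [iJ|iJ] := boolP (i \in J).
  by case: ifP => kJ; rewrite ?addr0 // !inE ik iJ mulr0 add0r.
rewrite !inE [k == i]eq_sym (negPf ik) /=.
have [kJ|kJ] := boolP (k \in J); last by rewrite mulr0 addr0.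
rewrite (negPf iJ) /=.
have -> : (i |: J) :\ k = i |: (J :\ k).
  by apply/setP => j; rewrite !inE; case: (eqVneq j i) => [->|]; rewrite ?ik.
rewrite !mulrA -mulrDl fsignU1 //.
have -> : fsign C i J = (-1) ^+ (k < i)%N * fsign C i (J :\ k).
  by rewrite -fsignU1 ?finset.setD11 // finset.setD1K.
set s := fsign C i _; set t := fsign C k J.
rewrite (_ : _ + _ = ((-1) ^+ (k < i)%N * (-1) ^+ (i < k)%N + 1) * (s * t)); last by ring.
have -> : (-1) ^+ (k < i)%N * (-1) ^+ (i < k)%N = -1 :> C.
  case: (ltngtP i k) => [_|_|/val_inj /eqP]; rewrite ?mul1r ?mulr1 //.
  by rewrite (negPf ik).
by rewrite addNr !mul0r.
Qed.

End Fock.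

(** * Points of the supergroup *)

Section OddElements.
Variables (R : realType) (A : superalgebra R).
Local Notation S := (cplx A).
Local Notation oc := (of_complex A).
Implicit Types (x y z : S) (a b : A).

Lemma of_complexC c z : oc c * z = z * oc c.
Proof.
by case: z => a b; apply/pair_equal_spec; split => /=;
  rewrite -!scalerAl -!scalerAr !mul1r !mulr1 // addrC.
Qed.

Lemma of_complexN c : oc (- c) = - oc c.
Proof. by case: c => a b; apply/pair_equal_spec; split => /=; rewrite scaleNr. Qed.

Lemma of_complex_suml (I : Type) (r : seq I) (P : pred I) (f : I -> R[i]) :
  oc (\sum_(i <- r | P i) f i) = \sum_(i <- r | P i) oc (f i).
Proof. by elim/big_rec2: _ => [|i y z _ <-]; [exact: of_complex0|rewrite of_complexD]. Qed.

Lemma of_complex_re (c : R) a : oc c%:C%C * cplx_re a = cplx_re (c *: a).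
Proof.
by apply/pair_equal_spec; split => /=;
  rewrite scale0r ?mulr0 ?mul0r ?subr0 ?addr0 // -scalerAl mul1r.
Qed.

Definition odd_cplx z := sa_part true z.1 /\ sa_part true z.2.

Lemma sa_partN e a : sa_part e a -> sa_part e (- a).
Proof. by move=> ea; rewrite -scaleN1r; exact: sa_partZ. Qed.

Lemma odd_cplx_re a : sa_part true a -> odd_cplx (cplx_re a).
Proof. by move=> oa; split => //=; exact: sa_part0. Qed.

Lemma odd_cplxD x y : odd_cplx x -> odd_cplx y -> odd_cplx (x + y).
Proof. by move=> [? ?] [? ?]; split; exact: sa_partD. Qed.

Lemma odd_cplxZ c x : odd_cplx x -> odd_cplx (oc c * x).
Proof.
case: x => x1 x2 [/= o1 o2]; split => /=; rewrite -!scalerAl !mul1r.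
  by apply: sa_partB; exact: sa_partZ.
by apply: sa_partD; exact: sa_partZ.
Qed.

Lemma odd_cplxN x : odd_cplx x -> odd_cplx (- x).
Proof. by move=> [? ?]; split; exact: sa_partN. Qed.

Lemma odd_mulC a b : sa_part true a -> sa_part true b -> a * b = - (b * a).
Proof. by move=> oa ob; rewrite (sa_comm oa ob) expr1 mulN1r. Qed.

Lemma odd_sqr a : sa_part true a -> a * a = 0.
Proof.
move=> oa; have /eqP := odd_mulC oa oa; rewrite -addr_eq0 => /eqP aa.
have : 2^-1 *: (a * a + a * a) = 0 by rewrite aa scaler0.
by rewrite -mulr2n -(scaler_nat (2 : nat) (a * a) : (2%:R : R) *: _ = _) scalerA mulVf ?scale1r // pnatr_eq0.
Qed.

Lemma odd_cplx_mulC x y : odd_cplx x -> odd_cplx y -> x * y = - (y * x).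
Proof.
case: x y => [x1 x2] [y1 y2] [/= ox1 ox2] [/= oy1 oy2].
apply/pair_equal_spec; split => /=.
  by rewrite (odd_mulC ox1 oy1) (odd_mulC ox2 oy2) opprB opprK addrC.
by rewrite (odd_mulC ox1 oy2) (odd_mulC ox2 oy1) opprD addrC.
Qed.

Lemma odd_cplx_sqr x : odd_cplx x -> x * x = 0.
Proof.
case: x => [x1 x2] [/= ox1 ox2]; apply/pair_equal_spec; split => /=.
  by rewrite !odd_sqr // subrr.
by rewrite (odd_mulC ox1 ox2) addNr.
Qed.

Lemma sa_body_odd a : sa_part true a -> sa_body A a = 0.
Proof. by move=> oa; apply/sa_bodyP; exists 2%N; rewrite expr2 odd_sqr. Qed.

Variable n : nat.
Implicit Types (theta : 'I_n -> S) (v : {set 'I_n} -> R[i]) (I J : {set 'I_n}).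

(** [theta k] travels along the sorted list of indices and changes sign at each element of [J] below
    [k]; sortedness guarantees that none is left to cross once [k] is reached. *)
Lemma mul_odd_prod theta k J : (forall i, odd_cplx (theta i)) -> k \notin J ->
  theta k * \prod_(i in J) theta i = fsign S k J * \prod_(i in k |: J) theta i.
Proof.
move=> otheta kJ.
have main (s : seq 'I_n) : sorted ltn (map val s) -> k \in s ->
    theta k * \prod_(i <- s | i \in J) theta i =
    (-1) ^+ count (fun j => (j \in J) && (j < k)%N) s *
      \prod_(i <- s | i \in k |: J) theta i.
  elim: s => // x s IH; rewrite /= inE => xs.
  have lts (y : 'I_n) : y \in s -> (x < y)%N.
    move: xs; rewrite (path_sortedE ltn_trans) => /andP[/allP xs _] ys.
    by apply: xs; exact: map_f.
  rewrite !big_cons; have [xk|kx] := eqVneq x k; [move=> _; subst x|].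
  - have ks : k \notin s by apply/negP => /lts; rewrite ltnn.
    rewrite (negPf kJ) finset.setU11 /= (eq_in_count (a2 := pred0)) ?count_pred0.
      rewrite mul1r; congr (_ * _); rewrite big_seq_cond [RHS]big_seq_cond.
      apply: eq_bigl => j; rewrite !inE; have [->|//] := eqVneq j k.
      by rewrite (negPf ks).
    by move=> j /lts kj; rewrite ltnNge ltnW // andbF.
  rewrite /= => ks; have xk := lts _ ks.
  rewrite !inE (negPf kx) xk /=; have {}IH := IH (path_sorted xs) ks.
  case: ifP => //= xJ; rewrite mulrA (odd_cplx_mulC (otheta k) (otheta x)) mulNr -mulrA IH.
  by rewrite add1n exprS mulN1r mulNr !mulrA; congr (- (_ * _)); apply: commr_sign.
have := main (index_enum 'I_n); rewrite mem_index_enum => ->//.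
  rewrite /fsign; congr ((-1) ^+ _ * _); rewrite cardE size_filter.
  rewrite -[index_enum _]/(Finite.enum _) -enumT; apply: eq_count => j.
  by rewrite !inE.
by rewrite -[index_enum _]/(Finite.enum _) -enumT val_enum_ord iota_ltn_sorted.
Qed.

Definition grassmann_eval theta v : S := \sum_I oc (v I) * \prod_(i in I) theta i.
Local Notation ev := grassmann_eval.

Lemma grassmann_evalD theta v w : ev theta (v + w) = ev theta v + ev theta w.
Proof. by rewrite -big_split; apply: eq_bigr => I _; rewrite of_complexD mulrDl. Qed.

Lemma grassmann_evalZ theta c v : ev theta (fun I => c * v I) = oc c * ev theta v.
Proof. by rewrite mulr_sumr; apply: eq_bigr => I _; rewrite of_complexM mulrA. Qed.

Lemma grassmann_eval_sum theta (T : finType) (f : T -> {set 'I_n} -> R[i]) :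
  ev theta (fun I => \sum_t f t I) = \sum_t ev theta (f t).
Proof.
rewrite exchange_big; apply: eq_bigr => I _.
by rewrite of_complex_suml mulr_suml.
Qed.

Lemma fsign_of_complex i J : oc (fsign R[i] i J) = fsign S i J.
Proof.
rewrite /fsign; elim: #|_| => [|e IH]; first by rewrite !expr0 of_complex1.
by rewrite !exprS of_complexM IH !mulN1r of_complexN of_complex1 mulN1r.
Qed.

(** Terms whose set contains [k] vanish because [theta k] squares to 0; the others correspond to the
    nonzero coefficients of [create k v] by adding [k] to the set. *)
Lemma grassmann_eval_create theta k v : (forall i, odd_cplx (theta i)) ->
  theta k * ev theta v = ev theta (create k v).
Proof.
move=> otheta; rewrite /ev mulr_sumr.
rewrite (bigID (fun I : {set 'I_n} => k \in I)) /= big1 ?add0r; last first.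
  move=> I kI; rewrite mulrA -of_complexC -mulrA.
  have := mul_odd_prod otheta (J := I :\ k) (k := k).
  rewrite finset.setD11 finset.setD1K // => /(_ isT) E.
  have -> : \prod_(i in I) theta i =
      fsign S k (I :\ k) * (theta k * \prod_(i in I :\ k) theta i).
    by rewrite E mulrA fsign_sqr mul1r.
  rewrite -fsign_of_complex (mulrA (theta k)) -of_complexC -mulrA (mulrA (theta k)).
  by rewrite odd_cplx_sqr // mul0r !mulr0.
rewrite [RHS](bigID (fun I : {set 'I_n} => k \in I)) /= [X in _ + X]big1 ?addr0; last first.
  by move=> I kI; rewrite /create (negPf kI) of_complex0 mul0r.
rewrite [RHS](reindex_onto (fun J => k |: J) (fun I => I :\ k)) /=; last first.
  by move=> I kI; rewrite finset.setD1K.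
apply: eq_big => [I|I kI].
  rewrite finset.setU11 /=; apply/idP/eqP => [kI|<-]; first by rewrite finset.setU1K.
  by rewrite finset.setD11.
rewrite /create finset.setU11 finset.setU1K // mulrA -of_complexC -mulrA.
rewrite mul_odd_prod // mulrA fsignU1 // ltnn mul1r of_complexM fsign_of_complex.
by rewrite -fsign_of_complex [_ * oc (v I)]of_complexC.
Qed.

(* The set of v for which this holds contains the vacuum and is stable under
   [create k], by [grassmann_eval_create] for the shifted variables, which are odd
   too, and [annihilate_create]. *)
Lemma grassmann_eval_shift theta tau a v :
  (forall i, odd_cplx (theta i)) -> sa_part true a ->
  ev (fun i => theta i - cplx_re a * oc (tau i)) v =
  ev theta v - cplx_re a * ev theta (fun I => \sum_i tau i * annihilate i v I).
Proof.
move=> otheta oa; set theta' := fun i => _.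
have oa' := odd_cplx_re oa.
have otheta' i : odd_cplx (theta' i).
  by apply/odd_cplxD/odd_cplxN => //; rewrite -of_complexC; exact: odd_cplxZ.
pose good v := ev theta' v =
  ev theta v - cplx_re a * ev theta (fun I => \sum_i tau i * annihilate i v I).
rewrite -/(good v).
have goodZ c w : good w -> good (fun I => c * w I).
  rewrite /good !grassmann_evalZ => ->; rewrite mulrBr; congr (_ - _).
  rewrite !mulrA of_complexC -mulrA -grassmann_evalZ; congr (_ * _).
  congr (ev _ _); apply/funext => I; rewrite mulr_sumr; apply: eq_bigr => i _.
  by rewrite /annihilate; case: ifP; rewrite ?mulr0 // => _; ring.
have good_create k w : good w -> good (create k w).
  rewrite /good -(grassmann_eval_create k w otheta') -(grassmann_eval_create k w otheta) => ->.
  rewrite /theta' mulrBl !mulrBr.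
  have aa : cplx_re a * oc (tau k) * (cplx_re a *
      ev theta (fun I => \sum_i tau i * annihilate i w I)) = 0.
    rewrite -of_complexC -mulrA (mulrA (cplx_re a)).
    by rewrite odd_cplx_sqr // mul0r mulr0.
  rewrite aa subr0 -addrA -opprD; congr (_ - _).
  rewrite mulrA (odd_cplx_mulC (otheta k) oa') mulNr -!mulrA -mulrN -mulrDr; congr (_ * _).
  rewrite grassmann_eval_create // -!grassmann_evalZ addrC -[X in _ - X]mul1r -mulNr.
  rewrite -[-1]/(- (1 : S)) -of_complex1 -of_complexN -grassmann_evalZ -grassmann_evalD.
  congr (ev _ _); apply/funext => I.
  rewrite -[LHS]/(_ + _) /create.
  transitivity (\sum_i tau i * ((i == k)%:R * w I) - create k (fun I => \sum_i tau i * annihilate i w I) I).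
    rewrite (_ : \sum_i tau i * ((i == k)%:R * w I) = tau k * w I) ?mulN1r //.
    rewrite (bigD1 k) //= eqxx mul1r big1 ?addr0 // => i ik.
    by rewrite (negPf ik) mul0r mulr0.
  rewrite /create; case: ifP => kI; last first.
    rewrite subr0; apply: eq_bigr => i _; congr (_ * _).
    by rewrite -annihilate_create /create kI addr0.
  rewrite mulr_sumr -sumrB; apply: eq_bigr => i _.
  by rewrite -annihilate_create /create kI; ring.
have good_delta (J : {set 'I_n}) : good (fun I => (I == J)%:R).
  move: {2}#|J| (leqnn #|J|) => N; elim: N J => [|N IH] J.
    rewrite leqn0 cards_eq0 => /eqP ->; rewrite /good.
    have ev0 th : ev th (fun I => (I == finset.set0)%:R) = 1.
      rewrite /ev (bigD1 finset.set0) //= eqxx big_set0 mulr1 of_complex1.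
      by rewrite big1 ?addr0 // => I /negPf ->; rewrite of_complex0 mul0r.
    rewrite !ev0 [ev _ _]big1 ?mulr0 ?subr0 // => I _.
    rewrite big1 ?of_complex0 ?mul0r // => i _; rewrite /annihilate.
    case: ifP => _; rewrite ?mulr0 // (_ : (_ == _) = false) ?mulr0 //.
    by apply/eqP => /setP /(_ i); rewrite !inE eqxx.
  move=> JN; have [J0|[k kJ]] := set_0Vmem J.
    by apply: IH; rewrite J0 cards0.
  have -> : (fun I => (I == J)%:R) = fun I => fsign R[i] k J *
      create k (fun I => (I == J :\ k)%:R) I :> R[i].
    apply/funext => I; rewrite /create; case: ifP => kI; last first.
      by rewrite mulr0 (_ : (_ == _) = false) //; apply/eqP => IJ; rewrite IJ kJ in kI.
    have [->|IJ] := eqVneq I J; first by rewrite eqxx mulr1 fsign_sqr.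
    rewrite (_ : (_ == _) = false) ?mulr0 //; apply/eqP => IJk.
    by move: IJ; rewrite -(finset.setD1K kI) IJk finset.setD1K // eqxx.
  apply/goodZ/good_create/IH.
  by rewrite (cardsD1 k J) kJ in JN.
have -> : v = fun I => \sum_J v J * (I == J)%:R.
  apply/funext => I; rewrite (bigD1 I) //= eqxx mulr1 big1 ?addr0 // => J.
  by rewrite eq_sym => /negPf ->; rewrite mulr0.
have good0 : good (fun=> 0).
  have ev0 th : ev th (fun=> 0) = 0.
    by rewrite /ev big1 // => I _; rewrite of_complex0 mul0r.
  rewrite /good ev0 (_ : (fun I => _) = fun=> 0) ?ev0 ?mulr0 ?subr0 //.
  by apply/funext => I; rewrite big1 // => i _; rewrite /annihilate !mulr0 if_same mulr0.
have goodD w w' : good w -> good w' -> good (w + w').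
  rewrite /good !grassmann_evalD => -> ->.
  rewrite (_ : (fun I => \sum_i tau i * annihilate i (w + w') I) =
    (fun I => \sum_i tau i * annihilate i w I) + (fun I => \sum_i tau i * annihilate i w' I)).
    by rewrite grassmann_evalD mulrDr opprD addrACA.
  apply/funext => I; rewrite -[RHS]/(_ + _) -big_split; apply: eq_bigr => i _.
  rewrite /annihilate; case: ifP => _; first by rewrite !mulr0 /= addr0.
  by rewrite /= -!mulrDr.
rewrite (_ : (fun I => _) = \sum_J (fun I => v J * (I == J)%:R)).
  elim/big_ind: _ => [|w w'|J _]; [exact: good0|exact: goodD|].
  exact: (goodZ (v J) _ (good_delta J)).
by apply/funext => I; rewrite fct_sumE.
Qed.

End OddElements.

(** * Action of a point whose odd coordinates are multiples of one odd element *)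

Section OddAction.
Variables (R : realType) (A : superalgebra R).
Local Notation S := (cplx A).
Local Notation oc := (of_complex A).

Lemma expC0 : expC (0 : R[i]) = 1.
Proof. by rewrite /expC /= expR0 cos0 sin0 mul1r. Qed.

(** The truncation order picked by [xget] is unknown, hence the three cases: order 0 would give 1 =
    0, order 1 forces z = 0, and from order 2 on the extra powers vanish. *)
Lemma super_exp_sqr0 (z : S) : cplx_body z = 0 -> z * z = 0 ->
  super_exp z = 1 + z.
Proof.
move=> z0 zz; rewrite /super_exp z0 expC0 of_complex0 subr0 of_complex1 mul1r.
have zn k : (1 < k)%N -> z ^+ k = 0.
  by case: k => [|[|k]] // _; rewrite !exprS mulrA zz mul0r.
have /(xgetI 0%N) : [set K | z ^+ K = 0]%classic 2%N by exact: zn.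
case: (xget _ _) => [/eqP|[|K]] /=; first by rewrite expr0 oner_eq0.
  move=> z1; rewrite big_ord1 fact0 invr1 of_complex1 expr0 mulr1.
  by rewrite -[z]expr1 z1 addr0.
move=> _; rewrite !big_ord_recl /= big1 => [|i _]; last by rewrite zn ?mulr0.
by rewrite addr0 fact0 invr1 of_complex1 expr0 expr1 !mul1r.
Qed.

Lemma eval_superfun_real m n (phi : superfun R m n) (q : 'rV[R]_m)
    (theta : 'I_n -> S) :
  eval_superfun phi (fun i => (q ord0 i)%:A) theta = grassmann_eval theta (phi q).
Proof. by apply: eq_bigr => I _; rewrite even_ext_real. Qed.

Section Action.
Variables (hbar : R) (m K L : nat).
Local Notation r := (qp_odd_dim K L).
Local Notation s := (zeta_dim K L).
Variables (alpha beta : 'I_r -> R) (gamma : nat -> R).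

(** For odd coordinates q = alpha a, p = beta a, xi = gamma a, the variable theta_i is replaced by
    theta_i - a [shift_coef i], and the exponent becomes a times the sum of the [phase_coef i]
    theta_i. The minus signs of q0 and zeta0 in the phase disappear when a is moved to the left. *)
Definition shift_coef (i : 'I_(r + s)) : R[i] :=
  match fintype.split i with
  | inl j => (alpha j)%:C%C
  | inr c => Complex (gamma c) (gamma (c + s)%N)
  end.

Definition phase_coef (i : 'I_(r + s)) : R[i] :=
  Complex 0 hbar * match fintype.split i with
  | inl j => (beta j)%:C%C
  | inr c => (heis_sign R K L / 2)%:C%C * Complex (gamma c) (- gamma (c + s)%N)
  end.

Definition odd_action (v : {set 'I_(r + s)} -> R[i]) I : R[i] :=
  \sum_i (phase_coef i * create i v I - shift_coef i * annihilate i v I).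

(** Since [a] squares to 0, everything is of first order in it: the exponential is 1 + a Lam, the
    translation is the identity minus a times a derivative, and the cross term vanishes. *)
Lemma schroedinger_super_odd (g : heis A m K L) (a : A)
    (phi : superfun R m (r + s)) (q : 'rV[R]_m) theta :
  sa_part true a -> odd_values theta ->
  (forall j, hq g (lshift r j) = 0) -> (forall j, hp g (lshift r j) = 0) ->
  ht g = 0 ->
  (forall j, hq g (rshift m j) = alpha j *: a) ->
  (forall j, hp g (rshift m j) = beta j *: a) ->
  (forall c : 'I_s, hxi_at g c = gamma c *: a /\
     hxi_at g (c + s) = gamma (c + s)%N *: a) ->
  schroedinger_super hbar g phi (fun i => (q ord0 i)%:A) theta =
  eval_superfun phi (fun i => (q ord0 i)%:A) theta +
  cplx_re a * eval_superfun (fun q => odd_action (phi q)) (fun i => (q ord0 i)%:A) theta.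
Proof.
move=> oa [th1 th2] gq gp gt gq' gp' gx.
have otheta i : odd_cplx (theta i).
  rewrite -(splitK i); case: (fintype.split i) => j /=.
    by have [b ob ->] := th1 j; exact: odd_cplx_re.
  exact: th2.
have oa' := odd_cplx_re oa.
have zetaE (c : 'I_s) : heis_zeta g c = oc (Complex (gamma c) (gamma (c + s)%N)) * cplx_re a.
  have [gx1 gx2] := gx c; rewrite /heis_zeta gx1 gx2.
  by apply/pair_equal_spec; split => /=; rewrite -!scalerAl !mul1r !scaler0 ?subr0 ?add0r.
have zetaE' (c : 'I_s) : cplx_conj (heis_zeta g c) =
    oc (Complex (gamma c) (- gamma (c + s)%N)) * cplx_re a.
  rewrite zetaE; apply/pair_equal_spec.
  by split => /=; rewrite -!scalerAl !mul1r !scaler0 ?subr0 ?add0r // scaleNr.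
(* The term quadratic in [a] drops out, and moving [a] to the left past the odd [x] absorbs the
   minus sign. *)
have aux c d x : odd_cplx x ->
    (oc c * cplx_re a - x) * (oc d * cplx_re a) = cplx_re a * (oc d * x).
  move=> ox; rewrite (of_complexC d) mulrBl (mulrA (_ * _)) -(mulrA (oc c)).
  rewrite odd_cplx_sqr // mulr0 mul0r sub0r (mulrA x) (odd_cplx_mulC ox oa') mulNr opprK.
  by rewrite -mulrA -of_complexC.
rewrite /schroedinger_super.
set phase := (X in super_exp X).
set Lam := \sum_i oc (phase_coef i) * theta i.
have oLam : odd_cplx Lam.
  rewrite /Lam; elim/big_ind: _.
  - by split; exact: sa_part0.
  - by move=> *; exact: odd_cplxD.
  - by move=> i _; exact: odd_cplxZ.
have phaseE : phase = cplx_re a * Lam.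
  rewrite /phase /Lam gt add0r big_split_ord /= big1 ?add0r; last first.
    by move=> j _; rewrite gp mulr0.
  rewrite [X in _ = _ * X]big_split_ord /= !mulrDr.
  congr (_ + _).
    rewrite !mulr_sumr; apply: eq_bigr => j _.
    rewrite /phase_coef (unsplitK (inl j : 'I_r + 'I_s)) (unsplitK (inr j : 'I_m + 'I_r)).
    rewrite gq' gp' -!of_complex_re (mulrA _ (oc (alpha j)%:C%C)) -of_complexM aux //.
    by rewrite of_complexM !mulrA of_complexC.
  rewrite !mulr_sumr; apply: eq_bigr => c _.
  rewrite /phase_coef (unsplitK (inr c : 'I_r + 'I_s)).
  rewrite zetaE' zetaE (mulrA _ (oc (Complex (gamma c) (gamma (c + s)%N)))) -of_complexM aux //.
  by rewrite !of_complexM !mulrA; congr (_ * _ * _);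
    rewrite -mulrA (of_complexC _ (cplx_re a)) mulrA (of_complexC _ (cplx_re a)).
have -> : super_exp phase = 1 + cplx_re a * Lam.
  rewrite phaseE super_exp_sqr0 //.
    rewrite /cplx_body /= mul0r subr0 mul0r addr0.
    by rewrite !rmorphM /= sa_body_odd // !mul0r.
  by rewrite mulrA -(mulrA _ Lam) (odd_cplx_mulC oLam oa') mulrN mulrA odd_cplx_sqr // !mul0r oppr0 mul0r.
rewrite (_ : (fun j => _) = (fun j => (q ord0 j)%:A)); last first.
  by apply/funext => j; rewrite gq subr0.
rewrite !eval_superfun_real.
rewrite (_ : (fun i => _) = fun i => theta i - cplx_re a * oc (shift_coef i)); last first.
  apply/funext => i; rewrite /shift_coef; case: (fintype.split i) => j.
    by rewrite gq' -of_complexC of_complex_re.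
  by rewrite zetaE of_complexC.
rewrite grassmann_eval_shift //.
rewrite mulrDl mul1r mulrBr -(mulrA _ Lam (cplx_re a * _)) (mulrA Lam (cplx_re a)).
rewrite (odd_cplx_mulC oLam oa') mulNr mulrN !mulrA odd_cplx_sqr // !mul0r oppr0 subr0.
rewrite -addrA; congr (_ + _); rewrite addrC -mulrA -mulrBr; congr (_ * _).
rewrite /Lam mulr_suml -[X in _ - X]mul1r -mulNr -of_complex1 -of_complexN -grassmann_evalZ.
rewrite (eq_bigr (fun i => grassmann_eval theta
   (fun I => phase_coef i * create i (phi q) I))); last first.
  by move=> i _; rewrite -mulrA grassmann_eval_create // grassmann_evalZ.
rewrite -grassmann_eval_sum -grassmann_evalD; congr (grassmann_eval _ _).
by apply/funext => I; rewrite /odd_action sumrB -[LHS]/(_ + _) mulN1r.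
Qed.

End Action.
End OddAction.

(** * Irreducibility on the Fock space *)

Section FockIrreducible.
Variables (C : fieldType) (n : nat) (V : set ({set 'I_n} -> C)).
Implicit Types (i k : 'I_n) (I J : {set 'I_n}) (v : {set 'I_n} -> C).

Hypothesis V0 : V (fun=> 0).
Hypothesis VP : forall (c : C) v w, V v -> V w -> V (fun I => c * v I + w I).
Hypothesis V_even : forall v, V v -> V (fun I => if odd #|I| then 0 else v I).
Variable i0 : 'I_n.
Hypothesis V_create : forall i v, i != i0 -> V v -> V (create i v).
Hypothesis V_annihilate : forall i v, i != i0 -> V v -> V (annihilate i v).
Variables x y : C.
Hypotheses (x0 : x != 0) (y0 : y != 0).
Hypothesis V_mixed : forall v, V v ->
  V (fun I => x * create i0 v I + y * annihilate i0 v I).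

Let VZ c v : V v -> V (fun I => c * v I).
Proof.
move=> Vv; rewrite (_ : (fun I => _) = fun I => c * v I + (fun=> 0) I); first exact: VP.
by apply/funext => I; rewrite addr0.
Qed.

(** [create i] after [annihilate i] is the projection onto the sets containing [i], and the opposite
    composition is the projection onto those avoiding it. *)
Let V_proj i b v : i != i0 -> V v -> V (fun J => if (i \in J) == b then v J else 0).
Proof.
move=> ii0 Vv; case: b.
  rewrite (_ : (fun J => _) = create i (annihilate i v)).
    exact/V_create/V_annihilate.
  apply/funext => J; rewrite /create /annihilate; case: ifP => // /eqP iJ.
    by rewrite iJ finset.setD11 finset.setD1K // fsignD1 mulrA fsign_sqr mul1r.
  by case: ifP.
rewrite (_ : (fun J => _) = annihilate i (create i v)).
  exact/V_annihilate/V_create.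
apply/funext => J; rewrite /create /annihilate; case: ifP => [/eqP iJ|]; last by case: ifP.
by rewrite iJ finset.setU11 finset.setU1K ?iJ // fsignU1 ?iJ // ltnn mul1r mulrA fsign_sqr mul1r.
Qed.

(* The occupation numbers of all i != i0 and the parity determine the set I. *)
Let V_delta I v : V v -> V (fun J => if J == I then v J else 0).
Proof.
move=> Vv.
have all_but (s : seq 'I_n) : i0 \notin s ->
    V (fun J => if all (fun i => (i \in J) == (i \in I)) s then v J else 0).
  elim: s => [|i s IH] //=; rewrite inE negb_or => /andP[i0i i0s].
  have := V_proj (i \in I) (i := i) _ (IH i0s); rewrite eq_sym => /(_ i0i).
  by congr V; apply/funext => J; case: eqP.
have := all_but (rem i0 (enum 'I_n)).
rewrite mem_rem_uniq ?enum_uniq // inE eqxx => /(_ isT).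
set w := fun J => _ => Vw.
suff -> : (fun J => if J == I then v J else 0) =
    (fun J => if odd #|J| == odd #|I| then w J else 0).
  case oI : (odd #|I|); last by have := V_even Vw; congr V; apply/funext => J; case: odd.
  have := VP (-1) (V_even Vw) Vw; congr V; apply/funext => J.
  by case: odd; rewrite ?mulr0 ?add0r // mulN1r addNr.
apply/funext => J; rewrite /w; have [->|JI] := eqVneq J I.
  rewrite eqxx (_ : all _ _ = true) //.
  by apply/allP => i _.
case: eqP => // par; case: allP => // agree; exfalso.
have {}agree i : i != i0 -> (i \in J) = (i \in I).
  by move=> ii0; apply/eqP/agree; rewrite mem_rem_uniq ?enum_uniq // inE ii0 mem_enum.
have E : J :\ i0 = I :\ i0.
  by apply/setP => i; rewrite !inE; case: (eqVneq i i0) => //= /agree.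
have : (i0 \in J) = (i0 \in I).
  by move: par; rewrite (cardsD1 i0 J) (cardsD1 i0 I) E !oddD !oddb => /addIb.
move=> E0; case/eqP: JI; apply/setP => i.
by have [->|/agree] := eqVneq i i0.
Qed.

(** A nonzero coefficient puts a basis vector in [V]. On a basis vector one of the two terms of the
    mixed generator at [i0] vanishes, so there it acts as a nonzero multiple of a pure creation or
    annihilation. Hence one can go down to the vacuum and up again to every basis vector. *)
Lemma fock_irreducible v I : V v -> v I != 0 -> forall w, V w.
Proof.
move=> Vv vI0.
pose d J : {set 'I_n} -> C := fun J' => (J' == J)%:R.
have VdI : V (d I).
  have := VZ (v I)^-1 (V_delta I Vv); congr V; apply/funext => J; rewrite /d.
  by case: eqP => [->|]; rewrite ?mulr0 // mulVf.
have createE i J : i \notin J -> create i (d J) = fun J' => fsign C i J * d (i |: J) J'.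
  move=> iJ; apply/funext => J'; rewrite /create /d.
  have [->|JJ'] := eqVneq J' (i |: J).
    by rewrite finset.setU11 finset.setU1K // eqxx fsignU1 // ltnn mul1r.
  case: ifP => iJ'; rewrite ?mulr0 // (_ : (_ == _) = false) ?mulr0 //.
  by apply/eqP => E; move: JJ'; rewrite -E finset.setD1K // eqxx.
have annihilateE i J : i \in J -> annihilate i (d J) = fun J' => fsign C i J * d (J :\ i) J'.
  move=> iJ; apply/funext => J'; rewrite /annihilate /d.
  have [->|JJ'] := eqVneq J' (J :\ i).
    by rewrite finset.setD11 finset.setD1K // eqxx fsignD1.
  case: ifP => iJ'; rewrite ?mulr0 // (_ : (_ == _) = false) ?mulr0 //.
  by apply/eqP => E; move: JJ'; rewrite -E finset.setU1K ?eqxx ?iJ'.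
have create0 i J : i \in J -> create i (d J) = fun=> 0.
  move=> iJ; apply/funext => J'; rewrite /create /d.
  case: ifP => // _; rewrite (_ : (_ == _) = false) ?mulr0 //.
  by apply/eqP => E; move: iJ; rewrite -E finset.setD11.
have annihilate0 i J : i \notin J -> annihilate i (d J) = fun=> 0.
  move=> iJ; apply/funext => J'; rewrite /annihilate /d.
  case: ifP => // _; rewrite (_ : (_ == _) = false) ?mulr0 //.
  by apply/eqP => E; move: iJ; rewrite -E finset.setU11.
have sgn0 i J : fsign C i J != 0 by rewrite signr_eq0.
have VdZ c w : c != 0 -> V (fun J => c * w J) -> V w.
  move=> c0 /(VZ c^-1); congr V; apply/funext => J; by rewrite mulrA mulVf // mul1r.
have VU i J : i \notin J -> V (d J) -> V (d (i |: J)).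
  move=> iJ VJ; apply: (VdZ _ _ (sgn0 i J)); rewrite -createE //.
  have [ii0|/V_create/(_ VJ)//] := eqVneq i i0.
  apply: (VdZ _ _ x0); have := V_mixed VJ; rewrite -ii0 annihilate0 //.
  by congr V; apply/funext => J'; rewrite mulr0 addr0.
have VD i J : i \in J -> V (d J) -> V (d (J :\ i)).
  move=> iJ VJ; apply: (VdZ _ _ (sgn0 i J)); rewrite -annihilateE //.
  have [ii0|/V_annihilate/(_ VJ)//] := eqVneq i i0.
  apply: (VdZ _ _ y0); have := V_mixed VJ; rewrite -ii0 create0 //.
  by congr V; apply/funext => J'; rewrite mulr0 add0r.
have Vd0 : V (d finset.set0).
  move: {2}#|I| (leqnn #|I|) VdI => N; elim: N I {vI0} => [|N IH] J.
    by rewrite leqn0 cards_eq0 => /eqP ->.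
  move=> JN VJ; have [J0|[k kJ]] := set_0Vmem J; first by rewrite -J0.
  by apply: (IH (J :\ k)); [rewrite (cardsD1 k J) kJ in JN|exact: VD].
have Vd J : V (d J).
  move: {2}#|J| (leqnn #|J|) => N; elim: N J => [|N IH] J.
    by rewrite leqn0 cards_eq0 => /eqP ->.
  move=> JN; have [->//|[k kJ]] := set_0Vmem J.
  rewrite -(finset.setD1K kJ); apply: VU; first by rewrite finset.setD11.
  by apply: IH; rewrite (cardsD1 k J) kJ in JN.
move=> w; rewrite (_ : w = fun J => \sum_(J' <- enum {set 'I_n}) w J' * d J' J); last first.
  apply/funext => J; rewrite big_enum (bigD1 J) //= /d eqxx mulr1 big1 ?addr0 // => J'.
  by rewrite eq_sym => /negPf ->; rewrite mulr0.
elim: (enum _) => [|J s IH].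
  by rewrite (_ : (fun J => _) = fun=> 0) //; apply/funext => J; rewrite big_nil.
rewrite (_ : (fun J => _) = (fun J0 => w J * d J J0 + (fun J => \sum_(J' <- s) w J' * d J' J) J0)).
  exact: VP.
by apply/funext => J0; rewrite big_cons.
Qed.

End FockIrreducible.

(** * Odd directions *)

Section OddDirections.
Variables (R : realType) (k l : nat).
Local Notation r0 := (qp_odd_dim k l).
Local Notation w := ((Num.sqrt 2 : R)^-1).
Implicit Types (d : odd_dir k l) (n : nat).

(** The odd coordinates of [odd_point m d a] are these reals times a; [dir_plus] and [dir_minus] are
    the diagonal ones, and the [incl_] family belongs to the image under [heis_incl]. Indices are
    natural numbers, with value 0 out of range, to match [diag_plus] and [diag_minus]. *)
Definition dir_q d n : R := if d is inl (inl j) then (n == j)%:R else 0.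
Definition dir_p d n : R := if d is inl (inr j) then (n == j)%:R else 0.
Definition dir_xi d n : R := if d is inr c then (n == c)%:R else 0.

Definition dir_plus d n : R :=
  if (n < r0)%N then w * (dir_q d n + dir_p d n)
  else if (l < k)%N then dir_xi d (n - r0) else 0.
Definition dir_minus d n : R :=
  if (n < r0)%N then w * (dir_q d n - dir_p d n)
  else if (k < l)%N then dir_xi d (n - r0) else 0.

Definition incl_q d n : R := w * (dir_plus d n + dir_minus d n).
Definition incl_p d n : R := w * (dir_plus d n - dir_minus d n).
Definition incl_xi K L d n : R :=
  if (L <= K)%N then dir_plus d (qp_odd_dim K L + n)
  else dir_minus d (qp_odd_dim K L + n).

Variables (A : superalgebra R) (m : nat).
Implicit Types (a : A).

Lemma coord_at_lin n (f : 'I_n -> A) (g : nat -> R) a :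
  (forall j, f j = g j *: a) -> (forall j, (n <= j)%N -> g j = 0) ->
  forall j, coord_at f j = g j *: a.
Proof.
move=> fg g0 j; have [jn|nj] := ltnP j n; first by rewrite (coord_atE f (Ordinal jn)) fg.
by rewrite coord_at_out // g0 // scale0r.
Qed.

Let dirE (b : bool) (a : A) : (if b then a else 0) = b%:R *: a.
Proof. by case: b; rewrite ?scale1r ?scale0r. Qed.

Lemma hq_odd_point d a n : (n < r0)%N -> hq_odd (odd_point m d a) n = dir_q d n *: a.
Proof.
move=> nr; rewrite /hq_odd (coord_atE _ (Ordinal nr)) /=.
rewrite (unsplitK (inr (Ordinal nr) : 'I_m + _)) dirE /dir_q.
by case: d => [[j|j]|c] //=; rewrite ?scale0r // eq_sym.
Qed.

Lemma hp_odd_point d a n : (n < r0)%N -> hp_odd (odd_point m d a) n = dir_p d n *: a.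
Proof.
move=> nr; rewrite /hp_odd (coord_atE _ (Ordinal nr)) /=.
rewrite (unsplitK (inr (Ordinal nr) : 'I_m + _)) dirE /dir_p.
by case: d => [[j|j]|c] //=; rewrite ?scale0r // eq_sym.
Qed.

Lemma hxi_odd_point d a n : hxi_at (odd_point m d a) n = dir_xi d n *: a.
Proof.
apply: coord_at_lin => j /=; rewrite ?dirE /dir_xi.
  by case: d => [[i|i]|c] //=; rewrite ?scale0r // eq_sym.
by case: d => // c jn; rewrite gtn_eqF // (leq_trans (ltn_ord c)).
Qed.

Lemma diag_plus_odd_point d a n : diag_plus (odd_point m d a) n = dir_plus d n *: a.
Proof.
rewrite /diag_plus /dir_plus; case: ltnP => nr.
  by rewrite hq_odd_point // hp_odd_point // -scalerDl scalerA.
by case: ifP; rewrite ?scale0r // hxi_odd_point.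
Qed.

Lemma diag_minus_odd_point d a n : diag_minus (odd_point m d a) n = dir_minus d n *: a.
Proof.
rewrite /diag_minus /dir_minus; case: ltnP => nr.
  by rewrite hq_odd_point // hp_odd_point // -scalerBl scalerA.
by case: ifP; rewrite ?scale0r // hxi_odd_point.
Qed.

Lemma schroedinger_super_odd_point hbar K L d (a : A)
    (phi : superfun R m (qp_odd_dim K L + zeta_dim K L)) (q : 'rV[R]_m) theta :
  sa_part true a -> odd_values theta ->
  schroedinger_super hbar (heis_incl K L (odd_point m d a)) phi
    (fun i => (q ord0 i)%:A) theta =
  eval_superfun phi (fun i => (q ord0 i)%:A) theta +
  cplx_re a * eval_superfun (fun q => odd_action hbar (fun j : 'I__ => incl_q d j)
     (fun j : 'I__ => incl_p d j) (incl_xi K L d) (phi q)) (fun i => (q ord0 i)%:A) theta.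
Proof.
have xiE c : (c < xi_dim K L)%N ->
    hxi_at (heis_incl K L (odd_point m d a)) c = incl_xi K L d c *: a.
  move=> cx; rewrite /hxi_at (coord_atE _ (Ordinal cx)) /= /incl_xi.
  by rewrite diag_plus_odd_point diag_minus_odd_point; case: ifP.
move=> oa oth; apply: schroedinger_super_odd => // [j|j|j|j|c].
- by rewrite /= (unsplitK (inl j : _ + 'I__)) (unsplitK (inl j : _ + 'I_r0)).
- by rewrite /= (unsplitK (inl j : _ + 'I__)) (unsplitK (inl j : _ + 'I_r0)).
- rewrite /= (unsplitK (inr j : 'I_m + _)).
  by rewrite diag_plus_odd_point diag_minus_odd_point -scalerDl scalerA.
- rewrite /= (unsplitK (inr j : 'I_m + _)).
  by rewrite diag_plus_odd_point diag_minus_odd_point -scalerBl scalerA.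
have cs := ltn_ord c; rewrite /zeta_dim in cs *; split; apply: xiE; lia.
Qed.

End OddDirections.

(** * The odd directions as Clifford generators of the exterior algebra *)

Section Clifford.
Variables (R : realType) (hbar : R) (k l : nat) (plus : bool).
Local Notation K := (over_plus k plus).
Local Notation L := (over_minus l plus).
Local Notation r := (qp_odd_dim K L).
Local Notation s := (zeta_dim K L).
Local Notation r0 := (qp_odd_dim k l).
Local Notation w := ((Num.sqrt 2 : R)^-1).
Implicit Types (d : odd_dir k l) (v : {set 'I_(r + s)} -> R[i]).
Hypotheses (kl : odd (k + l)) (hbar0 : hbar != 0).

(** The new number of xi is 2 s. The old one is smaller by one when the added coordinate lengthens
    xi, and larger by one when it turns an old xi into half of a new (q, p) pair. *)
Let dimE : [/\ (r = r0 \/ r = r0.+1)%N, (r = r0 -> xi_dim k l = s.*2.-1 /\ 0 < s)%N,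
  (r = r0.+1 -> xi_dim k l = s.*2.+1)%N & xi_dim K L = s.*2].
Proof.
rewrite /zeta_dim /xi_dim /qp_odd_dim /over_plus /over_minus.
by split; case: plus; lia.
Qed.

Let w2 : w * w *+ 2 = 1.
Proof. by rewrite -invfM -expr2 sqr_sqrtr // -mulr_natr mulVf // pnatr_eq0. Qed.

Let w2E (b : R) : w * (w * b + w * b) = b.
Proof. by rewrite -[RHS]mul1r -[X in _ = X * _]w2; ring. Qed.

Let w0 : w != 0.
Proof. by rewrite invr_eq0 sqrtr_eq0 -ltNge. Qed.

Local Notation dir_action d :=
  (@odd_action R hbar K L (fun j => incl_q R d j) (fun j => incl_p R d j) (incl_xi R K L d)).

Let odd_action_single alpha beta gamma (i : 'I_(r + s)) v :
  (forall i', i' != i -> phase_coef hbar beta gamma i' = 0 /\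
     shift_coef alpha gamma i' = 0) ->
  odd_action hbar alpha beta gamma v =
  fun I => phase_coef hbar beta gamma i * create i v I +
     - shift_coef alpha gamma i * annihilate i v I.
Proof.
move=> z; apply/funext => I; rewrite /odd_action (bigD1 i) //= big1 ?addr0 ?mulNr //.
by move=> i' /z[-> ->]; rewrite !mul0r subr0.
Qed.

Let dir_plus_q (j : 'I_r0) n : dir_plus R (inl (inl j) : odd_dir k l) n = w * (n == j)%:R.
Proof.
rewrite /dir_plus /= addr0; case: ltnP => // nr.
by rewrite gtn_eqF ?mulr0 ?if_same // (leq_trans (ltn_ord j)).
Qed.

Let dir_minus_q (j : 'I_r0) n : dir_minus R (inl (inl j) : odd_dir k l) n = w * (n == j)%:R.
Proof.
rewrite /dir_minus /= subr0; case: ltnP => // nr.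
by rewrite gtn_eqF ?mulr0 ?if_same // (leq_trans (ltn_ord j)).
Qed.

Let dir_plus_p (j : 'I_r0) n : dir_plus R (inl (inr j) : odd_dir k l) n = w * (n == j)%:R.
Proof.
rewrite /dir_plus /= add0r; case: ltnP => // nr.
by rewrite gtn_eqF ?mulr0 ?if_same // (leq_trans (ltn_ord j)).
Qed.

Let dir_minus_p (j : 'I_r0) n : dir_minus R (inl (inr j) : odd_dir k l) n = - (w * (n == j)%:R).
Proof.
rewrite /dir_minus /= sub0r mulrN; case: ltnP => // nr.
by rewrite gtn_eqF ?mulr0 ?if_same ?oppr0 // (leq_trans (ltn_ord j)).
Qed.

Let dir_plus_xi (c : 'I_(xi_dim k l)) n :
  dir_plus R (inr c : odd_dir k l) n = ((l < k)%N && (n == r0 + c)%N)%:R.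
Proof.
rewrite /dir_plus /= addr0 mulr0; case: (ltnP n r0) => nr.
  by rewrite ltn_eqF ?andbF // ltn_addr.
by case: ifP => //= _; congr (nat_of_bool _)%:R; apply/eqP/eqP; lia.
Qed.

Let dir_minus_xi (c : 'I_(xi_dim k l)) n :
  dir_minus R (inr c : odd_dir k l) n = ((k < l)%N && (n == r0 + c)%N)%:R.
Proof.
rewrite /dir_minus /= subr0 mulr0; case: (ltnP n r0) => nr.
  by rewrite ltn_eqF ?andbF // ltn_addr.
by case: ifP => //= _; congr (nat_of_bool _)%:R; apply/eqP/eqP; lia.
Qed.

Let nr0 (j : 'I_r0) n : (r + n == j)%N = false.
Proof.
apply/eqP => E; have jr := ltn_ord j; rewrite -E in jr.
by case: dimE => -[] rE _ _ _; rewrite rE in jr; lia.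
Qed.

Let dir_action_q (j : 'I_r0) (j' : 'I_r) v : val j' = j ->
  dir_action (inl (inl j) : odd_dir k l) v = fun I => - annihilate (lshift s j') v I.
Proof.
move=> jj'.
have xi0 n : incl_xi R K L (inl (inl j) : odd_dir k l) n = 0.
  by rewrite /incl_xi dir_plus_q dir_minus_q nr0 mulr0 if_same.
have qE n : incl_q R (inl (inl j) : odd_dir k l) n = (n == j)%:R.
  by rewrite /incl_q dir_plus_q dir_minus_q w2E.
have pE n : incl_p R (inl (inl j) : odd_dir k l) n = 0.
  by rewrite /incl_p dir_plus_q dir_minus_q subrr mulr0.
have pc i : phase_coef hbar (fun j0 : 'I_r => incl_p R (inl (inl j) : odd_dir k l) j0)
    (incl_xi R K L (inl (inl j) : odd_dir k l)) i = 0.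
  rewrite /phase_coef; case: (fintype.split i) => c; rewrite ?pE ?mulr0 //.
  by rewrite !xi0 oppr0 mulr0 mulr0.
rewrite (odd_action_single (i := lshift s j')).
  apply/funext => I; rewrite pc mul0r add0r /shift_coef.
  by rewrite (unsplitK (inl j' : _ + 'I__)) qE jj' eqxx mulN1r.
move=> i ij; split => //; rewrite /shift_coef -(splitK i) in ij *; case: (fintype.split i) ij => c.
  move=> cj; rewrite unsplitK qE; case: eqP => // E; case/eqP: cj.
  by apply/val_inj; rewrite /= E.
by rewrite unsplitK !xi0.
Qed.

Let dir_action_p (j : 'I_r0) (j' : 'I_r) v : val j' = j ->
  dir_action (inl (inr j) : odd_dir k l) v =
  fun I => Complex 0 hbar * create (lshift s j') v I.
Proof.
move=> jj'.
have xi0 n : incl_xi R K L (inl (inr j) : odd_dir k l) n = 0.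
  by rewrite /incl_xi dir_plus_p dir_minus_p nr0 mulr0 oppr0 if_same.
have qE n : incl_q R (inl (inr j) : odd_dir k l) n = 0.
  by rewrite /incl_q dir_plus_p dir_minus_p subrr mulr0.
have pE n : incl_p R (inl (inr j) : odd_dir k l) n = (n == j)%:R.
  by rewrite /incl_p dir_plus_p dir_minus_p opprK w2E.
rewrite (odd_action_single (i := lshift s j')).
  apply/funext => I; rewrite /shift_coef /phase_coef.
  by rewrite (unsplitK (inl j' : _ + 'I__)) qE pE jj' eqxx oppr0 mul0r addr0 mulr1.
move=> i; rewrite /shift_coef /phase_coef -(splitK i); case: (fintype.split i) => c.
  rewrite unsplitK qE pE => cj; split=> //; case: eqP => [E|]; last by rewrite mulr0.
  by case/eqP: cj; apply/val_inj; rewrite /= E.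
by rewrite unsplitK !xi0 oppr0 !mulr0.
Qed.

Let kl_neq : (l < k)%N != (k < l)%N.
Proof. by case: (ltngtP k l) => // E; move: kl; rewrite E addnn odd_double. Qed.

(** Sign of the xi terms of the smaller group; k and l differ because their sum is odd. *)
Let sgn : R := (l < k)%N%:R - (k < l)%N%:R.

Let sgn0 : sgn != 0.
Proof.
rewrite /sgn; move: kl_neq; case: (l < k)%N; case: (k < l)%N => // _.
  by rewrite subr0 oner_neq0.
by rewrite sub0r oppr_eq0 oner_neq0.
Qed.

Let incl_q_xi (c : 'I_(xi_dim k l)) n :
  incl_q R (inr c : odd_dir k l) n = w * (n == r0 + c)%N%:R.
Proof.
rewrite /incl_q dir_plus_xi dir_minus_xi; congr (_ * _).
move: kl_neq; case: (l < k)%N; case: (k < l)%N => //= _; by rewrite ?addr0 ?add0r.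
Qed.

Let incl_p_xi (c : 'I_(xi_dim k l)) n :
  incl_p R (inr c : odd_dir k l) n = w * (sgn * (n == r0 + c)%N%:R).
Proof.
rewrite /incl_p /sgn dir_plus_xi dir_minus_xi; congr (_ * _).
by case: (l < k)%N; case: (k < l)%N => //=; ring.
Qed.

Let incl_xi_xi (c : 'I_(xi_dim k l)) n : (n < s.*2)%N ->
  incl_xi R K L (inr c : odd_dir k l) n = (r + n == r0 + c)%N%:R.
Proof.
move=> ns; rewrite /incl_xi dir_plus_xi dir_minus_xi.
(* The bound on [n] makes the new xi nonempty. This excludes K = L, where [L <= K] holds whichever
   sign was in excess before. *)
have lkE : (l < k)%N = (L <= K)%N.
  have [_ _ _ xi] := dimE; rewrite -xi in ns; apply/idP/idP; move: ns;
  rewrite /xi_dim /over_plus /over_minus; case: (plus); lia.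
have klE : (k < l)%N = ~~ (L <= K)%N by rewrite -lkE; move: kl_neq; case: (l < k)%N; case: (k < l)%N.
by rewrite lkE klE; case: (L <= K)%N.
Qed.

Let eps : R[i] := Complex 0 hbar * (heis_sign R K L / 2)%:C%C.

Let eps0 : eps != 0.
Proof.
rewrite mulf_neq0 //; first by rewrite eq_complex /= eqxx.
rewrite eq_complex /= eqxx andbT mulf_neq0 ?invr_eq0 ?pnatr_eq0 //.
by rewrite /heis_sign; case: ifP => _; rewrite ?oppr_eq0 oner_neq0.
Qed.

(** An old xi sitting at a (q, p) index of the larger group has component w along q and w [sgn]
    along p, so creation and annihilation occur only in this mixture. *)
Let dir_action_xi_q (c : 'I_(xi_dim k l)) (j : 'I_r) v : val j = (r0 + c)%N ->
  dir_action (inr c : odd_dir k l) v = fun I =>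
    Complex 0 hbar * (w * sgn)%:C%C * create (lshift s j) v I +
    - w%:C%C * annihilate (lshift s j) v I.
Proof.
move=> jc.
have xi0 n : (n < s.*2)%N -> incl_xi R K L (inr c : odd_dir k l) n = 0.
  move=> ns; rewrite incl_xi_xi // -jc (_ : (_ == _) = false) //.
  by apply/eqP; have := ltn_ord j; rewrite /=; lia.
have xi0' (i : 'I_s) : incl_xi R K L (inr c : odd_dir k l) i = 0 /\
    incl_xi R K L (inr c : odd_dir k l) (i + s) = 0.
  by have := ltn_ord i; split; apply: xi0; rewrite -addnn; lia.
rewrite (odd_action_single (i := lshift s j)).
  apply/funext => I; rewrite /shift_coef /phase_coef.
  by rewrite (unsplitK (inl j : _ + 'I__)) incl_q_xi incl_p_xi /= -jc eqxx !mulr1.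
move=> i; rewrite /shift_coef /phase_coef -(splitK i); case: (fintype.split i) => i'.
  rewrite unsplitK incl_q_xi incl_p_xi -jc; case: (eqVneq (i' : nat) (val j)) => [E|_ _]; last first.
    by rewrite ?mulr0n /= !mulr0.
  by case/eqP; apply/val_inj; rewrite /= E.
by rewrite unsplitK; have [-> ->] := xi0' i'; rewrite oppr0 !mulr0.
Qed.

(** This direction is the real part of zeta^j and that of [dir_action_xi_im] its imaginary part. The
    conjugation in the phase gives the two opposite relative signs between creation and
    annihilation. *)
Let dir_action_xi_re (c : 'I_(xi_dim k l)) (j : 'I_s) v : (r + j = r0 + c)%N ->
  dir_action (inr c : odd_dir k l) v = fun I =>
    eps * create (rshift r j) v I + - 1 * annihilate (rshift r j) v I.
Proof.
move=> jc.
have xiE (i : 'I_s) : incl_xi R K L (inr c : odd_dir k l) i = (i == j)%:R /\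
    incl_xi R K L (inr c : odd_dir k l) (i + s) = 0.
  have := ltn_ord i; have := ltn_ord j => js ls; rewrite !incl_xi_xi; try by rewrite -addnn; lia.
  rewrite -jc eqn_add2l; split => //.
  by rewrite (_ : (_ == _) = false) //; apply/eqP; lia.
rewrite (odd_action_single (i := rshift r j)).
  apply/funext => I; rewrite /shift_coef /phase_coef.
  rewrite (unsplitK (inr j : 'I__ + _)); have [-> ->] := xiE j; rewrite eqxx oppr0.
  by rewrite -[Complex 1 0]/(1 : R[i]) mulr1.
move=> i; rewrite /shift_coef /phase_coef -(splitK i); case: (fintype.split i) => i'.
  rewrite unsplitK incl_q_xi incl_p_xi -jc (_ : ((i' : nat) == r + j)%N = false); last first.
    by apply/eqP; have := ltn_ord i'; lia.
  by rewrite ?mulr0n /= !mulr0.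
rewrite unsplitK; have [-> ->] := xiE i'; case: (eqVneq i' j) => [->|_ _]; first by rewrite eqxx.
by rewrite oppr0 !mulr0.
Qed.

Let dir_action_xi_im (c : 'I_(xi_dim k l)) (j : 'I_s) v : (r + (j + s) = r0 + c)%N ->
  dir_action (inr c : odd_dir k l) v = fun I =>
    eps * - 'i%C * create (rshift r j) v I + - 'i%C * annihilate (rshift r j) v I.
Proof.
move=> jc.
have xiE (i : 'I_s) : incl_xi R K L (inr c : odd_dir k l) i = 0 /\
    incl_xi R K L (inr c : odd_dir k l) (i + s) = (i == j)%:R.
  have := ltn_ord i; have := ltn_ord j => js ls; rewrite !incl_xi_xi; try by rewrite -addnn; lia.
  rewrite -jc !eqn_add2l eqn_add2r; split => //.
  by rewrite (_ : (_ == _) = false) //; apply/eqP; lia.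
rewrite (odd_action_single (i := rshift r j)).
  apply/funext => I; rewrite /shift_coef /phase_coef.
  rewrite (unsplitK (inr j : 'I__ + _)); have [-> ->] := xiE j; rewrite eqxx mulrA.
  rewrite (_ : Complex 0 (-1) = - 'i%C) //.
  by apply/eqP; rewrite eq_complex /= oppr0 !eqxx.
move=> i; rewrite /shift_coef /phase_coef -(splitK i); case: (fintype.split i) => i'.
  rewrite unsplitK incl_q_xi incl_p_xi -jc (_ : ((i' : nat) == r + (j + s))%N = false); last first.
    by apply/eqP; have := ltn_ord i'; lia.
  by rewrite ?mulr0n /= !mulr0.
rewrite unsplitK; have [-> ->] := xiE i'; case: (eqVneq i' j) => [->|_ _]; first by rewrite eqxx.
by rewrite oppr0 !mulr0.
Qed.

Section Stable.
Variable V : set ({set 'I_(r + s)} -> R[i]).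
Hypothesis V0 : V (fun=> 0).
Hypothesis VP : forall (c : R[i]) v w, V v -> V w -> V (fun I => c * v I + w I).
Hypothesis V_even : forall v, V v -> V (fun I => if odd #|I| then 0 else v I).
Hypothesis V_action : forall d v, V v -> V (dir_action d v).

Let VZ c v : V v -> V (fun I => c * v I).
Proof.
move=> Vv; rewrite (_ : (fun I => _) = fun I => c * v I + (fun=> 0) I); first exact: VP.
by apply/funext => I; rewrite addr0.
Qed.

(* If the added coordinate has the sign in excess (r = r0), it is the last xi,
   and the imaginary part of the last zeta is missing. Otherwise it is paired
   with the old first xi into a new (q, p), of which only one combination is in
   the image of the inclusion. *)
Lemma clifford_irreducible v I : V v -> v I != 0 -> forall w, V w.
Proof.
have [rE xi1 xi2 xi3] := dimE.
have full_q (i : 'I_(r + s)) j : lshift s j = i -> (j < r0)%N ->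
    (forall v, V v -> V (create i v)) /\ (forall v, V v -> V (annihilate i v)).
  move=> <- jr; split=> {}v Vv.
    have := V_action (inl (inr (Ordinal jr))) Vv; rewrite (dir_action_p (j' := j)) //.
    move/(VZ (Complex 0 hbar)^-1); congr V; apply/funext => J.
    by rewrite mulrA mulVf ?mul1r // eq_complex /= eqxx.
  have := V_action (inl (inl (Ordinal jr))) Vv; rewrite (dir_action_q (j' := j)) //.
  by move/(VZ (-1)); congr V; apply/funext => J; rewrite mulN1r opprK.
have full_xi (c : 'I_s) c1 c2 : (r + c = r0 + c1)%N -> (r + (c + s) = r0 + c2)%N ->
    (c1 < xi_dim k l)%N -> (c2 < xi_dim k l)%N ->
    (forall v, V v -> V (create (rshift r c) v)) /\
    (forall v, V v -> V (annihilate (rshift r c) v)).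
  move=> E1 E2 lt1 lt2.
  have ii : 'i%C * - 'i%C = 1 :> R[i] by rewrite mulrN -expr2 sqr_i opprK.
  have two0 : (2 : R[i]) != 0 by rewrite pnatr_eq0.
  split=> {}v Vv; have V1 := V_action (inr (Ordinal lt1)) Vv;
    have V2 := V_action (inr (Ordinal lt2)) Vv;
    rewrite (dir_action_xi_re (j := c)) // in V1;
    rewrite (dir_action_xi_im (j := c)) // in V2.
    (* With a and b the created and annihilated vectors, [V1] holds eps a - b and i times [V2] gives
       eps a + b: their sum isolates a, their difference b. *)
    have := VZ (2 * eps)^-1 (VP 'i%C V2 V1); congr V; apply/funext => J.
    set a := create _ _ _; set b := annihilate _ _ _.
    rewrite (_ : _ + _ = ('i%C * - 'i%C) * (eps * a + b) + (eps * a - b)); last by ring.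
    rewrite ii mul1r (_ : _ + _ = 2 * eps * a); last by ring.
    by rewrite mulKf // mulf_neq0.
  have := VZ 2^-1 (VP 'i%C V2 (VZ (-1) V1)); congr V; apply/funext => J.
  set a := create _ _ _; set b := annihilate _ _ _.
  rewrite (_ : _ + _ = ('i%C * - 'i%C) * (eps * a + b) - (eps * a - b)); last by ring.
  by rewrite ii mul1r (_ : _ - _ = 2 * b) ?mulKf //; ring.
have [rr|rr] := rE.
  have [xiE s0] := xi1 rr.
  (* There are 2 s - 1 old xi, so only the last zeta lacks its imaginary part: it is the exceptional
     index. *)
  have lts : (s.-1 < s)%N by lia.
  have ltx : (s.-1 < xi_dim k l)%N by lia.
  have full (i : 'I_(r + s)) : i != rshift r (Ordinal lts) ->
      (forall v, V v -> V (create i v)) /\ (forall v, V v -> V (annihilate i v)).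
    case: (split_ordP i) => j -> ji.
      by apply: (full_q _ j) => //; rewrite -rr.
    have js : (j < s.-1)%N.
      have := ltn_ord j; have : (j : nat) != s.-1; last by move/eqP; lia.
      by apply/eqP => E; case/eqP: ji; congr rshift; apply/val_inj.
    by apply: (full_xi j j (j + s)%N); rewrite ?rr ?xiE -?addnn //; lia.
  apply: (fock_irreducible V0 VP V_even (i0 := rshift r (Ordinal lts)) _ _ eps0 (y := -1)).
  - by move=> i {}v ii0 Vv; apply: (full _ _).1.
  - by move=> i {}v ii0 Vv; apply: (full _ _).2.
  - by rewrite oppr_eq0 oner_neq0.
  move=> {}v /(V_action (inr (Ordinal ltx))).
  by rewrite (dir_action_xi_re (j := Ordinal lts)) // rr.
have xiE := xi2 rr.
(* The exceptional index is [r0], the position of the new (q, p) pair, reached only by the old xi of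
   index 0. *)
have ltr : (r0 < r)%N by lia.
have ltx : (0 < xi_dim k l)%N by lia.
have full (i : 'I_(r + s)) : i != lshift s (Ordinal ltr) ->
    (forall v, V v -> V (create i v)) /\ (forall v, V v -> V (annihilate i v)).
  case: (split_ordP i) => j -> ji.
    apply: (full_q _ j) => //.
    have := ltn_ord j; have : (j : nat) != r0; last by move/eqP; lia.
    by apply/eqP => E; case/eqP: ji; congr lshift; apply/val_inj.
  have := ltn_ord j => js.
  (* The indices of the old xi are shifted by one because the first of them has gone into the new
     pair. *)
  by apply: (full_xi j j.+1 (j + s).+1); rewrite ?rr ?xiE -?addnn //; lia.
apply: (fock_irreducible V0 VP V_even (i0 := lshift s (Ordinal ltr)) _ _
   (x := Complex 0 hbar * (w * sgn)%:C%C) (y := - w%:C%C)).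
- by move=> i {}v ii0 Vv; apply: (full _ _).1.
- by move=> i {}v ii0 Vv; apply: (full _ _).2.
- by rewrite !mulf_neq0 // eq_complex /= eqxx ?andbT // mulf_neq0.
- by rewrite oppr_eq0 eq_complex /= eqxx andbT.
move=> {}v /(V_action (inr (Ordinal ltx))).
by rewrite (dir_action_xi_q (j := Ordinal ltr)) //= addn0.
Qed.

End Stable.
End Clifford.

(** * Integration on R^m *)

Section RowIntegral.
Variable R : realType.

(** The translated measure agrees with Lebesgue measure on half-open intervals, and these determine
    it. *)
Lemma lebesgue_measure_shift (c : R) (A : set (measurableTypeR R)) :
  measurable A -> lebesgue_measure ((fun x => x + c) @^-1` A) = lebesgue_measure A.
Proof.
move=> mA.
have mshift : measurable_fun [set: measurableTypeR R] (fun x : measurableTypeR R => (x + c : measurableTypeR R)).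
  exact: measurable_funD.
pose f : {mfun measurableTypeR R >-> measurableTypeR R} :=
  HB.pack (fun x : measurableTypeR R => (x + c : measurableTypeR R))
    (isMeasurableFun.Build _ _ _ _ _ mshift).
rewrite [RHS](@lebesgue_measure_unique R (pushforward lebesgue_measure f)) //.
move=> _ [[a b] /= ab <-].
rewrite /pushforward (_ : _ @^-1` _ = `]a - c, b - c]%classic).
  by rewrite !lebesgue_measure_itv/= !lte_fin ltrD2r -!EFinB (_ : b - c - (a - c) = b - a) //; ring.
by apply/seteqP; split => x /=; rewrite !in_itv /= ltrBlDr lerBrDr.
Qed.

Lemma ge0_integral_shift (c : R) (f : measurableTypeR R -> \bar R) :
  measurable_fun setT f -> (forall x, 0 <= f x)%E ->
  (\int[lebesgue_measure]_x f (x + c)%R = \int[lebesgue_measure]_x f x)%E.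
Proof.
move=> mf f0.
have mshift : measurable_fun [set: measurableTypeR R] (fun x : measurableTypeR R => (x + c : measurableTypeR R)).
  exact: measurable_funD.
pose h : {mfun measurableTypeR R >-> measurableTypeR R} :=
  HB.pack (fun x : measurableTypeR R => (x + c : measurableTypeR R))
    (isMeasurableFun.Build _ _ _ _ _ mshift).
have := @ge0_integral_pushforward _ _ _ _ R _ mshift lebesgue_measure setT f measurableT mf (fun x _ => f0 x).
rewrite preimage_setT => <-.
have E := @eq_measure_integral _ (measurableTypeR R) R setT lebesgue_measure (pushforward lebesgue_measure h) f _.
apply: E => A mA _; exact: lebesgue_measure_shift.
Qed.

Lemma ge0_integral_row_cons m (f : 'rV[R]_m.+1 -> \bar R) :
  measurable_fun setT f -> (forall x, 0 <= f x)%E ->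
  (\int[lebesgue_row R m.+1]_x f x =
   \int[lebesgue_measure]_t \int[lebesgue_row R m]_y f (row_cons (t, y)))%E.
Proof.
move=> mf f0 /=.
rewrite (ge0_integral_pushforward (@measurable_row_cons R m)) // preimage_setT fubini_tonelli1 //.
  exact: (measurableT_comp mf (@measurable_row_cons R m)).
by move=> x; exact: f0.
Qed.

Lemma measurable_row_add m : measurable_fun setT (fun z : 'rV[R]_m * 'rV[R]_m => z.1 + z.2).
Proof.
apply: measurable_fun_row => i.
rewrite (_ : (fun x => _) = fun z : 'rV[R]_m * 'rV[R]_m => row_coord i z.1 + row_coord i z.2).
  by apply: measurable_funD; apply: measurableT_comp => //; exact: measurable_row_coord.
by apply/funext => x; rewrite !mxE.
Qed.

Lemma measurable_row_shift m (c : 'rV[R]_m) : measurable_fun setT (fun x : 'rV[R]_m => x + c).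
Proof.
exact: (measurableT_comp (@measurable_row_add m) (measurable_pair2 c)).
Qed.

(** Induction on [m] through iterated integrals: the inner variables are shifted by the induction
    hypothesis, the first coordinate by the one-dimensional case. *)
Lemma ge0_integral_row_shift m (c : 'rV[R]_m) (f : 'rV[R]_m -> \bar R) :
  measurable_fun setT f -> (forall x, 0 <= f x)%E ->
  (\int[lebesgue_row R m]_x f (x + c)%R = \int[lebesgue_row R m]_x f x)%E.
Proof.
elim: m c f => [|m IH] c f mf f0.
  apply: eq_integral => x _; congr f; apply/rowP; by case.
have mfc := measurableT_comp mf (measurable_row_shift c).
rewrite (ge0_integral_row_cons mf f0) (ge0_integral_row_cons mfc (fun x => f0 (x + c))).
pose c' : 'rV[R]_m := \row_i c ord0 (lift ord0 i).
transitivity (\int[lebesgue_measure]_t \int[lebesgue_row R m]_y f (row_cons ((t + c ord0 ord0)%R, y)))%E.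
  apply: eq_integral => t _.
  rewrite -[RHS](IH c') //; last first.
    exact: (measurableT_comp mf (measurableT_comp (@measurable_row_cons R m) (measurable_pair1 (t + c ord0 ord0 : measurableTypeR R)))).
  apply: eq_integral => y _; congr f; apply/rowP => i; rewrite mxE.
  case: (unliftP ord0 i) => [j ->|->]; rewrite ?row_consS ?row_cons0 //=.
  by rewrite !mxE.
rewrite (ge0_integral_shift (c ord0 ord0) (f := fun t => \int[lebesgue_row R m]_y f (row_cons (t, y)))%E) //.
  apply: (measurable_fun_fubini_tonelli_F (f \o (@row_cons R m))) => //.
    exact: (measurableT_comp mf (@measurable_row_cons R m)).
  by move=> x; exact: f0.
by move=> x; exact: integral_ge0.
Qed.

Definition sqnorm m (x : 'rV[R]_m) : R := \sum_i x ord0 i ^+ 2.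

Lemma sqnorm_ge0 m (x : 'rV[R]_m) : 0 <= sqnorm x.
Proof. by apply: sumr_ge0 => i _; exact: sqr_ge0. Qed.

Lemma measurable_sqnorm m : measurable_fun setT (@sqnorm m).
Proof. by apply: measurable_sum => i; apply: measurable_funX; exact: measurable_row_coord. Qed.

Definition gauss m (c : R) (x : 'rV[R]_m) : R := expR (- (c * sqnorm x)).

Lemma measurable_gauss m c : measurable_fun setT (@gauss m c).
Proof.
apply: measurableT_comp => //; apply: measurableT_comp => //.
by apply: measurable_funM => //; exact: measurable_sqnorm.
Qed.

Lemma gauss_gt0 m c (x : 'rV[R]_m) : 0 < gauss c x.
Proof. exact: expR_gt0. Qed.

Lemma gauss_le1 m c (x : 'rV[R]_m) : 0 <= c -> gauss c x <= 1.
Proof. by move=> c0; rewrite /gauss -expR0 ler_expR oppr_le0 mulr_ge0 ?sqnorm_ge0. Qed.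

(** The Gaussian is a product over the coordinates, so the integral reduces to the one-dimensional
    Gaussian integral. *)
Lemma integral_gauss_lty m : (\int[lebesgue_row R m]_x (gauss 1 x)%:E < +oo)%E.
Proof.
elim: m => [|m IH].
  rewrite /= integral_dirac //.
    by rewrite diracE in_setT mul1e ltry.
  apply/measurable_EFinP; exact: measurable_gauss.
rewrite ge0_integral_row_cons //; last 2 first.
  apply/measurable_EFinP; exact: measurable_gauss.
  by move=> x; rewrite lee_fin ltW // gauss_gt0.
have E t (y : 'rV[R]_m) : gauss 1 (row_cons (t, y)) = gauss_fun t * gauss 1 y.
  rewrite /gauss /gauss_fun -expRD; congr expR; rewrite /sqnorm big_ord_recl row_cons0 /=.
  by under eq_bigr do rewrite row_consS /=; ring.
under eq_integral => t _.
  under eq_integral do rewrite E EFinM.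
  rewrite ge0_integralZl_EFin //; last 3 first.
  - by move=> y _; rewrite lee_fin ltW // gauss_gt0.
  - apply/measurable_EFinP; exact: measurable_gauss.
  - exact: gauss_fun_ge0.
  over.
have IHfin : (\int[lebesgue_row R m]_y (gauss 1 y)%:E)%E \is a fin_num.
  by rewrite ge0_fin_numE // integral_ge0 // => y _; rewrite lee_fin ltW // gauss_gt0.
have gf0 (t : R) : (0 <= (gauss_fun t)%:E)%E by rewrite lee_fin; exact: gauss_fun_ge0.
rewrite ge0_integralZr //; last 2 first.
- apply/measurable_EFinP; exact: measurable_gauss_fun.
- by apply: integral_ge0 => y _; rewrite lee_fin ltW // gauss_gt0.
by rewrite lte_mul_pinfty // integralT_gauss ?ltry.
Qed.

End RowIntegral.

(** * The Hilbert norm through pointwise densities *)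

Section Density.
Variables (R : realType) (m n : nat).
Local Notation mu := (lebesgue_row R m).
Implicit Types (phi psi : superfun R m n) (h : 'rV[R]_m -> R) (q : 'rV[R]_m).

Definition hs_measurable phi := forall I,
  measurable_fun setT (fun q => complex.Re (phi q I)) /\
  measurable_fun setT (fun q => complex.Im (phi q I)).

(** Only the real part of the pointwise hermitian product is kept: the real inner product suffices
    for distance arguments. *)
Definition hs_pair phi psi q : R :=
  \sum_I (complex.Re (phi q I) * complex.Re (psi q I) +
          complex.Im (phi q I) * complex.Im (psi q I)).
Definition hs_density phi q := hs_pair phi phi q.

Definition fun_scale h phi : superfun R m n := fun q I => (h q)%:C%C * phi q I.

Lemma hs_density_ge0 phi q : 0 <= hs_density phi q.
Proof. by apply: sumr_ge0 => I _; rewrite addr_ge0 // -expr2 sqr_ge0. Qed.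

Lemma measurable_hs_pair phi psi : hs_measurable phi -> hs_measurable psi ->
  measurable_fun setT (hs_pair phi psi).
Proof.
move=> mphi mpsi; apply: measurable_sum => I.
by apply: measurable_funD; apply: measurable_funM; (apply: (mphi I).1 || apply: (mphi I).2 || apply: (mpsi I).1 || apply: (mpsi I).2).
Qed.

Lemma hs_norm2E phi : hs_measurable phi ->
  hs_norm2 phi = (\int[mu]_q (hs_density phi q)%:E)%E.
Proof.
move=> mphi; rewrite /hs_norm2.
under [RHS]eq_integral do rewrite /hs_density /hs_pair -sumEFin.
rewrite ge0_integral_sum //.
- move=> I; apply/measurable_EFinP.
  by apply: measurable_funD; apply: measurable_funM; (apply: (mphi I).1 || apply: (mphi I).2).
- by move=> I q _; rewrite lee_fin addr_ge0 // -expr2 sqr_ge0.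
Qed.

Lemma hs_measurableD phi psi : hs_measurable phi -> hs_measurable psi ->
  hs_measurable (phi + psi).
Proof.
move=> mphi mpsi I; have [p1 p2] := mphi I; have [s1 s2] := mpsi I; split.
  rewrite (_ : (fun q => _) = (fun q => complex.Re (phi q I) + complex.Re (psi q I))).
    exact: measurable_funD.
  by apply/funext => q /=; rewrite -[(phi + psi) q I]/(phi q I + psi q I); case: (phi q I) (psi q I) => ? ? [].
rewrite (_ : (fun q => _) = (fun q => complex.Im (phi q I) + complex.Im (psi q I))).
  exact: measurable_funD.
by apply/funext => q /=; rewrite -[(phi + psi) q I]/(phi q I + psi q I); case: (phi q I) (psi q I) => ? ? [].
Qed.

Lemma hs_measurableM (f : 'rV[R]_m -> R[i]) phi :
  measurable_fun setT (fun q => complex.Re (f q)) ->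
  measurable_fun setT (fun q => complex.Im (f q)) ->
  hs_measurable phi -> hs_measurable (fun q I => f q * phi q I).
Proof.
move=> f1 f2 mphi I; have [p1 p2] := mphi I; split.
  rewrite (_ : (fun q => _) = (fun q => complex.Re (f q) * complex.Re (phi q I) -
      complex.Im (f q) * complex.Im (phi q I))).
    by apply: measurable_funB; exact: measurable_funM.
  by apply/funext => q /=; case: (f q) (phi q I) => ? ? [].
rewrite (_ : (fun q => _) = (fun q => complex.Re (f q) * complex.Im (phi q I) +
    complex.Im (f q) * complex.Re (phi q I))).
  by apply: measurable_funD; exact: measurable_funM.
by apply/funext => q /=; case: (f q) (phi q I) => ? ? [].
Qed.

Lemma hs_measurableN phi : hs_measurable phi -> hs_measurable (- phi).
Proof.
move=> mphi; rewrite (_ : - phi = fun q I => (-1) * phi q I).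
  exact: (@hs_measurableM (fun=> -1)).
by apply/funext => q; apply/funext => I; rewrite mulN1r.
Qed.

Lemma hs_measurableB phi psi : hs_measurable phi -> hs_measurable psi ->
  hs_measurable (phi - psi).
Proof. by move=> mphi mpsi; apply: hs_measurableD => //; exact: hs_measurableN. Qed.

Lemma hs_density_scale h phi q :
  hs_density (fun_scale h phi) q = h q ^+ 2 * hs_density phi q.
Proof.
rewrite /hs_density /hs_pair mulr_sumr; apply: eq_bigr => I _.
by rewrite /fun_scale; case: (phi q I) => a b /=; ring.
Qed.

Lemma hs_densityB phi psi q :
  hs_density (phi - psi) q = hs_density phi q - 2 * hs_pair phi psi q + hs_density psi q.
Proof.
rewrite /hs_density /hs_pair mulr_sumr -sumrB -big_split; apply: eq_bigr => I _.
rewrite -[(phi - psi) q I]/(phi q I - psi q I).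
by case: (phi q I) (psi q I) => a b [c d] /=; ring.
Qed.

Lemma hs_densityD_le phi psi q :
  hs_density (phi + psi) q <= 2 * hs_density phi q + 2 * hs_density psi q.
Proof.
rewrite /hs_density /hs_pair !mulr_sumr -big_split; apply: ler_sum => I _.
rewrite -[(phi + psi) q I]/(phi q I + psi q I).
case: (phi q I) (psi q I) => a b [c d] /=; rewrite -subr_ge0.
rewrite (_ : _ - _ = (a - c) ^+ 2 + (b - d) ^+ 2); last by ring.
by rewrite addr_ge0 // sqr_ge0.
Qed.

Lemma hs_densityM (f : 'rV[R]_m -> R[i]) phi q :
  hs_density (fun q I => f q * phi q I) q =
  (complex.Re (f q) ^+ 2 + complex.Im (f q) ^+ 2) * hs_density phi q.
Proof.
rewrite /hs_density /hs_pair mulr_sumr; apply: eq_bigr => I _.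
by case: (f q) (phi q I) => c d [a b] /=; ring.
Qed.

(** Positivity of the densities of phi - psi and of phi + psi bounds the pairing on both sides. *)
Lemma hs_pair_le phi psi q :
  `|hs_pair phi psi q| <= hs_density phi q + hs_density psi q.
Proof.
have := hs_densityB phi psi q; have := hs_density_ge0 (phi - psi) q.
have := hs_densityB phi (- psi) q; have := hs_density_ge0 (phi - - psi) q.
have -> : hs_pair phi (- psi) q = - hs_pair phi psi q.
  rewrite /hs_pair -sumrN; apply: eq_bigr => I _.
  rewrite -[(- psi) q I]/(- psi q I); by case: (phi q I) (psi q I) => a b [c d] /=; ring.
have -> : hs_density (- psi) q = hs_density psi q.
  rewrite /hs_density /hs_pair; apply: eq_bigr => I _.
  rewrite -[(- psi) q I]/(- psi q I); by case: (psi q I) => c d /=; ring.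
have := hs_density_ge0 phi q; have := hs_density_ge0 psi q.
by move=> *; rewrite ler_norml; apply/andP; split; lra.
Qed.

Lemma hsP phi : hs phi <-> hs_measurable phi /\
  mu.-integrable setT (fun q => (hs_density phi q)%:E).
Proof.
split=> [[mphi lt]|[mphi /integrableP[_ lt]]].
  split=> //; apply/integrableP; split.
    by apply/measurable_EFinP; exact: measurable_hs_pair.
  under eq_integral do rewrite gee0_abs ?lee_fin ?hs_density_ge0 //.
  by rewrite -hs_norm2E.
split=> //; rewrite hs_norm2E //.
by move: lt; under eq_integral do rewrite gee0_abs ?lee_fin ?hs_density_ge0 //.
Qed.

Lemma hs_le phi (G : 'rV[R]_m -> R) : hs_measurable phi ->
  mu.-integrable setT (EFin \o G) -> (forall q, hs_density phi q <= G q) -> hs phi.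
Proof.
move=> mphi iG leG; apply/hsP; split=> //.
apply: le_integrable iG => //.
  by apply/measurable_EFinP; exact: measurable_hs_pair.
move=> q _; rewrite /= lee_fin ger0_norm ?hs_density_ge0 //.
exact: le_trans (leG q) (ler_norm _).
Qed.

Lemma hsD phi psi : hs phi -> hs psi -> hs (phi + psi).
Proof.
move=> /hsP[mphi iphi] /hsP[mpsi ipsi].
apply: (hs_le (G := fun q => 2 * hs_density phi q + 2 * hs_density psi q)).
- exact: hs_measurableD.
- exact: (integrableD _ (integrableZl _ 2 iphi) (integrableZl _ 2 ipsi)).
- exact: hs_densityD_le.
Qed.

Lemma hsM (f : 'rV[R]_m -> R[i]) (M : R) phi :
  measurable_fun setT (fun q => complex.Re (f q)) ->
  measurable_fun setT (fun q => complex.Im (f q)) ->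
  (forall q, complex.Re (f q) ^+ 2 + complex.Im (f q) ^+ 2 <= M) ->
  hs phi -> hs (fun q I => f q * phi q I).
Proof.
move=> f1 f2 fM /hsP[mphi iphi].
apply: (hs_le (G := fun q => M * hs_density phi q)).
- exact: hs_measurableM.
- exact: (integrableZl _ M iphi).
- by move=> q; rewrite hs_densityM ler_wpM2r ?hs_density_ge0.
Qed.

Lemma hsN phi : hs phi -> hs (- phi).
Proof.
move=> hphi; rewrite (_ : - phi = fun q I => (-1) * phi q I).
  exact: (@hsM (fun=> -1) ((-1) ^+ 2 + (-0) ^+ 2)).
by apply/funext => q; apply/funext => I; rewrite mulN1r.
Qed.

Lemma hsB phi psi : hs phi -> hs psi -> hs (phi - psi).
Proof. by move=> hphi hpsi; apply: hsD => //; exact: hsN. Qed.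

Lemma hs_scale h (M : R) phi : measurable_fun setT h -> (forall q, `|h q| <= M) ->
  hs phi -> hs (fun_scale h phi).
Proof.
move=> mh hM; apply: (@hsM (fun q => (h q)%:C%C) (M ^+ 2)) => //= q.
by rewrite expr0n addr0 -[h q ^+ 2]ger0_norm ?sqr_ge0 // normrX lerXn2r ?nnegrE // (le_trans _ (hM q)).
Qed.

Section ClosedSubspace.
Variable F : set (superfun R m n).
Hypothesis closedF : closed_subspace F.

(** By dominated convergence, pointwise convergence under an integrable bound gives convergence in
    norm, to which closedness applies. *)
Lemma closed_subspace_lim (phi_ : nat -> superfun R m n) phi (G : 'rV[R]_m -> R) :
  (forall k, F (phi_ k)) -> hs phi -> mu.-integrable setT (EFin \o G) ->
  (forall q k, hs_density (phi - phi_ k) q <= G q) ->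
  (forall q, hs_density (phi - phi_ k) q @[k --> \oo] --> 0) ->
  F phi.
Proof.
have [Fhs _ _ Fclosed] := closedF.
move=> Fphi_ hphi iG leG cv; apply: Fclosed => // e e0.
have mk k : hs_measurable (phi - phi_ k).
  by case: (hsB hphi (Fhs _ (Fphi_ k))).
have : (\int[mu]_q (hs_density (phi - phi_ k) q)%:E)%E @[k --> \oo] --> 0%E.
  have [] := @dominated_convergence _ _ _ mu setT measurableT
    (fun k q => (hs_density (phi - phi_ k) q)%:E) (cst 0%E) (EFin \o G).
  - by move=> k; apply/measurable_EFinP; exact: measurable_hs_pair.
  - exact: measurable_cst.
  - by apply: aeW => q _; apply: cvg_EFin; [exact: nearW|exact: cv].
  - by [].
  - by apply: aeW => q k _; rewrite /= lee_fin ger0_norm ?hs_density_ge0.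
  by move=> _ _; rewrite integral0.
move=> /fine_cvgP[finN cvN].
have /cvgr_norm_lt /(_ e) := cvN; rewrite normr0 => /(_ e0) ltN.
have [k [fk ltk]] := filter_ex (filterI finN ltN).
exists (phi_ k) => //; rewrite hs_norm2E // -(fineK fk) lte_fin.
by apply: le_lt_trans ltk; exact: ler_norm.
Qed.

End ClosedSubspace.
End Density.

(** * Bounded multipliers of an invariant subspace *)

Section SignApproximation.
Variable R : realType.

(* An odd polynomial whose iterates push [-1, 1] to the sign: applied to a sine,
   it turns trigonometric polynomials into signs. *)
Definition sharpen (v : R) : R := 2^-1 * (3 * v - v ^+ 3).

Lemma iter_sharpenN k v : iter k sharpen (- v) = - iter k sharpen v.
Proof. by elim: k => //= k ->; rewrite /sharpen; ring. Qed.

(** On [0, 1] the iterates increase, and 1 - [sharpen] w = (1 - w) (1 - (w + w^2) / 2) with w >= v,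
    so each step shrinks the distance to 1 by a factor at most 1 - v / 2. *)
Lemma iter_sharpen_bound k v : 0 <= v <= 1 ->
  v <= iter k sharpen v <= 1 /\ 1 - iter k sharpen v <= (1 - v / 2) ^+ k.
Proof.
move=> /andP[v0 v1]; elim: k => [|k [/andP[IH1 IH2] IH3]] /=.
  by rewrite lexx v1 expr0 lerBlDr lerDl.
set w := iter k sharpen v in IH1 IH2 IH3 *.
have E : 1 - sharpen w = (1 - w) * (1 - (w + w ^+ 2) / 2).
  by rewrite /sharpen; field.
have w2 : w ^+ 2 <= 1 by rewrite expr_le1 //; lra.
have w2' : 0 <= w ^+ 2 by exact: sqr_ge0.
split; last first.
  rewrite E [X in _ <= X]exprSr; apply: ler_pM => //; lra.
apply/andP; split; last first.
  by rewrite -subr_ge0 E mulr_ge0 //; lra.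
apply: (le_trans IH1); rewrite -subr_ge0.
rewrite (_ : _ - _ = w * (1 - w ^+ 2) / 2); last by rewrite /sharpen; field.
by rewrite !mulr_ge0 // ?invr_ge0 //; lra.
Qed.

Lemma norm_iter_sharpen k v : `|v| <= 1 -> `|iter k sharpen v| <= 1.
Proof.
wlog v0 : v / 0 <= v => [hw|].
  have [|/ltW v0] := leP 0 v; first exact: hw.
  by have := hw (- v); rewrite iter_sharpenN !normrN oppr_ge0; exact.
move=> v1; have [|/andP[a b] _] := @iter_sharpen_bound k v.
  by rewrite v0 (le_trans (ler_norm _) v1).
by rewrite ger0_norm // (le_trans v0).
Qed.

Lemma cvg_iter_sharpen v : `|v| <= 1 -> iter k sharpen v @[k --> \oo] --> Num.sg v.
Proof.
wlog v0 : v / 0 <= v => [hw|].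
  have [|/ltW v0] := leP 0 v; first exact: hw.
  move=> v1; rewrite -[v]opprK sgrN; under eq_fun do rewrite iter_sharpenN.
  by apply: cvgN; apply: hw; rewrite ?oppr_ge0 ?normrN.
move=> v1; have vle1 : v <= 1 by exact: le_trans (ler_norm _) v1.
have [->|vn0] := eqVneq v 0.
  rewrite sgr0; under eq_fun => k.
    rewrite (_ : iter k sharpen 0 = 0); last by elim: k => //= k ->; rewrite /sharpen; ring.
    over.
  exact: cvg_cst.
have vgt0 : 0 < v by rewrite lt_neqAle eq_sym vn0.
rewrite gtr0_sg //.
have : (1 - (1 - v / 2) ^+ k) @[k --> \oo] --> (1 - 0 : R).
  apply: cvgB; first exact: cvg_cst.
  by apply: cvg_expr; rewrite ger0_norm; lra.
rewrite subr0 => cv; apply: (squeeze_cvgr _ cv (cvg_cst _)).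
apply: nearW => k; have [|/andP[a b] c] := @iter_sharpen_bound k v; first by rewrite v0.
by rewrite b andbT lerBlDr addrC -lerBlDr.
Qed.

Lemma sgr_sin (x : R) : `|x| < pi -> Num.sg (sin x) = Num.sg x.
Proof.
move=> xpi; have [x0|x0|->] := ltrgt0P x; last by rewrite sin0.
  rewrite gtr0_sg ?gtr0_sg // sin_gt0_pi // ?x0 //=.
  by apply: le_lt_trans xpi; exact: ler_norm.
rewrite [RHS]ltr0_sg // -(opprK x) sinN sgrN gtr0_sg // sin_gt0_pi // oppr_gt0 x0 /=.
by apply: le_lt_trans xpi; rewrite -normrN; exact: ler_norm.
Qed.

(** For fixed x the argument x / (k + 1) ends up in ]-pi, pi[, where the sine has the sign of its
    argument; the sequence is eventually constant. *)
Lemma cvg_sgr_sin (x : R) : Num.sg (sin (k.+1%:R^-1 * x)) @[k --> \oo] --> Num.sg x.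
Proof.
apply: cvg_near_cst.
have cv : k.+1%:R^-1 * x @[k --> \oo] --> (0 * x).
  by apply: cvgM; [exact: cvg_harmonic|exact: cvg_cst].
move: cv; rewrite mul0r => /cvgr_norm_lt /(_ pi); rewrite normr0 => /(_ (pi_gt0 _)).
apply: filterS => k lt; rewrite sgr_sin // sgrM gtr0_sg ?mul1r //.
Qed.

End SignApproximation.

(** The sum counts the integers from 1 to N that are at most y, that is, the integer part of y. *)
Lemma dist_floor_sum (R : realType) N (y : R) : 0 <= y <= N%:R ->
  `|\sum_(j < N) (j.+1%:R <= y)%R%:R - y| <= 1.
Proof.
elim: N => [|N IH] /andP[y0 yN].
  by rewrite big_ord0 sub0r normrN ger0_norm // (le_trans yN).
rewrite big_ord_recr /=; have [yle|ylt] := leP y N%:R.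
  rewrite (_ : (_ <= y) = false) ?addr0; first by apply: IH; rewrite y0.
  by apply/negbTE; rewrite -ltNge (le_lt_trans yle) // ltr_nat.
rewrite (eq_bigr (fun=> 1)) => [|j _]; last first.
  by rewrite (_ : (_ <= y)) // (le_trans _ (ltW ylt)) // ler_nat.
rewrite sumr_const card_ord; have : N.+1%:R = N%:R + 1 :> R by rewrite -addn1 natrD.
by case: (leP N.+1%:R y) => Ny EN; rewrite ler_norml /= ?mulr1n ?mulr0n; apply/andP; split; lra.
Qed.

Section Multipliers.
Variables (R : realType) (m n : nat) (F : set (superfun R m n)).
Local Notation mu := (lebesgue_row R m).
Implicit Types (phi psi : superfun R m n) (h : 'rV[R]_m -> R) (q : 'rV[R]_m).
Hypothesis closedF : closed_subspace F.
Hypothesis modulationF : forall (p : 'rV[R]_m) (t : R) phi, F phi ->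
  F (fun q I => expC (Complex 0 (t - \sum_i q ord0 i * p ord0 i)) * phi q I).

Lemma closed_subspaceD phi psi : F phi -> F psi -> F (phi + psi).
Proof.
have [_ _ FP _] := closedF => Fphi Fpsi.
have := FP 1 _ _ Fphi Fpsi; congr F; congr (_ + _).
by apply/funext => q; apply/funext => I; rewrite mul1r.
Qed.

Lemma closed_subspaceZ (c : R[i]) phi : F phi -> F (fun q I => c * phi q I).
Proof.
have [_ F0 FP _] := closedF => Fphi.
by have := FP c _ _ Fphi F0; rewrite addr0.
Qed.

Definition multiplier h := [/\ measurable_fun setT h,
  exists M, forall q, `|h q| <= M & forall phi, F phi -> F (fun_scale h phi)].

Lemma multiplier_cst c : multiplier (cst c).
Proof.
split; [exact: measurable_cst|by exists (`|c|)|].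
by move=> phi Fphi; exact: (closed_subspaceZ c%:C%C Fphi).
Qed.

Lemma multiplierD h h' : multiplier h -> multiplier h' -> multiplier (fun q => h q + h' q).
Proof.
move=> [mh [M hM] Fh] [mh' [M' hM'] Fh']; split.
- exact: measurable_funD.
- by exists (M + M') => q; apply: le_trans (ler_normD _ _) (lerD _ _).
move=> phi Fphi; have := closed_subspaceD (Fh _ Fphi) (Fh' _ Fphi); congr F.
by apply/funext => q; apply/funext => I; rewrite /fun_scale rmorphD mulrDl.
Qed.

Lemma multiplierM h h' : multiplier h -> multiplier h' -> multiplier (fun q => h q * h' q).
Proof.
move=> [mh [M hM] Fh] [mh' [M' hM'] Fh']; split.
- exact: measurable_funM.
- by exists (M * M') => q; rewrite normrM ler_pM.
move=> phi Fphi; have := Fh _ (Fh' _ Fphi); congr F.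
by apply/funext => q; apply/funext => I; rewrite /fun_scale rmorphM mulrA.
Qed.

Lemma multiplierZ c h : multiplier h -> multiplier (fun q => c * h q).
Proof. by move=> hh; apply: multiplierM => //; exact: multiplier_cst. Qed.

Lemma multiplierB h h' : multiplier h -> multiplier h' -> multiplier (fun q => h q - h' q).
Proof.
move=> hh hh'; have := multiplierD hh (multiplierZ (-1) hh'); congr multiplier.
by apply/funext => q; rewrite mulN1r.
Qed.

Lemma multiplierX k h : multiplier h -> multiplier (fun q => h q ^+ k).
Proof.
move=> hh; elim: k => [|k IH]; first exact: multiplier_cst.
have := multiplierM hh IH; congr multiplier.
by apply/funext => q; rewrite exprS.
Qed.

Lemma multiplier_lim M (h_ : nat -> 'rV[R]_m -> R) h :
  (forall k, multiplier (h_ k)) -> (forall k q, `|h_ k q| <= M) ->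
  (forall q, h_ k q @[k --> \oo] --> h q) -> multiplier h.
Proof.
move=> mult_ bnd cv; have [Fhs _ _ _] := closedF.
have mh : measurable_fun setT h.
  apply: (@measurable_fun_cvg _ _ _ _ h_) => [k|q _]; last exact: cv.
  by case: (mult_ k).
have hM q : `|h q| <= M.
  by apply: (cvgr_to_le (cvg_norm (cv q))); exact: nearW.
split=> //; first by exists M.
move=> phi Fphi; have hphi := Fhs _ Fphi; have [mphi iphi] := (hsP phi).1 hphi.
have E q k : hs_density (fun_scale h phi - fun_scale (h_ k) phi) q =
    (h q - h_ k q) ^+ 2 * hs_density phi q.
  rewrite -(hs_density_scale (fun q => h q - h_ k q)); congr hs_density.
  by apply/funext => q'; apply/funext => I; rewrite /fun_scale rmorphB mulrBl.
apply: (@closed_subspace_lim _ _ _ _ closedF (fun k => fun_scale (h_ k) phi) _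
   (fun q => (2 * M) ^+ 2 * hs_density phi q)).
- by move=> k; case: (mult_ k) => _ _; apply.
- exact: hs_scale hM _.
- exact: (integrableZl _ _ iphi).
- move=> q k; rewrite E ler_wpM2r ?hs_density_ge0 //.
  rewrite -[X in X <= _]ger0_norm ?sqr_ge0 // normrX lerXn2r ?nnegrE //.
    by rewrite mulr_ge0 // (le_trans _ (hM q)).
  by rewrite mulrDl !mul1r; apply: le_trans (ler_normB _ _) (lerD _ _).
- move=> q; under eq_fun do rewrite E expr2.
  have cv0 : h q - h_ k q @[k --> \oo] --> (0 : R).
    by rewrite -(subrr (h q)); apply: cvgB => //; exact: cvg_cst.
  rewrite -(mul0r (hs_density phi q)); apply: cvgM; last exact: cvg_cst.
  by rewrite -(mul0r (0 : R)); exact: cvgM.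
Qed.

(** Half the sum of the modulations with parameters (p, t) and (-p, -t), which are complex
    conjugates of each other. *)
Lemma multiplier_cos (p : 'rV[R]_m) (t : R) :
  multiplier (fun q => cos (t - \sum_i q ord0 i * p ord0 i)).
Proof.
have meas : measurable_fun setT (fun q : 'rV[R]_m => t - \sum_i q ord0 i * p ord0 i).
  apply: measurable_funB => //; apply: measurable_sum => i.
  by apply: measurable_funM => //; exact: measurable_row_coord.
split.
- apply: (measurableT_comp _ meas); apply: continuous_measurable_fun; exact: continuous_cos.
- by exists 1 => q; rewrite ler_norml cos_geN1 cos_le1.
move=> phi Fphi.
have Fp := modulationF p t Fphi; have Fm := modulationF (- p) (- t) Fphi.
have := closed_subspaceZ (2^-1) (closed_subspaceD Fp Fm); congr F.
apply/funext => q; apply/funext => I; rewrite /fun_scale.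
have addE (f g : superfun R m n) : (f + g) q I = f q I + g q I by [].
rewrite addE -mulrDl mulrA; congr (_ * _).
rewrite (_ : - t - _ = - (t - \sum_i q ord0 i * p ord0 i)); last first.
  rewrite opprB addrC; congr (_ - _).
  by rewrite -sumrN; apply: eq_bigr => i _; rewrite mxE mulrN opprK.
set x := t - _.
rewrite /expC /= expR0 !mul1r cosN sinN.
by apply/eqP; rewrite eq_complex /=; apply/andP; split; apply/eqP; field.
Qed.


Lemma multiplier_sin (i : 'I_m) (lam c : R) :
  multiplier (fun q => sin (lam * (q ord0 i - c))).
Proof.
(* The phase pi / 2 turns the cosine into a sine, and lam c moves its zero to c. *)
have := multiplier_cos (lam *: delta_mx 0 i) (pi / 2 + lam * c).
congr multiplier; apply/funext => q.
rewrite (bigD1 i) //= !mxE !eqxx mulr1 big1 ?addr0; last first.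
  by move=> j ji; rewrite !mxE eqxx (negPf ji) !mulr0.
rewrite (_ : _ - _ = pi / 2 - lam * (q ord0 i - c)); last by ring.
by rewrite cosB cos_pihalf sin_pihalf mul0r mul1r add0r.
Qed.

Lemma multiplier_sharpen h k : (forall q, `|h q| <= 1) -> multiplier h ->
  multiplier (fun q => iter k (@sharpen R) (h q)).
Proof.
move=> h1 hh; elim: k => [|k IH] //=.
apply: multiplierZ; apply: multiplierB; first exact: multiplierZ.
exact: multiplierX.
Qed.

(** Two successive bounded limits: at a fixed wavelength the iterates of [sharpen] give the sign of
    the sine, then the wavelength goes to infinity. *)
Lemma multiplier_sgr (i : 'I_m) (c : R) : multiplier (fun q => Num.sg (q ord0 i - c)).
Proof.
have sin1 x : `|sin x| <= 1 :> R by rewrite ler_norml sin_geN1 sin_le1.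
have sg1 (x : R) : `|Num.sg x| <= 1 by rewrite normr_sg; case: eqP.
apply: (@multiplier_lim 1 (fun k q => Num.sg (sin (k.+1%:R^-1 * (q ord0 i - c))))) => //.
  move=> j; apply: (@multiplier_lim 1 (fun k q =>
    iter k (@sharpen R) (sin (j.+1%:R^-1 * (q ord0 i - c))))) => [k|k q|q].
  - by apply: multiplier_sharpen => //; exact: multiplier_sin.
  - exact: norm_iter_sharpen.
  - exact: cvg_iter_sharpen.
by move=> q; exact: cvg_sgr_sin.
Qed.

Let mult_indic (A : set 'rV[R]_m) := multiplier (\1_A : 'rV[R]_m -> R).

Let mult_indicC A : mult_indic A -> mult_indic (~` A).
Proof.
move=> hA; have := multiplierB (multiplier_cst 1) hA; congr multiplier.
by apply/funext => q; rewrite !indicE in_setC; case: (_ \in _); rewrite ?subrr ?subr0.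
Qed.

(** The complement of the union has for indicator the limit of the finite products of the 1 - 1_A;
    at each point these are eventually constant. *)
Let mult_indic_bigcup (A : (set 'rV[R]_m)^nat) : (forall k, mult_indic (A k)) ->
  mult_indic (\bigcup_k A k).
Proof.
move=> hA; pose u k q : R := \prod_(j < k) (1 - \1_(A j) q).
have fac01 j q : 0 <= 1 - (\1_(A j) q : R) <= 1.
  by rewrite indicE; case: (_ \in _); rewrite ?subrr ?subr0 lexx ler01.
have u01 k q : 0 <= u k q <= 1.
  by rewrite prodr_ge0 ?prodr_ile1 // => j _; case/andP: (fac01 j q).
have hu k : multiplier (u k).
  elim: k => [|k IH].
    rewrite (_ : u 0%N = cst 1); first exact: multiplier_cst.
    by apply/funext => q; rewrite /u big_ord0.
  rewrite (_ : u k.+1 = fun q => u k q * (1 - \1_(A k) q)).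
    by apply: multiplierM => //; exact: (multiplierB (multiplier_cst 1) (hA k)).
  by apply/funext => q; rewrite /u big_ord_recr.
apply: (@multiplier_lim 1 (fun k q => 1 - u k q)) => [k|k q|q].
- exact: (multiplierB (multiplier_cst 1) (hu k)).
- by have /andP[? ?] := u01 k q; rewrite ger0_norm; lra.
apply: cvg_near_cst; rewrite indicE.
have [/set_mem[j _ Aj]|nA] := boolP (q \in _).
  near=> k; have jk : (j < k)%N by near: k; exact: nbhs_infty_gt.
  rewrite /u (bigD1 (Ordinal jk)) //= indicE mem_set // subrr mul0r subr0 //.
apply: nearW => k; rewrite /u big1 ?subrr // => j _.
rewrite indicE memNset ?subr0 // => Aj.
by move/negP: nA; apply; rewrite inE; exists j.
Unshelve. all: by end_near. Qed.

(** The sets whose indicator is a multiplier form a sigma-algebra, so it is enough to treat the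
    half-spaces q_i < c, which generate the measurable sets. *)
Lemma multiplier_indic A : measurable A -> multiplier (\1_A : 'rV[R]_m -> R).
Proof.
have indic0 : mult_indic set0.
  have := multiplier_cst 0; congr multiplier.
  by apply/funext => q; rewrite indicE in_set0.
suff sub : @measurable _ 'rV[R]_m `<=` [set B | mult_indic B] by exact: sub.
apply: smallest_sub => /=.
  by split=> [//|B hB|B hB]; [rewrite setTD; exact: mult_indicC|exact: mult_indic_bigcup].
elim/big_ind: _ => [//|B C hB hC|i _]; first by rewrite subUset.
move=> _ [B mB <-]; rewrite setTI; move: B mB.
change (measurable `<=` [set B : set R | mult_indic (row_coord i @^-1` B)]).
rewrite [measurable](RGenInftyO.measurableE R); apply: smallest_sub => /=.
  split=> [|B hB|B hB].
  - by rewrite /= preimage_set0.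
  - by rewrite /= setTD preimage_setC; exact: mult_indicC.
  - by rewrite /= preimage_bigcup; exact: mult_indic_bigcup.
move=> _ [c ->] /=.
(* With s the sign of q_i - c, (s^2 - s) / 2 is 1 for s = -1 and 0 for s = 0 or 1. *)
have := multiplierZ 2^-1 (multiplierB (multiplierX 2 (multiplier_sgr i c)) (multiplier_sgr i c)).
congr multiplier; apply/funext => q; rewrite indicE.
rewrite (_ : (q \in _) = (q ord0 i - c < 0)); last first.
  by rewrite subr_lt0; apply/idP/idP; rewrite inE /= in_itv.
case: (ltrgt0P (q ord0 i - c)) => x.
- by rewrite gtr0_sg //=; field.
- by rewrite ltr0_sg //=; field.
- by rewrite x sgr0 /=; field.
Qed.

Let multiplier_sum N (h_ : nat -> 'rV[R]_m -> R) : (forall j, multiplier (h_ j)) ->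
  multiplier (fun q => \sum_(j < N) h_ j q).
Proof.
move=> hh; elim: N => [|N IH].
  have := multiplier_cst 0; congr multiplier.
  by apply/funext => q; rewrite big_ord0.
have := multiplierD IH (hh N); congr multiplier.
by apply/funext => q; rewrite big_ord_recr.
Qed.

(** A function with values in [0, 1] is a uniform limit of averages of the indicators of its
    superlevel sets; an affine change of values reduces the bounded case to this one. *)
Lemma multiplier_bounded M h : measurable_fun setT h -> (forall q, `|h q| <= M) ->
  multiplier h.
Proof.
move=> + hM.
wlog h01 : h M hM / forall q, 0 <= h q <= 1 => [hw mh|mh].
  have M0 : 0 <= M by apply: le_trans (hM 0); exact: normr_ge0.
  (* The added 1 keeps the divisor positive even when M = 0. *)
  pose D := 2 * (M + 1); have D0 : 0 < D by rewrite /D; lra.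
  have := multiplierB (multiplierZ D (hw (fun q => (h q + M + 1) / D) 1 _ _ _)) (multiplier_cst (M + 1)).
  have b q : 0 <= (h q + M + 1) / D <= 1.
    have := hM q; rewrite ler_norml => /andP[? ?].
    by rewrite divr_ge0 ?(ltW D0) ?ler_pdivrMr // ?mul1r /D; lra.
  have -> : (fun q => D * ((h q + M + 1) / D) - cst (M + 1) q) = h.
    by apply/funext => q; rewrite mulrC divfK ?gt_eqF //=; ring.
  apply=> //.
    by move=> q; have /andP[? ?] := b q; rewrite ger0_norm.
  by apply: measurable_funM => //; apply: measurable_funD => //; apply: measurable_funD.
(* This is the integer part of (N + 1) h, divided by N + 1. *)
pose h_ N q : R := \sum_(j < N.+1) N.+1%:R^-1 * \1_[set q | j.+1%:R <= N.+1%:R * h q] q.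
have hE N q : `|h_ N q - h q| <= N.+1%:R^-1.
  have N0 : 0 < N.+1%:R :> R by rewrite ltr0n.
  have -> : h_ N q - h q = N.+1%:R^-1 *
      (\sum_(j < N.+1) (j.+1%:R <= N.+1%:R * h q)%R%:R - N.+1%:R * h q).
    rewrite mulrBr mulKf ?gt_eqF // mulr_sumr; congr (_ - _); apply: eq_bigr => j _.
    by rewrite indicE; congr (_ * _%:R); congr nat_of_bool; apply/idP/idP; rewrite inE.
  rewrite normrM ger0_norm ?invr_ge0 ?(ltW N0) // ler_piMr ?invr_ge0 ?(ltW N0) //.
  apply: dist_floor_sum; have /andP[h0 h1] := h01 q.
  by rewrite mulr_ge0 ?(ltW N0) // ler_piMr // ltW.
have inv1 N : N.+1%:R^-1 <= 1 :> R by rewrite invf_le1 ?ltr0n // ler1n.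
apply: (@multiplier_lim 2 h_) => [N|N q|q].
- apply: (@multiplier_sum N.+1 (fun j q =>
    N.+1%:R^-1 * \1_[set q | j.+1%:R <= N.+1%:R * h q] q)) => j; apply/multiplierZ/multiplier_indic.
  rewrite -[X in measurable X]setTI; apply: measurable_fun_ler => //.
  exact: measurable_funM.
- have := hE N q; have := inv1 N; have /andP[] := h01 q; move: (_^-1) (h_ N q) => e x ? ? ?.
  by rewrite !ler_norml => /andP[? ?]; apply/andP; split; lra.
have cv c : h q + c * N.+1%:R^-1 @[N --> \oo] --> h q.
  rewrite -[X in _ --> X]addr0; apply: cvgD; first exact: cvg_cst.
  by rewrite -(mulr0 c); apply: cvgM; [exact: cvg_cst|exact: cvg_harmonic].
apply: (squeeze_cvgr _ (cv (-1)) (cv 1)); apply: nearW => N.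
have := hE N q; move: (_^-1) (h_ N q) => e x.
by rewrite ler_norml => /andP[? ?]; apply/andP; split; lra.
Qed.

End Multipliers.

(** * Averaging against a Gaussian *)

Section RowIntegralMore.
Variables (R : realType) (m : nat).
Local Notation mu := (lebesgue_row R m).

Lemma integral_row_shift (c : 'rV[R]_m) (f : 'rV[R]_m -> \bar R) :
  measurable_fun setT f -> (\int[mu]_x f (x + c)%R = \int[mu]_x f x)%E.
Proof.
move=> mf; rewrite integralE [RHS]integralE; congr (_ - _)%E.
  rewrite -(ge0_integral_row_shift c (measurable_funepos mf)) //.
  by apply: eq_integral => x _; rewrite !funeposE.
rewrite -(ge0_integral_row_shift c (measurable_funeneg mf)) //.
by apply: eq_integral => x _; rewrite !funenegE.
Qed.

Lemma integrable_row_shift (c : 'rV[R]_m) (f : 'rV[R]_m -> \bar R) :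
  mu.-integrable setT f -> mu.-integrable setT (fun x => f (x + c)%R).
Proof.
move=> /integrableP[mf lt]; apply/integrableP; split.
  exact: (measurableT_comp mf (measurable_row_shift c)).
rewrite (integral_row_shift c (f := fun x => `|f x|%E)) //.
exact: (measurableT_comp _ mf).
Qed.

Lemma integrable_gauss (c : R) : 1 <= c -> mu.-integrable setT (fun x => (gauss c x)%:E).
Proof.
move=> c1; have int1 : mu.-integrable setT (fun x => (gauss 1 x)%:E).
  apply/integrableP; split.
    by apply/measurable_EFinP; exact: measurable_gauss.
  under eq_integral do rewrite gee0_abs ?lee_fin ?(ltW (gauss_gt0 _ _)) //.
  exact: integral_gauss_lty.
apply: le_integrable int1 => //.
  by apply/measurable_EFinP; exact: measurable_gauss.
move=> x _; rewrite /= !ger0_norm ?(ltW (gauss_gt0 _ _)) // lee_fin ler_expR lerN2.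
by rewrite ler_wpM2r ?sqnorm_ge0.
Qed.

(** 2 |x|^2 + 2 |x + a|^2 - |a|^2 = |2 x + a|^2. This bound, uniform in x and integrable in a,
    controls the averages over translations. *)
Lemma gaussM_le (x a : 'rV[R]_m) : gauss 2 x * gauss 2 (x + a) <= gauss 1 a.
Proof.
rewrite /gauss -expRD ler_expR /sqnorm !mulr_sumr -!sumrN -big_split /=.
apply: ler_sum => i _; rewrite !mxE -subr_ge0.
rewrite (_ : _ - _ = (2 * x ord0 i + a ord0 i) ^+ 2); last by ring.
exact: sqr_ge0.
Qed.

End RowIntegralMore.

(** * Real inner product and squared norm *)

Section InnerProduct.
Variables (R : realType) (m n : nat).
Local Notation mu := (lebesgue_row R m).
Implicit Types (phi psi : superfun R m n).

Definition hs_sqnorm phi : R := \int[mu]_q (hs_density phi q).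
Definition hs_inner phi psi : R := \int[mu]_q (hs_pair phi psi q).

Lemma hs_sqnormE phi : hs phi -> hs_norm2 phi = (hs_sqnorm phi)%:E.
Proof.
move=> /hsP[mphi iphi]; rewrite hs_norm2E // /hs_sqnorm /Rintegral fineK //.
exact: integrable_fin_num.
Qed.

Lemma hs_sqnorm_ge0 phi : 0 <= hs_sqnorm phi.
Proof. by apply: Rintegral_ge0 => q _; exact: hs_density_ge0. Qed.

Lemma integrable_hs_pair phi psi : hs phi -> hs psi ->
  mu.-integrable setT (EFin \o hs_pair phi psi).
Proof.
move=> /hsP[mphi iphi] /hsP[mpsi ipsi].
apply: (le_integrable measurableT _ _ (integrableD measurableT iphi ipsi)).
  by apply/measurable_EFinP; exact: measurable_hs_pair.
move=> q _; rewrite /= lee_fin [X in _ <= X]ger0_norm ?hs_pair_le //.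
by rewrite addr_ge0 ?hs_density_ge0.
Qed.

Lemma hs_innerBr phi psi psi' : hs phi -> hs psi -> hs psi' ->
  hs_inner phi (psi - psi') = hs_inner phi psi - hs_inner phi psi'.
Proof.
move=> hphi hpsi hpsi'; rewrite /hs_inner -RintegralB //; try exact: integrable_hs_pair.
apply: eq_Rintegral => q _; rewrite /hs_pair -sumrB; apply: eq_bigr => I _.
rewrite -[(psi - psi') q I]/(psi q I - psi' q I).
by case: (phi q I) (psi q I) (psi' q I) => a b [c d] [e f] /=; ring.
Qed.

Lemma hs_sqnormBZ phi psi (t : R) : hs phi -> hs psi ->
  hs_sqnorm (phi - (fun q I => t%:C%C * psi q I)) =
  hs_sqnorm phi - 2 * t * hs_inner phi psi + t ^+ 2 * hs_sqnorm psi.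
Proof.
move=> hphi hpsi; have [_ iphi] := (hsP phi).1 hphi; have [_ ipsi] := (hsP psi).1 hpsi.
have ipair := integrable_hs_pair hphi hpsi.
rewrite /hs_sqnorm /hs_inner -!RintegralZl // -RintegralB //; last first.
  exact: (integrableZl _ (2 * t) ipair).
rewrite -RintegralD //.
- apply: eq_Rintegral => q _; rewrite hs_densityB.
  rewrite -[X in _ + X]/(hs_density (fun_scale (cst t) psi) q) hs_density_scale.
  congr (_ - _ + _); rewrite -mulrA; congr (_ * _); rewrite /hs_pair mulr_sumr.
  by apply: eq_bigr => I _; case: (phi q I) (psi q I) => a b [c d] /=; ring.
- exact: (integrableB _ iphi (integrableZl _ (2 * t) ipair)).
- exact: (integrableZl _ (t ^+ 2) ipsi).
Qed.

Lemma hs_densityN phi q : hs_density (- phi) q = hs_density phi q.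
Proof.
apply: eq_bigr => I _; rewrite -[(- phi) q I]/(- phi q I).
by case: (phi q I) => a b /=; ring.
Qed.

Lemma hs_sqnorm_le phi psi : hs phi -> hs psi ->
  hs_sqnorm psi <= 2 * hs_sqnorm phi + 2 * hs_sqnorm (phi - psi).
Proof.
move=> hphi hpsi; have [_ iphi] := (hsP phi).1 hphi; have [_ ipsi] := (hsP psi).1 hpsi.
have hB := hsB hphi hpsi; have [_ iB] := (hsP _).1 hB.
rewrite /hs_sqnorm -!RintegralZl // -RintegralD //; last 2 first.
- exact: (integrableZl _ 2 iphi).
- exact: (integrableZl _ 2 iB).
apply: le_Rintegral => //.
  exact: (integrableD _ (integrableZl _ 2 iphi) (integrableZl _ 2 iB)).
move=> q _; have := hs_densityD_le phi (- (phi - psi)) q.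
rewrite (_ : phi - (phi - psi) = psi); last by rewrite opprB addrC subrK.
by rewrite hs_densityN.
Qed.

End InnerProduct.

Section Core.
Variables (R : realType) (m n : nat) (F : set (superfun R m n)).
Local Notation mu := (lebesgue_row R m).
Implicit Types (phi psi : superfun R m n).
Hypothesis closedF : closed_subspace F.
Hypothesis modulationF : forall (p : 'rV[R]_m) (t : R) phi, F phi ->
  F (fun q I => expC (Complex 0 (t - \sum_i q ord0 i * p ord0 i)) * phi q I).
Hypothesis translationF : forall (a : 'rV[R]_m) phi, F phi -> F (fun q I => phi (q - a) I).

Definition gauss_mean phi (I : {set 'I_n}) : R[i] :=
  Complex (\int[mu]_q (gauss 2 q * complex.Re (phi q I)))
          (\int[mu]_q (gauss 2 q * complex.Im (phi q I))).

Definition gauss_tensor (v : {set 'I_n} -> R[i]) : superfun R m n :=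
  fun q I => (gauss 2 q)%:C%C * v I.

Lemma gauss_sqr_le (q : 'rV[R]_m) : gauss 2 q ^+ 2 <= gauss 2 q.
Proof. by rewrite expr2 ler_piMr ?(ltW (gauss_gt0 _ _)) // gauss_le1. Qed.

Lemma integrable_gaussM phi I : hs phi ->
  mu.-integrable setT (fun q => (gauss 2 q * complex.Re (phi q I))%:E) /\
  mu.-integrable setT (fun q => (gauss 2 q * complex.Im (phi q I))%:E).
Proof.
move=> /hsP[mphi iphi].
have ig : mu.-integrable setT (fun q => (gauss 2 q)%:E).
  by apply: integrable_gauss; rewrite ler1n.
have main (f : 'rV[R]_m -> R) : measurable_fun setT f ->
    (forall q, f q ^+ 2 <= hs_density phi q) ->
    mu.-integrable setT (fun q => (gauss 2 q * f q)%:E).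
  move=> mf f2; apply: (le_integrable measurableT _ _ (integrableD measurableT ig iphi)).
    by apply/measurable_EFinP; apply: measurable_funM => //; exact: measurable_gauss.
  move=> q _; rewrite /= lee_fin.
  have g0 := ltW (gauss_gt0 2 q); have d0 := hs_density_ge0 phi q.
  rewrite normrM (ger0_norm g0) [X in _ <= X]ger0_norm ?addr_ge0 //.
  have := f2 q; have := gauss_sqr_le q; rewrite -[f q ^+ 2]ger0_norm ?sqr_ge0 // normrX.
  move: (gauss 2 q) `|f q| (hs_density phi q) g0 d0 => x y z x0 z0 xx yz.
  have : 0 <= (x - y) ^+ 2 by exact: sqr_ge0.
  rewrite sqrrB; have : 0 <= x ^+ 2 by exact: sqr_ge0. have : 0 <= y ^+ 2 by exact: sqr_ge0.
  by move=> *; lra.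
split; apply: main; try by case: (mphi I).
  move=> q; rewrite /hs_density /hs_pair (bigD1 I) //= -!expr2 -addrA lerDl.
  by rewrite addr_ge0 ?sqr_ge0 // sumr_ge0 // => J _; rewrite -!expr2 addr_ge0 ?sqr_ge0.
move=> q; rewrite /hs_density /hs_pair (bigD1 I) //= -!expr2 [X in X + _]addrC -addrA lerDl.
by rewrite addr_ge0 ?sqr_ge0 // sumr_ge0 // => J _; rewrite -!expr2 addr_ge0 ?sqr_ge0.
Qed.

Lemma hs_density_gauss_tensor v q :
  hs_density (gauss_tensor v) q = gauss 2 q ^+ 2 * \sum_I (complex.Re (v I) ^+ 2 + complex.Im (v I) ^+ 2).
Proof.
rewrite /hs_density /hs_pair mulr_sumr; apply: eq_bigr => I _.
by rewrite /gauss_tensor; case: (v I) => a b /=; ring.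
Qed.

Lemma hs_gauss_tensor v : hs (gauss_tensor v).
Proof.
apply: (hs_le (G := fun q => (\sum_I (complex.Re (v I) ^+ 2 + complex.Im (v I) ^+ 2)) * gauss 2 q)).
- move=> I; rewrite /gauss_tensor; split.
    rewrite (_ : (fun q => _) = fun q => gauss 2 q * complex.Re (v I)).
      by apply: measurable_funM => //; exact: measurable_gauss.
    by apply/funext => q; case: (v I) => a b /=; ring.
  rewrite (_ : (fun q => _) = fun q => gauss 2 q * complex.Im (v I)).
    by apply: measurable_funM => //; exact: measurable_gauss.
  by apply/funext => q; case: (v I) => a b /=; ring.
- have ig : mu.-integrable setT (fun q => (gauss 2 q)%:E).
    by apply: integrable_gauss; rewrite ler1n.
  exact: (integrableZl _ _ ig).
- move=> q; rewrite hs_density_gauss_tensor mulrC ler_wpM2l ?gauss_sqr_le //.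
  by apply: sumr_ge0 => I _; rewrite addr_ge0 ?sqr_ge0.
Qed.

(* [weyl a phi x = g(x) g(x + a) phi(x + a)] is again in F, and its integral
   over a is [gauss_tensor (gauss_mean phi)]. *)
Definition weyl phi (a : 'rV[R]_m) : superfun R m n :=
  fun_scale (fun x => gauss 2 x * gauss 2 (x + a)) (fun x I => phi (x + a) I).

Lemma weyl_closed phi a : F phi -> F (weyl phi a).
Proof.
move=> Fphi; have mult : multiplier F (fun x => gauss 2 x * gauss 2 (x + a)).
  apply: (@multiplier_bounded _ _ _ _ closedF modulationF 1).
    apply: measurable_funM; first exact: measurable_gauss.
    exact: (measurableT_comp (measurable_gauss 2) (measurable_row_shift a)).
  move=> q; rewrite ger0_norm ?mulr_ge0 ?(ltW (gauss_gt0 _ _)) //.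
  by rewrite mulr_ile1 ?(ltW (gauss_gt0 _ _)) // gauss_le1.
case: mult => _ _; apply.
have := translationF (- a) Fphi; congr F; apply/funext => x; by rewrite opprK.
Qed.

Lemma hs_density_weyl phi a x :
  hs_density (weyl phi a) x <= gauss 1 a ^+ 2 * hs_density phi (x + a).
Proof.
rewrite /weyl hs_density_scale ler_wpM2r ?hs_density_ge0 //.
rewrite lerXn2r ?nnegrE ?mulr_ge0 ?(ltW (gauss_gt0 _ _)) //.
exact: gaussM_le.
Qed.

Lemma hs_sqnorm_weyl phi a : hs phi -> hs (weyl phi a) ->
  hs_sqnorm (weyl phi a) <= gauss 1 a ^+ 2 * hs_sqnorm phi.
Proof.
move=> /hsP[mphi iphi] /hsP[mw iw]; rewrite /hs_sqnorm.
have ishift := integrable_row_shift a iphi.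
rewrite [in X in _ <= X](_ : \int[mu]_q hs_density phi q = \int[mu]_q hs_density phi (q + a)).
  rewrite -RintegralZl //; apply: le_Rintegral => //.
    exact: (integrableZl _ _ ishift).
  by move=> x _; exact: hs_density_weyl.
by rewrite /Rintegral (integral_row_shift a (f := fun x => (hs_density phi x)%:E)) //; case/integrableP: iphi.
Qed.

(** Exchanging the integrals over a and x shows that the average of [weyl phi a] is the Gaussian
    tensor in the weak sense, without vector-valued integration. The domination is [gauss 1 a] times
    the sum of the densities of psi at x and of phi at x + a. *)
Lemma hs_inner_weyl phi psi : hs phi -> hs psi -> (forall a, hs (weyl phi a)) ->
  mu.-integrable setT (fun a => (hs_inner psi (weyl phi a))%:E) /\
  hs_inner psi (gauss_tensor (gauss_mean phi)) = \int[mu]_a (hs_inner psi (weyl phi a)).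
Proof.
move=> hphi hpsi hweyl; have [mphi iphi] := (hsP phi).1 hphi; have [mpsi ipsi] := (hsP psi).1 hpsi.
pose H (z : 'rV[R]_m * 'rV[R]_m) : \bar R := (hs_pair psi (weyl phi z.1) z.2)%:E.
have HE a x : hs_pair psi (weyl phi a) x = \sum_I
    (gauss 2 x * complex.Re (psi x I) * (gauss 2 (x + a) * complex.Re (phi (x + a) I)) +
     gauss 2 x * complex.Im (psi x I) * (gauss 2 (x + a) * complex.Im (phi (x + a) I))).
  apply: eq_bigr => I _; rewrite /weyl /fun_scale.
  by case: (psi x I) (phi (x + a) I) => c d [e f] /=; ring.
have madd : measurable_fun setT (fun z : 'rV[R]_m * 'rV[R]_m => z.2 + z.1).
  apply: (eq_measurable_fun (fun z : 'rV[R]_m * 'rV[R]_m => z.1 + z.2)).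
    by move=> z _; rewrite addrC.
  exact: measurable_row_add.
have mH : measurable_fun setT H.
  apply/measurable_EFinP; rewrite (_ : (fun z => _) = fun z : 'rV[R]_m * 'rV[R]_m => \sum_I
    (gauss 2 z.2 * complex.Re (psi z.2 I) * (gauss 2 (z.2 + z.1) * complex.Re (phi (z.2 + z.1) I)) +
     gauss 2 z.2 * complex.Im (psi z.2 I) * (gauss 2 (z.2 + z.1) * complex.Im (phi (z.2 + z.1) I)))); last first.
    by apply/funext => z; exact: HE.
  have mg := measurable_gauss (m := m) (2 : R).
  apply: measurable_sum => I; have [p1 p2] := mphi I; have [s1 s2] := mpsi I.
  apply: measurable_funD; apply: measurable_funM; apply: measurable_funM.
  - exact: (measurableT_comp mg measurable_snd).
  - exact: (measurableT_comp s1 measurable_snd).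
  - exact: (measurableT_comp mg madd).
  - exact: (measurableT_comp p1 madd).
  - exact: (measurableT_comp mg measurable_snd).
  - exact: (measurableT_comp s2 measurable_snd).
  - exact: (measurableT_comp mg madd).
  - exact: (measurableT_comp p2 madd).
have Hle a x : (`|H (a, x)| <= (gauss 1 a)%:E * ((hs_density psi x)%:E + (hs_density phi (x + a))%:E))%E.
  rewrite /H /= lee_fin.
  have -> : hs_pair psi (weyl phi a) x = gauss 2 x * gauss 2 (x + a) *
      hs_pair psi (fun x I => phi (x + a) I) x.
    rewrite /hs_pair mulr_sumr; apply: eq_bigr => I _; rewrite /weyl /fun_scale.
    by case: (psi x I) (phi (x + a) I) => c d [e f] /=; ring.
  rewrite normrM ger0_norm ?mulr_ge0 ?(ltW (gauss_gt0 _ _)) //.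
  apply: ler_pM => //; first by rewrite ?mulr_ge0 ?(ltW (gauss_gt0 _ _)).
    exact: gaussM_le.
  exact: (hs_pair_le psi (fun x I => phi (x + a) I) x).
have inner_x a : (\int[mu]_x H (a, x) = (hs_inner psi (weyl phi a))%:E)%E.
  rewrite /hs_inner /Rintegral fineK //.
  by apply: integrable_fin_num => //; exact: integrable_hs_pair.
have iH : (mu \x mu)%E.-integrable setT H.
  apply/integrable12ltyP => //.
  have ig : mu.-integrable setT (fun a => (gauss 1 a)%:E) by exact: integrable_gauss.
  have /integrableP[mZ] := integrableZl measurableT (hs_sqnorm psi + hs_sqnorm phi) ig.
  apply: le_lt_trans; apply: ge0_le_integral => //.
  - by move=> a _; apply: integral_ge0.
  - apply: (measurable_fun_fubini_tonelli_F (abse \o H)); last by move=> z; exact: abse_ge0.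
    exact: (measurableT_comp _ mH).
  - exact: (measurableT_comp _ mZ).
  move=> a _; rewrite gee0_abs; last first.
    by rewrite lee_fin mulr_ge0 ?(ltW (gauss_gt0 _ _)) // addr_ge0 ?hs_sqnorm_ge0.
  have ishift := integrable_row_shift a iphi.
  have -> : ((hs_sqnorm psi + hs_sqnorm phi)%:E * (gauss 1 a)%:E =
     \int[mu]_x ((gauss 1 a)%:E * ((hs_density psi x)%:E + (hs_density phi (x + a))%:E)))%E.
    rewrite integralZl //; last exact: integrableD.
    rewrite integralD // (integral_row_shift a (f := fun x => (hs_density phi x)%:E)); last first.
      by case/integrableP: iphi.
    rewrite muleC EFinD; congr (_ * (_ + _))%E; rewrite /hs_sqnorm /Rintegral fineK //;
    exact: integrable_fin_num.
  apply: ge0_le_integral => //.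
  - exact: (measurableT_comp _ (measurableT_comp mH (measurable_pair1 a))).
  - by case/integrableP: (integrableZl measurableT (gauss 1 a) (integrableD measurableT ipsi ishift)).
(* For fixed x, invariance under a -> a + x removes x from the integral of g phi and leaves the
   mean. *)
have inner_a x : (\int[mu]_a H (a, x) = (hs_pair psi (gauss_tensor (gauss_mean phi)) x)%:E)%E.
  have i1 I := integrable_row_shift x (integrable_gaussM I hphi).1.
  have i2 I := integrable_row_shift x (integrable_gaussM I hphi).2.
  pose G I a := ((gauss 2 x * complex.Re (psi x I))%:E *
        (gauss 2 (a + x) * complex.Re (phi (a + x) I))%:E +
      (gauss 2 x * complex.Im (psi x I))%:E *
        (gauss 2 (a + x) * complex.Im (phi (a + x) I))%:E)%E.
  have iG I : mu.-integrable setT (G I).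
    exact: (integrableD measurableT (integrableZl measurableT _ (i1 I)) (integrableZl measurableT _ (i2 I))).
  transitivity (\int[mu]_a \sum_I G I a)%E.
    apply: eq_integral => a _; rewrite /H /= HE -sumEFin; apply: eq_bigr => I _.
    by rewrite /G -!EFinM -EFinD [a + x]addrC.
  rewrite integral_sum //.
  rewrite /hs_pair -sumEFin; apply: eq_bigr => I _.
  have fin1 : (\int[mu]_q (gauss 2 q * complex.Re (phi q I))%:E)%E \is a fin_num.
    by apply: integrable_fin_num => //; case: (integrable_gaussM I hphi).
  have fin2 : (\int[mu]_q (gauss 2 q * complex.Im (phi q I))%:E)%E \is a fin_num.
    by apply: integrable_fin_num => //; case: (integrable_gaussM I hphi).
  rewrite (integralD measurableT (integrableZl measurableT _ (i1 I)) (integrableZl measurableT _ (i2 I))).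
  rewrite (integralZl measurableT (i1 I)) (integralZl measurableT (i2 I)).
  rewrite (integral_row_shift x (f := fun q => (gauss 2 q * complex.Re (phi q I))%:E)); last first.
    by case/integrableP: (integrable_gaussM I hphi).1.
  rewrite (integral_row_shift x (f := fun q => (gauss 2 q * complex.Im (phi q I))%:E)); last first.
    by case/integrableP: (integrable_gaussM I hphi).2.
  rewrite -(fineK fin1) -(fineK fin2) -!EFinM -EFinD; congr EFin.
  rewrite /gauss_tensor /gauss_mean /Rintegral /=.
  by move: (fine _) (fine _) => c d; ring.
split.
  have := integrable_fubini_F iH; apply: eq_integrable => // a _.
  exact: inner_x.
rewrite /hs_inner [LHS]/Rintegral [RHS]/Rintegral; congr fine.
under eq_integral do rewrite -inner_a.
rewrite -(Fubini iH); apply: eq_integral => a _; exact: inner_x.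
Qed.

(* Approximate orthogonality to F, tested against the averages of elements of F
   in [weyl], replaces the projection theorem. *)
Lemma gauss_mean_closed phi : F phi -> F (gauss_tensor (gauss_mean phi)).
Proof.
have [Fhs F0 FP Fclosed] := closedF.
move=> Fphi; have hphi := Fhs _ Fphi; set u := gauss_tensor _.
have hu : hs u by exact: hs_gauss_tensor.
have hw a : hs (weyl phi a) by apply/Fhs/weyl_closed.
apply: Fclosed => // e0 e0pos; apply: contrapT => far.
have {}far f : F f -> e0 <= hs_sqnorm (u - f).
  move=> Ff; rewrite leNgt; apply/negP => lt; apply: far; exists f => //.
  by rewrite hs_sqnormE ?lte_fin //; apply: hsB => //; exact: Fhs.
pose S := [set hs_sqnorm (u - f) | f in F].
have S0 : S !=set0 by exists (hs_sqnorm (u - 0)), 0.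
have lbS : has_lbound S by exists e0 => _ [f Ff <-]; exact: far.
pose d := inf S.
have d0 : 0 < d.
  by apply: (lt_le_trans e0pos); apply: lb_le_inf => // _ [f Ff <-]; exact: far.
pose C := \int[mu]_a gauss 1 a.
have C0 : 0 <= C by apply: Rintegral_ge0 => a _; exact: ltW (gauss_gt0 _ _).
pose N := hs_sqnorm phi.
have N0 : 0 <= N by exact: hs_sqnorm_ge0.
(* Bounds |f|^2 for every f whose squared distance to u is below d + 1. *)
pose M := 2 * hs_sqnorm u + 2 * (d + 1).
have M0 : 0 <= M by have := hs_sqnorm_ge0 u; rewrite /M; lra.
(* An f within t^2 of the infimum makes u - f orthogonal to F up to order t, and |u - f|^2 is then
   itself of order t, since u is an average of elements of F and f is in F. *)
have small t : 0 < t -> t <= 1 -> d <= t / 2 * (C * (1 + N) + (1 + M)).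
  move=> t0 t1; have tt0 : 0 < t ^+ 2 by rewrite exprn_gt0.
  have tt1 : t ^+ 2 <= 1 by rewrite expr_le1 // ltW.
  have [_ [f Ff <-] fd] : exists2 x, S x & x < d + t ^+ 2 by apply: inf_adherent; last split.
  have hf := Fhs _ Ff; set psi := u - f in fd.
  have hpsi : hs psi by exact: hsB.
  have dpsi : d <= hs_sqnorm psi by apply: ge_inf => //; exists f.
  (* Moving f by c g cannot bring the squared distance below d, and it started below d + t^2. *)
  have orth g (c : R) : F g -> 2 * c * hs_inner psi g <= t ^+ 2 + c ^+ 2 * hs_sqnorm g.
    move=> Fg; have hg := Fhs _ Fg.
    have : d <= hs_sqnorm (psi - (fun q I => c%:C%C * g q I)).
      apply: ge_inf => //; exists (f + (fun q I => c%:C%C * g q I)).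
        by have := FP c%:C%C _ _ Fg Ff; rewrite addrC.
      by rewrite opprD addrA.
    by rewrite hs_sqnormBZ //; lra.
  have fM : hs_sqnorm f <= M.
    by apply: le_trans (hs_sqnorm_le hu hf) _; rewrite /M; lra.
  have Hf : - hs_inner psi f <= t / 2 * (1 + M).
    have := orth f (- t) Ff.
    rewrite sqrrN; have : t ^+ 2 * hs_sqnorm f <= t ^+ 2 * M by rewrite ler_wpM2l // ltW.
    move=> h1 h2; have : t * (2 * - hs_inner psi f) <= t * (t * (1 + M)) by lra.
    by rewrite ler_pM2l //; lra.
  (* Taking c = t / [gauss 1 a] compensates the decay of the norm of [weyl phi a], so that the
     resulting bound is proportional to [gauss 1 a] and integrable in a. *)
  have Hw a : hs_inner psi (weyl phi a) <= t / 2 * (1 + N) * gauss 1 a.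
    have g0 := gauss_gt0 1 a; have := orth (weyl phi a) (t / gauss 1 a) (weyl_closed a Fphi).
    have : (t / gauss 1 a) ^+ 2 * hs_sqnorm (weyl phi a) <= t ^+ 2 * N.
      have -> : t ^+ 2 * N = (t / gauss 1 a) ^+ 2 * (gauss 1 a ^+ 2 * N).
        by rewrite mulrA -exprMn divfK // gt_eqF.
      by rewrite ler_wpM2l ?sqr_ge0 // hs_sqnorm_weyl.
    move=> h1 h2; rewrite -ler_pdivrMr //.
    have : t * (2 * (hs_inner psi (weyl phi a) / gauss 1 a)) <= t * (t * (1 + N)).
      rewrite (_ : t * (2 * _) = 2 * (t / gauss 1 a) * hs_inner psi (weyl phi a)); last by ring.
      lra.
    by rewrite ler_pM2l //; lra.
  have [iw wE] := hs_inner_weyl hphi hpsi hw.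
  have Hu : hs_inner psi u <= t / 2 * (1 + N) * C.
    rewrite wE /C -RintegralZl //; last exact: integrable_gauss.
    apply: le_Rintegral => //.
    exact: (integrableZl _ _ (integrable_gauss _ _)).
  have : hs_sqnorm psi = hs_inner psi u - hs_inner psi f.
    by rewrite -hs_innerBr.
  by move=> E; lra.
pose B := C * (1 + N) + (1 + M).
have B0 : 0 < B by rewrite /B; have := mulr_ge0 C0 N0; lra.
(* With t at most d / B the estimate reads d <= d / 2, against d > 0. *)
have := small (Num.min 1 (d / B)); rewrite lt_min ltr01 divr_gt0 //= ge_min lexx /= => /(_ isT isT).
have : Num.min 1 (d / B) / 2 * B <= d / 2.
  rewrite mulrAC ler_pM2r ?invr_gt0 // -ler_pdivlMr //.
  by rewrite ge_min lexx orbT.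
rewrite -/B; lra.
Qed.

End Core.

(** * From Gaussian tensors back to the whole subspace *)

Section Clip.
Variable R : realType.
Implicit Types (M x : R).

Definition clip M x : R := Num.max (- M) (Num.min M x).

Lemma norm_clip_le M x : 0 <= M -> `|clip M x| <= M.
Proof.
move=> M0; rewrite /clip ler_norml; apply/andP; split; first by rewrite le_max lexx.
by rewrite ge_max ge_min lexx andbT; lra.
Qed.

Lemma clip_id M x : `|x| <= M -> clip M x = x.
Proof.
rewrite ler_norml => /andP[a b]; rewrite /clip (min_idPr b).
by apply/max_idPr.
Qed.

Lemma clip_dist M x : 0 <= M -> `|x - clip M x| <= `|x|.
Proof.
move=> M0; have [xM|xM] := leP `|x| M; first by rewrite clip_id // subrr normr0.
have [x0|x0] := leP 0 x.
  move: xM; rewrite ger0_norm // => xM.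
  rewrite /clip (min_idPl (ltW xM)) (max_idPr _); last by lra.
  by rewrite ger0_norm; lra.
move: xM; rewrite ltr0_norm // => xM.
rewrite /clip (min_idPr _); last by lra.
rewrite (max_idPl _); last by lra.
by rewrite ler0_norm; lra.
Qed.

(** The truncation of a function is a bounded multiplier whose product with the function vanishes
    only where the function does; it detects nonzero vectors. *)
Lemma clip_mul_gt0 M x : 0 < M -> x != 0 -> 0 < clip M x * x.
Proof.
move=> M0; rewrite neq_lt => /orP[x0|x0].
  rewrite nmulr_rgt0 // /clip gt_max oppr_lt0 M0 /= gt_min x0 orbT.
  by [].
by rewrite pmulr_lgt0 // /clip lt_max lt_min M0 x0 orbT.
Qed.

Lemma clip_mul_ge0 M x : 0 < M -> 0 <= clip M x * x.
Proof.
move=> M0; have [->|x0] := eqVneq x 0; first by rewrite mulr0.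
exact/ltW/clip_mul_gt0.
Qed.

Lemma measurable_clip d (T : measurableType d) M (f : T -> R) :
  measurable_fun setT f -> measurable_fun setT (fun q => clip M (f q)).
Proof.
by move=> mf; apply: measurable_maxr => //; apply: measurable_minr.
Qed.

End Clip.

Section Total.
Variables (R : realType) (m n : nat) (F : set (superfun R m n)).
Local Notation mu := (lebesgue_row R m).
Implicit Types (phi psi : superfun R m n).
Hypothesis closedF : closed_subspace F.
Hypothesis modulationF : forall (p : 'rV[R]_m) (t : R) phi, F phi ->
  F (fun q I => expC (Complex 0 (t - \sum_i q ord0 i * p ord0 i)) * phi q I).
Hypothesis translationF : forall (a : 'rV[R]_m) phi, F phi -> F (fun q I => phi (q - a) I).

Lemma closed_subspace_eq phi psi : hs phi -> F psi -> hs_eq phi psi -> F phi.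
Proof.
have [_ _ _ Fclosed] := closedF.
move=> hphi Fpsi E; apply: Fclosed => // e e0; exists psi => //.
by rewrite E lte_fin.
Qed.

Lemma hs_norm2_eq0 phi : hs_measurable phi ->
  (forall I, {ae mu, forall q, phi q I = 0}) -> hs_norm2 phi = 0%E.
Proof.
move=> mphi phi0; rewrite /hs_norm2 big1 // => I _.
have mf : measurable_fun setT (fun q => (complex.Re (phi q I) ^+ 2 + complex.Im (phi q I) ^+ 2)%:E).
  by apply/measurable_EFinP; apply: measurable_funD; apply: measurable_funX;
    [exact: (mphi I).1|exact: (mphi I).2].
have := (ae_eq_integral_abs mu measurableT mf).2.
under eq_integral do rewrite gee0_abs ?lee_fin ?addr_ge0 ?sqr_ge0 //.
by apply; apply: filterS (phi0 I) => q -> _ /=; rewrite !expr0n /= addr0.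
Qed.

Lemma hs_norm2_eq0_ae phi I : hs_measurable phi -> hs_norm2 phi = 0%E ->
  {ae mu, forall q, phi q I = 0}.
Proof.
move=> mphi E0.
have E : (\int[mu]_q (complex.Re (phi q I) ^+ 2 + complex.Im (phi q I) ^+ 2)%:E = 0)%E.
  have ge0 J : (0 <= \int[mu]_q (complex.Re (phi q J) ^+ 2 + complex.Im (phi q J) ^+ 2)%:E)%E.
    by apply: integral_ge0 => q _; rewrite lee_fin addr_ge0 ?sqr_ge0.
  apply/eqP; rewrite eq_le ge0 andbT -E0 /hs_norm2 (bigD1 I) //= leeDl // sume_ge0 //.
have mf : measurable_fun setT (fun q => (complex.Re (phi q I) ^+ 2 + complex.Im (phi q I) ^+ 2)%:E).
  by apply/measurable_EFinP; apply: measurable_funD; apply: measurable_funX;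
    [exact: (mphi I).1|exact: (mphi I).2].
have /(ae_eq_integral_abs mu measurableT mf).1 : (\int[mu]_q `|(complex.Re (phi q I) ^+ 2 + complex.Im (phi q I) ^+ 2)%:E| = 0)%E.
  by under eq_integral do rewrite gee0_abs ?lee_fin ?addr_ge0 ?sqr_ge0 //.
apply: filterS => q /(_ Logic.I) [] /eqP.
rewrite paddr_eq0 ?sqr_ge0 // !sqrf_eq0 => /andP[/eqP r0 /eqP i0].
by apply/eqP; rewrite eq_complex r0 i0 eqxx.
Qed.

(* phi is the limit of the truncations of phi / g, multiplied by g. *)
Lemma gauss_tensor_total : (forall v, F (gauss_tensor v)) -> forall phi, hs phi -> F phi.
Proof.
move=> Fv phi hphi; have [mphi iphi] := (hsP phi).1 hphi.
pose re N I q := clip N%:R (complex.Re (phi q I) / gauss 2 q).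
pose im N I q := clip N%:R (complex.Im (phi q I) / gauss 2 q).
pose phi_ N : superfun R m n := fun q I => (gauss 2 q)%:C%C * Complex (re N I q) (im N I q).
have mdiv (f : 'rV[R]_m -> R) N : measurable_fun setT f ->
    multiplier F (fun q => clip N%:R (f q / gauss 2 q)).
  move=> mf; apply: (@multiplier_bounded _ _ _ _ closedF modulationF N%:R).
    apply: measurable_clip; apply: measurable_funM => //.
    (* The inverse of the Gaussian is the Gaussian of opposite parameter, whence its
       measurability. *)
    rewrite (_ : (fun q => _) = fun q => gauss (- 2) q); first exact: measurable_gauss.
    by apply/funext => q; rewrite /gauss -expRN mulNr opprK.
  by move=> q; exact: norm_clip_le.
have Fphi_ N : F (phi_ N).
  pose d J : {set 'I_n} -> R[i] := fun I => (I == J)%:R.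
  (* Multipliers are real, so each component is assembled from its real part and i times its
     imaginary part. *)
  pose t J : superfun R m n := fun_scale (re N J) (gauss_tensor (d J)) +
     (fun q I => 'i%C * fun_scale (im N J) (gauss_tensor (d J)) q I).
  have Ft J : F (t J).
    apply: (closed_subspaceD closedF); last apply: (closed_subspaceZ closedF).
      by case: (mdiv _ N (mphi J).1) => _ _; apply.
    by case: (mdiv _ N (mphi J).2) => _ _; apply.
  rewrite (_ : phi_ N = \sum_J t J).
    have [_ F0 _ _] := closedF.
    by elim/big_ind: _ => //; exact: closed_subspaceD.
  apply/funext => q; apply/funext => I; rewrite !fct_sumE.
  rewrite (bigD1 I) //= big1 => [|J JI].
    rewrite addr0 -[RHS]/(_ + _) /fun_scale /gauss_tensor /d eqxx /phi_ !mulr1.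
    by apply/eqP; rewrite eq_complex /=; apply/andP; split; apply/eqP; ring.
  by rewrite -[LHS]/(_ + _) /fun_scale /gauss_tensor /d eq_sym (negPf JI) !mulr0 addr0.
have E N q I : (phi - phi_ N) q I = (gauss 2 q)%:C%C *
    Complex (complex.Re (phi q I) / gauss 2 q - re N I q) (complex.Im (phi q I) / gauss 2 q - im N I q).
  rewrite -[LHS]/(phi q I - phi_ N q I) /phi_; have g0 := gt_eqF (gauss_gt0 2 q).
  case: (phi q I) => a b /=.
  by apply/eqP; rewrite eq_complex /=; apply/andP; split; apply/eqP; field; rewrite g0.
apply: (closed_subspace_lim closedF Fphi_ hphi iphi).
  move=> q N; rewrite /hs_density /hs_pair; apply: ler_sum => I _; rewrite E /re /im.
  have g0 := gauss_gt0 2 q; case: (phi q I) => a b /=; rewrite !mul0r subr0 addr0.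
  have main c : (gauss 2 q * (c / gauss 2 q - clip N%:R (c / gauss 2 q))) *
      (gauss 2 q * (c / gauss 2 q - clip N%:R (c / gauss 2 q))) <= c * c.
    rewrite -!expr2 -[X in X <= _]ger0_norm ?sqr_ge0 // -[X in _ <= X]ger0_norm ?sqr_ge0 //.
    rewrite !normrX lerXn2r ?nnegrE // normrM (gtr0_norm g0).
    have -> : `|c| = gauss 2 q * `|c / gauss 2 q|.
      by rewrite normrM normfV (gtr0_norm g0) mulrC divfK // gt_eqF.
    by rewrite ler_wpM2l ?(ltW g0) // clip_dist.
  by rewrite lerD.
(* At a fixed q the truncation is inactive once N exceeds all the quotients, so the difference is
   eventually 0; domination by the density of phi came from [clip_dist]. *)
move=> q; apply: cvg_near_cst; near=> N.
rewrite /hs_density /hs_pair big1 // => I _; rewrite E /re /im.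
pose B := \sum_I (`|complex.Re (phi q I) / gauss 2 q| + `|complex.Im (phi q I) / gauss 2 q|).
have BN : B <= N%:R by near: N; exact: nbhs_infty_ger.
have : `|complex.Re (phi q I) / gauss 2 q| + `|complex.Im (phi q I) / gauss 2 q| <= B.
  by rewrite /B (bigD1 I) //= lerDl sumr_ge0 // => J _; rewrite addr_ge0.
move=> IB; rewrite !clip_id ?subrr; first by rewrite /= !(mulr0, mul0r, subr0, addr0).
  by apply: le_trans BN; apply: le_trans IB; rewrite lerDr.
by apply: le_trans BN; apply: le_trans IB; rewrite lerDl.
Unshelve. all: by end_near. Qed.

(** If every Gaussian mean of an element of F were 0, then multiplying phi by the truncation of one
    real or imaginary component f would give a zero integral of g [clip 1 f] f. The integrand is
    nonnegative, so f would vanish almost everywhere. *)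
Lemma closed_subspace_gauss_tensor phi : F phi -> ~ hs_eq phi 0 ->
  exists v I, F (gauss_tensor v) /\ v I != 0.
Proof.
have [Fhs F0 _ _] := closedF.
move=> Fphi nphi; apply: contrapT => none; apply: nphi.
have hphi := Fhs _ Fphi; have [mphi iphi] := (hsP phi).1 hphi.
rewrite /hs_eq subr0; apply: hs_norm2_eq0 => // I.
have means (h : 'rV[R]_m -> R) : measurable_fun setT h ->
    gauss_mean (fun_scale (fun q => clip 1 (h q)) phi) I = 0.
  move=> mh; apply: contrapT => /eqP ne; apply: none.
  exists (gauss_mean (fun_scale (fun q => clip 1 (h q)) phi)), I; split => //.
  apply: (gauss_mean_closed closedF modulationF translationF).
  have mult : multiplier F (fun q => clip 1 (h q)).
    apply: (@multiplier_bounded _ _ _ _ closedF modulationF 1).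
      exact: measurable_clip.
    by move=> q; exact: norm_clip_le.
  by case: mult => _ _; apply.
have main (f : 'rV[R]_m -> R) : measurable_fun setT f ->
    mu.-integrable setT (fun q => (gauss 2 q * (clip 1 (f q) * f q))%:E) ->
    \int[mu]_q (gauss 2 q * (clip 1 (f q) * f q)) = 0 -> {ae mu, forall q, f q = 0}.
  move=> mf iF int0.
  have mF : measurable_fun setT (fun q => (gauss 2 q * (clip 1 (f q) * f q))%:E).
    by case/integrableP: iF.
  have : (\int[mu]_q `|(gauss 2 q * (clip 1 (f q) * f q))%:E| = 0)%E.
    have ge0 q : 0 <= gauss 2 q * (clip 1 (f q) * f q).
      by rewrite mulr_ge0 ?(ltW (gauss_gt0 _ _)) // clip_mul_ge0.
    under eq_integral do rewrite gee0_abs ?lee_fin ?ge0 //.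
    move: int0; rewrite /Rintegral => int0.
    by rewrite -[LHS]fineK ?int0 //; exact: integrable_fin_num.
  move/(ae_eq_integral_abs mu measurableT mF).1; apply: filterS => q /(_ Logic.I) [] /eqP.
  rewrite mulf_eq0 gt_eqF ?gauss_gt0 //= => /eqP z; apply: contrapT => /eqP f0.
  by have := clip_mul_gt0 ltr01 f0; rewrite z ltxx.
have ReE h q : complex.Re (fun_scale h phi q I) = h q * complex.Re (phi q I).
  by rewrite /fun_scale; case: (phi q I) => a b /=; ring.
have ImE h q : complex.Im (fun_scale h phi q I) = h q * complex.Im (phi q I).
  by rewrite /fun_scale; case: (phi q I) => a b /=; ring.
have hsc (h : 'rV[R]_m -> R) : measurable_fun setT h -> hs (fun_scale (fun q => clip 1 (h q)) phi).
  move=> mh; apply: (@hs_scale _ _ _ _ 1) => //; first exact: measurable_clip.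
  by move=> q; exact: norm_clip_le.
have re0 : {ae mu, forall q, complex.Re (phi q I) = 0}.
  have mr := (mphi I).1; apply: main => //.
    have := (integrable_gaussM I (hsc _ mr)).1; apply: eq_integrable => // q _.
    by rewrite /= ReE.
  have := congr1 (@complex.Re R) (means _ mr) => /= <-.
  by apply: eq_Rintegral => q _; rewrite ReE.
have im0 : {ae mu, forall q, complex.Im (phi q I) = 0}.
  have mi := (mphi I).2; apply: main => //.
    have := (integrable_gaussM I (hsc _ mi)).2; apply: eq_integrable => // q _.
    by rewrite /= ImE.
  have := congr1 (@complex.Im R) (means _ mi) => /= <-.
  by apply: eq_Rintegral => q _; rewrite ImE.
apply: filterS2 re0 im0 => q r0 i0.
by apply/eqP; rewrite eq_complex r0 i0 eqxx.
Qed.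

(** The grading of F provides an even part only up to null sets; comparing components identifies it
    almost everywhere with the Gaussian tensor of the even part of v. *)
Lemma gauss_tensor_even v : graded_subspace F -> F (gauss_tensor v) ->
  F (gauss_tensor (fun I => if odd #|I| then 0 else v I)).
Proof.
have [Fhs _ _ _] := closedF.
move=> gradF Fv; have [phi0 [phi1 [F0 [h0 z0] F1 [h1 z1] E]]] := gradF _ Fv.
apply: closed_subspace_eq F0 _; first exact: hs_gauss_tensor.
have [m0 _] := (hsP _).1 h0; have [m1 _] := (hsP _).1 h1.
have mt w : hs_measurable (@gauss_tensor R m n w) by case/hsP: (@hs_gauss_tensor R m n w).
apply: hs_norm2_eq0 => [|I]; first exact: hs_measurableB.
have := hs_norm2_eq0_ae I (hs_measurableB (mt v) (hs_measurableD m0 m1)) E.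
case oI : (odd #|I|).
  have := z0 I; rewrite oI => /(_ isT) + _; apply: filterS => q zq.
  by rewrite -[LHS]/(gauss_tensor _ q I - phi0 q I) /gauss_tensor oI mulr0 zq subrr.
have := z1 I; rewrite oI => /(_ isT); apply: filterS2 => q zq.
rewrite -[X in X = 0 -> _]/(gauss_tensor _ q I - (phi0 q I + phi1 q I)) zq addr0.
by rewrite -[X in _ -> X = 0]/(gauss_tensor _ q I - phi0 q I) /gauss_tensor oI.
Qed.

End Total.

(** * Smoothness of Gaussian vectors *)

Section Symbols.
Variables (R : realType) (hbar : R) (m : nat).
Implicit Types (x v : heis_body R m) (y : 'rV[R]_m).

Definition phase x y : R :=
  hbar * (x.2 + \sum_i (2^-1 * x.1.1 ord0 i - y ord0 i) * x.1.2 ord0 i).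

(* Syntax for functions of a group element (q, p, t) and of a point y of R^m.
   Multiplied by [packet], they form a class stable under derivatives in the
   group element, see [gder], which contains the orbits of Gaussians. *)
Inductive symbol :=
| Cst of R | CoordQ of 'I_m | CoordP of 'I_m | Coord of 'I_m
| CosPhase | SinPhase | Plus of symbol & symbol | Times of symbol & symbol.

Fixpoint eval (e : symbol) x y : R :=
  match e with
  | Cst c => c
  | CoordQ i => x.1.1 ord0 i
  | CoordP i => x.1.2 ord0 i
  | Coord i => y ord0 i
  | CosPhase => cos (phase x y)
  | SinPhase => sin (phase x y)
  | Plus e1 e2 => eval e1 x y + eval e2 x y
  | Times e1 e2 => eval e1 x y * eval e2 x y
  end.

Definition sum_symbol (f : 'I_m -> symbol) : symbol :=
  foldr (fun i e => Plus (f i) e) (Cst 0) (index_enum 'I_m).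

Lemma eval_sum f x y : eval (sum_symbol f) x y = \sum_i eval (f i) x y.
Proof.
rewrite /sum_symbol; elim: (index_enum _) => [|i s IH] /=; first by rewrite big_nil.
by rewrite big_cons IH.
Qed.

Definition der_phase v : symbol :=
  Times (Cst hbar) (Plus (Cst v.2) (sum_symbol (fun i =>
    Plus (Times (Cst (2^-1 * v.1.1 ord0 i)) (CoordP i))
      (Times (Plus (Times (Cst 2^-1) (CoordQ i)) (Times (Cst (-1)) (Coord i)))
             (Cst (v.1.2 ord0 i)))))).

Fixpoint der v (e : symbol) : symbol :=
  match e with
  | Cst _ | Coord _ => Cst 0
  | CoordQ i => Cst (v.1.1 ord0 i)
  | CoordP i => Cst (v.1.2 ord0 i)
  | CosPhase => Times (Cst (-1)) (Times SinPhase (der_phase v))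
  | SinPhase => Times CosPhase (der_phase v)
  | Plus e1 e2 => Plus (der v e1) (der v e2)
  | Times e1 e2 => Plus (Times (der v e1) e2) (Times e1 (der v e2))
  end.

Definition packet x y : R := gauss 2 (y - x.1.1).

(** Logarithmic derivative of [packet] in the direction v: the derivative of -2 |y - q|^2 along
    q. *)
Definition der_packet v : symbol :=
  sum_symbol (fun i => Times (Cst (4 * v.1.1 ord0 i))
    (Plus (Coord i) (Times (Cst (-1)) (CoordQ i)))).

Definition gder v e := Plus (der v e) (Times e (der_packet v)).

Definition wave e x y : R := eval e x y * packet x y.

Let is_derive_line (a b t : R) : is_derive t (1 : R) (fun t : R => a + t * b) b.
Proof.
have -> : (fun t : R => a + t * b) = cst a + b *: id.
  by apply/funext => u; rewrite /= -[RHS]/(a + b * u) mulrC.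
have := is_deriveD (is_derive_cst a t (1 : R)) (is_deriveZ b (is_derive_id t (1 : R))).
by rewrite add0r -[b *: 1]/(b * 1) mulr1.
Qed.

Let is_deriveMr (f g : R -> R) (t a b : R) :
  is_derive t (1 : R) f a -> is_derive t (1 : R) g b ->
  is_derive t (1 : R) (fun t => f t * g t) (a * g t + f t * b).
Proof.
move=> df dg; rewrite -[fun t => _]/(f * g).
by apply: is_derive_eq; rewrite addrC -![_ *: _]/(_ * _) [g t * _]mulrC.
Qed.

Let is_deriveDr (f g : R -> R) (t a b : R) :
  is_derive t (1 : R) f a -> is_derive t (1 : R) g b ->
  is_derive t (1 : R) (fun t => f t + g t) (a + b).
Proof. by move=> df dg; exact: is_deriveD. Qed.

Let is_derive_sumr (f : 'I_m -> R -> R) (t : R) (a : 'I_m -> R) :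
  (forall i, is_derive t (1 : R) (f i) (a i)) ->
  is_derive t (1 : R) (fun t => \sum_i f i t) (\sum_i a i).
Proof.
move=> df; rewrite (_ : (fun t => _) = \sum_i f i); first exact: is_derive_sum.
by apply/funext => u; rewrite fct_sumE.
Qed.

Let is_derive_q x v t i :
  is_derive t (1 : R) (fun t : R => (x + t *: v).1.1 ord0 i) (v.1.1 ord0 i).
Proof. by under eq_fun do rewrite !mxE; exact: is_derive_line. Qed.

Let is_derive_p x v t i :
  is_derive t (1 : R) (fun t : R => (x + t *: v).1.2 ord0 i) (v.1.2 ord0 i).
Proof. by under eq_fun do rewrite !mxE; exact: is_derive_line. Qed.

Let is_derive_t x v t :
  is_derive t (1 : R) (fun t : R => (x + t *: v).2 : R) (v.2 : R).
Proof. exact: (@is_derive_line (x.2 : R) (v.2 : R) t). Qed.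

Lemma is_derive_phase x v y t :
  is_derive t (1 : R) (fun t : R => phase (x + t *: v) y) (eval (der_phase v) (x + t *: v) y).
Proof.
rewrite /phase /der_phase; move: (2^-1 : R) => c; apply: is_derive_eq.
  apply: (is_deriveMr (is_derive_cst hbar _ _)).
  apply: (is_deriveDr (is_derive_t x v t)).
  apply: is_derive_sumr => i; apply: (is_deriveMr _ (is_derive_p x v t i)).
  apply: (is_deriveDr _ (is_derive_cst _ _ _)).
  exact: (is_deriveMr (is_derive_cst _ _ _) (is_derive_q x v t i)).
rewrite /cst mul0r add0r; cbn [eval]; congr (_ * (_ + _)).
by rewrite eval_sum; apply: eq_bigr => i _; cbn [eval]; ring.
Qed.

Lemma is_derive_eval e x v y t :
  is_derive t (1 : R) (fun t : R => eval e (x + t *: v) y) (eval (der v e) (x + t *: v) y).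
Proof.
elim: e => /= [c|i|i|i|||e1 IH1 e2 IH2|e1 IH1 e2 IH2].
- exact: is_derive_cst.
- under eq_fun do rewrite !mxE; exact: is_derive_line.
- under eq_fun do rewrite !mxE; exact: is_derive_line.
- exact: is_derive_cst.
- apply: is_derive_eq; first exact: (is_derive1_comp _ (is_derive_phase x v y t)).
  by rewrite mulN1r mulNr.
- exact: (is_derive1_comp _ (is_derive_phase x v y t)).
- exact: is_deriveD.
- exact: is_deriveMr.
Qed.

Lemma is_derive_packet x v y t :
  is_derive t (1 : R) (fun t : R => packet (x + t *: v) y)
    (eval (der_packet v) (x + t *: v) y * packet (x + t *: v) y).
Proof.
rewrite /packet /gauss /sqnorm eval_sum.
have dexp : is_derive t (1 : R) (fun u : R => - (2 * \sum_i (y - (x + u *: v).1.1) ord0 i ^+ 2))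
    (\sum_i eval (Times (Cst (4 * v.1.1 ord0 i))
      (Plus (Coord i) (Times (Cst (-1)) (CoordQ i)))) (x + t *: v) y).
  rewrite (_ : (fun u => _) = fun u : R => \sum_i (-2 * ((y ord0 i - x.1.1 ord0 i + u * - v.1.1 ord0 i) *
      (y ord0 i - x.1.1 ord0 i + u * - v.1.1 ord0 i)))); last first.
    apply/funext => u; rewrite mulr_sumr -sumrN; apply: eq_bigr => i _.
    by rewrite !mxE; ring.
  apply: is_derive_sumr => i.
  have dl := is_derive_line (y ord0 i - x.1.1 ord0 i) (- v.1.1 ord0 i) t.
  have := is_deriveMr (is_derive_cst (- 2 : R) t (1 : R)) (is_deriveMr dl dl).
  congr (is_derive _ _ _ _); rewrite /cst; cbn [eval].
  by rewrite -[(x + t *: v).1.1]/(x.1.1 + t *: v.1.1) !mxE; ring.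
have := is_derive1_comp (is_derive_expR _) dexp.
by congr (is_derive _ _ _ _); rewrite mulrC.
Qed.

Lemma is_derive_wave e x v y t :
  is_derive t (1 : R) (fun t : R => wave e (x + t *: v) y) (wave (gder v e) (x + t *: v) y).
Proof.
rewrite /wave /gder; apply: is_derive_eq.
  exact: (is_deriveMr (is_derive_eval e x v y t) (is_derive_packet x v y t)).
by rewrite /=; ring.
Qed.

(** An l^1 norm, which bounds each coordinate by itself; [cvg_norm1] relates it to the topology of
    the group. *)
Definition norm1 x : R :=
  \sum_i `|x.1.1 ord0 i| + \sum_i `|x.1.2 ord0 i| + `|x.2 : R|.

Lemma norm1_ge0 x : 0 <= norm1 x.
Proof. by rewrite /norm1 !addr_ge0 // sumr_ge0. Qed.

Lemma norm1_q x i : `|x.1.1 ord0 i| <= norm1 x.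
Proof.
rewrite /norm1 -addrA (bigD1 i) //= -addrA lerDl.
by rewrite !addr_ge0 // sumr_ge0.
Qed.

Lemma norm1_p x i : `|x.1.2 ord0 i| <= norm1 x.
Proof.
rewrite /norm1 [X in _ <= X + _]addrC (bigD1 i) //= -!addrA lerDl.
by rewrite !addr_ge0 // sumr_ge0.
Qed.

Lemma norm1_t x : `|x.2 : R| <= norm1 x.
Proof. by rewrite /norm1 lerDr addr_ge0 // sumr_ge0. Qed.

Lemma norm1_line x v (t : R) : norm1 (x + t *: v) <= norm1 x + `|t| * norm1 v.
Proof.
rewrite /norm1 !mulrDr !mulr_sumr addrACA (addrACA (\sum_i `|x.1.1 _ _|)) -!big_split /=.
apply: lerD; last by rewrite -normrM; exact: ler_normD.
by apply: ler_sum => i _; apply: lerD; rewrite !mxE -normrM; exact: ler_normD.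
Qed.

(** Growth slower than any Gaussian in y, locally uniformly in x. Asking it for every eps makes the
    class stable under products. The variant [tame_linear] adds a factor linear in the direction
    v. *)
Definition tame (f : heis_body R m -> 'rV[R]_m -> R) := forall eps rho : R, 0 < eps ->
  exists2 C, 0 <= C & forall x, norm1 x <= rho -> forall y,
    `|f x y| <= C * expR (eps * sqnorm y).

Definition tame_linear (f : heis_body R m -> heis_body R m -> 'rV[R]_m -> R) :=
  forall eps rho : R, 0 < eps ->
  exists2 C, 0 <= C & forall x v, norm1 x <= rho -> forall y,
    `|f v x y| <= C * norm1 v * expR (eps * sqnorm y).

Let expR_ge1' eps y : 0 < eps -> 1 <= expR (eps * sqnorm y).
Proof. by move=> e0; rewrite -expR0 ler_expR mulr_ge0 ?sqnorm_ge0 // ltW. Qed.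

Lemma tame_bounded f : (forall rho, exists2 C, 0 <= C & forall x, norm1 x <= rho ->
  forall y, `|f x y| <= C) -> tame f.
Proof.
move=> fb eps rho e0; have [C C0 fC] := fb rho; exists C => // x xr y.
by apply: le_trans (fC x xr y) _; rewrite ler_peMr // expR_ge1'.
Qed.

Lemma tame_linear_bounded f : (forall rho, exists2 C, 0 <= C & forall x v, norm1 x <= rho ->
  forall y, `|f v x y| <= C * norm1 v) -> tame_linear f.
Proof.
move=> fb eps rho e0; have [C C0 fC] := fb rho; exists C => // x v xr y.
by apply: le_trans (fC x v xr y) _; rewrite ler_peMr ?mulr_ge0 ?norm1_ge0 // expR_ge1'.
Qed.

Lemma tame_coord i : tame (fun _ y => y ord0 i).
Proof.
move=> eps rho e0; exists (1 + eps^-1).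
  by rewrite addr_ge0 // invr_ge0 ltW.
move=> _ _ y; have le1 : `|y ord0 i| <= 1 + y ord0 i ^+ 2.
  rewrite -[y ord0 i ^+ 2]ger0_norm ?sqr_ge0 // normrX -subr_ge0.
  rewrite (_ : _ - _ = (`|y ord0 i| - 2^-1) ^+ 2 + 3 / 4); last by field.
  by rewrite addr_ge0 ?sqr_ge0 // divr_ge0.
(* 1 + y_i^2 is compared with (1 + 1 / eps) (1 + eps y_i^2), whose second factor is below the
   exponential. *)
apply: (le_trans le1); apply: (@le_trans _ _ ((1 + eps^-1) * (1 + eps * y ord0 i ^+ 2))).
  rewrite mulrDl mul1r mulrDr mulKf ?gt_eqF // mulr1.
  have : 0 <= eps * y ord0 i ^+ 2 by rewrite mulr_ge0 ?sqr_ge0 // ltW.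
  have : 0 <= eps^-1 by rewrite invr_ge0 ltW.
  lra.
rewrite ler_wpM2l ?addr_ge0 ?invr_ge0 ?(ltW e0) //.
apply: le_trans (expR_ge1Dx _) _; rewrite ler_expR ler_wpM2l ?(ltW e0) //.
by rewrite /sqnorm (bigD1 i) //= lerDl sumr_ge0 // => j _; exact: sqr_ge0.
Qed.

Lemma tameD f g : tame f -> tame g -> tame (fun x y => f x y + g x y).
Proof.
move=> tf tg eps rho e0; have [C C0 fC] := tf eps rho e0; have [D D0 gD] := tg eps rho e0.
exists (C + D); first exact: addr_ge0.
move=> x xr y; rewrite mulrDl; apply: le_trans (ler_normD _ _) _.
by apply: lerD; [exact: fC|exact: gD].
Qed.

Let expR_half eps y : expR (eps * sqnorm y) = expR (eps / 2 * sqnorm y) * expR (eps / 2 * sqnorm y).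
Proof. by rewrite -expRD -mulrDl -splitr. Qed.

Lemma tameM f g : tame f -> tame g -> tame (fun x y => f x y * g x y).
Proof.
move=> tf tg eps rho e0; have e2 : 0 < eps / 2 by rewrite divr_gt0.
have [C C0 fC] := tf _ rho e2; have [D D0 gD] := tg _ rho e2.
exists (C * D); first exact: mulr_ge0.
move=> x xr y; rewrite expR_half mulrACA normrM.
by apply: ler_pM => //; [exact: fC|exact: gD].
Qed.

Lemma tame_linearD f g : tame_linear f -> tame_linear g ->
  tame_linear (fun v x y => f v x y + g v x y).
Proof.
move=> tf tg eps rho e0; have [C C0 fC] := tf eps rho e0; have [D D0 gD] := tg eps rho e0.
exists (C + D); first exact: addr_ge0.
move=> x v xr y; rewrite !mulrDl; apply: le_trans (ler_normD _ _) _.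
by apply: lerD; [exact: fC|exact: gD].
Qed.

Lemma tame_linearM f g : tame_linear f -> tame g -> tame_linear (fun v x y => f v x y * g x y).
Proof.
move=> tf tg eps rho e0; have e2 : 0 < eps / 2 by rewrite divr_gt0.
have [C C0 fC] := tf _ rho e2; have [D D0 gD] := tg _ rho e2.
exists (C * D); first exact: mulr_ge0.
move=> x v xr y; rewrite expR_half [C * D * _]mulrAC mulrACA normrM.
by apply: ler_pM => //; [exact: fC|exact: gD].
Qed.

Lemma tame_linear0 : tame_linear (fun _ _ _ => 0).
Proof. by apply: tame_linear_bounded => rho; exists 0 => // *; rewrite normr0 mul0r. Qed.

Lemma tame_linear_sum (f : 'I_m -> heis_body R m -> heis_body R m -> 'rV[R]_m -> R) :
  (forall i, tame_linear (f i)) -> tame_linear (fun v x y => \sum_i f i v x y).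
Proof.
move=> tf; elim: (index_enum _) => [|i s IH].
  have := tame_linear0; congr tame_linear.
  by apply/funext => v; apply/funext => x; apply/funext => y; rewrite big_nil.
have := tame_linearD (tf i) IH; congr tame_linear.
by apply/funext => v; apply/funext => x; apply/funext => y; rewrite big_cons.
Qed.

Lemma tame_linear_q c i : tame_linear (fun v _ _ => c * v.1.1 ord0 i).
Proof.
apply: tame_linear_bounded => rho; exists `|c| => // x v _ y.
by rewrite normrM ler_wpM2l // norm1_q.
Qed.

Lemma tame_linear_p i : tame_linear (fun v _ _ => v.1.2 ord0 i).
Proof.
by apply: tame_linear_bounded => rho; exists 1 => // x v _ y; rewrite mul1r norm1_p.
Qed.

Lemma tame_cst c : tame (fun _ _ => c).
Proof. by apply: tame_bounded => rho; exists `|c|. Qed.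

Lemma tame_eval e : tame (eval e).
Proof.
elim: e => /= [c|i|i|i|||e1 IH1 e2 IH2|e1 IH1 e2 IH2].
- exact: tame_cst.
- apply: tame_bounded => rho; exists `|rho| => // x xr y.
  exact: le_trans (norm1_q x i) (le_trans xr (ler_norm _)).
- apply: tame_bounded => rho; exists `|rho| => // x xr y.
  exact: le_trans (norm1_p x i) (le_trans xr (ler_norm _)).
- exact: tame_coord.
- by apply: tame_bounded => rho; exists 1 => // x _ y; rewrite ler_norml cos_geN1 cos_le1.
- by apply: tame_bounded => rho; exists 1 => // x _ y; rewrite ler_norml sin_geN1 sin_le1.
- exact: tameD.
- exact: tameM.
Qed.

Let tame_linear_swap f g : tame f -> tame_linear g -> tame_linear (fun v x y => f x y * g v x y).
Proof.
move=> tf tg; have := tame_linearM tg tf; congr tame_linear.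
by apply/funext => v; apply/funext => x; apply/funext => y; rewrite mulrC.
Qed.

Lemma tame_der_phase : tame_linear (fun v => eval (der_phase v)).
Proof.
rewrite /der_phase /=; apply: (tame_linear_swap (tame_cst hbar)).
apply: tame_linearD.
  by apply: tame_linear_bounded => rho; exists 1 => // x v _ y; rewrite mul1r norm1_t.
rewrite (_ : (fun v x y => _) = fun v x y => \sum_i (2^-1 * v.1.1 ord0 i * x.1.2 ord0 i +
  (2^-1 * x.1.1 ord0 i + -1 * y ord0 i) * v.1.2 ord0 i)); last first.
  by apply/funext => v; apply/funext => x; apply/funext => y; rewrite eval_sum.
apply: tame_linear_sum => i; apply: tame_linearD.
  exact: (tame_linearM (tame_linear_q _ i) (tame_eval (CoordP i))).
exact: (tame_linear_swap (tame_eval (Plus (Times (Cst 2^-1) (CoordQ i)) (Times (Cst (-1)) (Coord i))))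
  (tame_linear_p i)).
Qed.

Lemma tame_der e : tame_linear (fun v => eval (der v e)).
Proof.
elim: e => /= [c|i|i|i|||e1 IH1 e2 IH2|e1 IH1 e2 IH2].
- exact: tame_linear0.
- by have := tame_linear_q 1 i; congr tame_linear; apply/funext => v; rewrite mul1r.
- exact: tame_linear_p.
- exact: tame_linear0.
- apply: (tame_linear_swap (tame_cst _)).
  exact: (tame_linear_swap (tame_eval SinPhase) tame_der_phase).
- exact: (tame_linear_swap (tame_eval CosPhase) tame_der_phase).
- exact: tame_linearD.
- apply: tame_linearD; first exact: (tame_linearM IH1 (tame_eval e2)).
  exact: (tame_linear_swap (tame_eval e1) IH2).
Qed.

Lemma tame_der_packet : tame_linear (fun v => eval (der_packet v)).
Proof.
rewrite /der_packet (_ : (fun v => _) = fun v x y => \sum_i (4 * v.1.1 ord0 i *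
  (y ord0 i + -1 * x.1.1 ord0 i))); last first.
  by apply/funext => v; apply/funext => x; apply/funext => y; rewrite eval_sum.
apply: tame_linear_sum => i.
exact: (tame_linearM (tame_linear_q _ i) (tame_eval (Plus (Coord i) (Times (Cst (-1)) (CoordQ i))))).
Qed.

Lemma tame_gder e : tame_linear (fun v => eval (gder v e)).
Proof.
apply: tame_linearD; first exact: tame_der.
exact: (tame_linear_swap (tame_eval e) tame_der_packet).
Qed.

(** 2 |y - q|^2 >= |y|^2 - 2 |q|^2, the difference being |y - 2 q|^2. *)
Lemma packet_le x y rho : norm1 x <= rho ->
  packet x y <= expR (2 * rho ^+ 2) * expR (- sqnorm y).
Proof.
move=> xr; rewrite /packet /gauss -expRD ler_expR.
have qr : sqnorm x.1.1 <= rho ^+ 2.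
  apply: (@le_trans _ _ (\sum_i rho * `|x.1.1 ord0 i|)).
    apply: ler_sum => i _; rewrite -[_ ^+ 2]ger0_norm ?sqr_ge0 // normrX expr2.
    by rewrite ler_wpM2r // (le_trans (norm1_q x i)).
  rewrite -mulr_sumr expr2 ler_wpM2l //; first exact: le_trans (norm1_ge0 x) xr.
  apply: le_trans xr; rewrite /norm1 -addrA lerDl addr_ge0 // sumr_ge0 //.
suff : sqnorm y - 2 * sqnorm x.1.1 <= 2 * sqnorm (y - x.1.1) by lra.
rewrite /sqnorm !mulr_sumr -sumrB; apply: ler_sum => i _; rewrite !mxE -subr_ge0.
rewrite (_ : _ - _ = (y ord0 i - 2 * x.1.1 ord0 i) ^+ 2); last by ring.
exact: sqr_ge0.
Qed.

Lemma packet_ge0 x y : 0 <= packet x y. Proof. exact: ltW (gauss_gt0 _ _). Qed.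

(** Growth with eps = 1/2 against the decay exp(-|y|^2) of the packet leaves [gauss 2^-1], whose
    square is the integrable [gauss 1]. *)
Let envelope_le (C rho a : R) x y : norm1 x <= rho -> 0 <= C ->
  `|a| <= C * expR (2^-1 * sqnorm y) ->
  `|a * packet x y| <= C * expR (2 * rho ^+ 2) * gauss 2^-1 y.
Proof.
move=> xr C0 aC; rewrite normrM (ger0_norm (packet_ge0 x y)).
have -> : gauss 2^-1 y = expR (2^-1 * sqnorm y) * expR (- sqnorm y).
  by rewrite /gauss -expRD; congr expR; field.
by rewrite mulrACA; apply: ler_pM => //; [exact: packet_ge0|exact: packet_le].
Qed.

Lemma wave_bound e rho : exists2 C, 0 <= C & forall x, norm1 x <= rho ->
  forall y, `|wave e x y| <= C * gauss 2^-1 y.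
Proof.
have [//|C C0 eC] := @tame_eval e 2^-1 rho.
exists (C * expR (2 * rho ^+ 2)); first by rewrite mulr_ge0 // expR_ge0.
by move=> x xr y; apply: envelope_le => //; exact: eC.
Qed.

Lemma wave_gder_bound e rho : exists2 C, 0 <= C & forall x v, norm1 x <= rho ->
  forall y, `|wave (gder v e) x y| <= C * norm1 v * gauss 2^-1 y.
Proof.
have [//|C C0 eC] := @tame_gder e 2^-1 rho.
exists (C * expR (2 * rho ^+ 2)); first by rewrite mulr_ge0 // expR_ge0.
move=> x v xr y; rewrite [C * _ * _]mulrAC; apply: envelope_le => //; last exact: eC.
by rewrite mulr_ge0 ?norm1_ge0.
Qed.

Let mvt_line (f df : R -> R) (h : R) : (forall t, is_derive t (1 : R) f (df t)) ->
  exists2 c, `|c| <= `|h| & f h - f 0 = df c * h.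
Proof.
move=> fdf; have cf : continuous f.
  move=> t; apply: differentiable_continuous; apply/derivable1_diffP.
  by case: (fdf t).
have [h0|/ltW h0] := leP 0 h.
  have [c] := MVT_segment h0 (fun t _ => fdf t) (continuous_subspaceT cf).
  rewrite in_itv /= subr0 => /andP[c0 ch] E; exists c => //.
  by rewrite !ger0_norm // (le_trans c0).
have [c] := MVT_segment h0 (fun t _ => fdf t) (continuous_subspaceT cf).
rewrite in_itv /= sub0r => /andP[hc c0] E; exists c.
  by rewrite !ler0_norm // lerN2.
by rewrite -[LHS]opprB E mulrN opprK.
Qed.

Lemma wave_lipschitz e x : exists2 C, 0 <= C & forall v, norm1 v <= 1 ->
  forall y, `|wave e (x + v) y - wave e x y| <= C * norm1 v * gauss 2^-1 y.
Proof.
have [C C0 eC] := wave_gder_bound e (norm1 x + 1); exists C => // v v1 y.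
have [c] := mvt_line 1 (is_derive_wave e x v y).
rewrite scale1r scale0r addr0 mulr1 normr1 => c1 ->; apply: eC.
apply: le_trans (norm1_line _ _ _) _; rewrite lerD2l.
by rewrite mulr_ile1 ?norm1_ge0.
Qed.

(** Two uses of the mean value theorem: the difference quotient is the derivative at an intermediate
    point, and its distance to the derivative at x is controlled by the second derivative. The
    constant does not depend on y, as convergence in norm requires. *)
Lemma wave_derivative e x v : exists2 C, 0 <= C & forall h : R, h != 0 -> `|h| <= 1 ->
  forall y, `|h^-1 * (wave e (x + h *: v) y - wave e x y) - wave (gder v e) x y| <=
    C * `|h| * gauss 2^-1 y.
Proof.
have [C C0 eC] := wave_bound (gder v (gder v e)) (norm1 x + norm1 v); exists C => // h h0 h1 y.
have [c ch] := mvt_line h (is_derive_wave e x v y).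
rewrite scale0r addr0 => ->; rewrite mulrC mulfK //.
have [c' cc'] := mvt_line c (is_derive_wave (gder v e) x v y).
rewrite scale0r addr0 => ->; rewrite normrM [C * _ * _]mulrAC.
apply: ler_pM => //; apply: eC; apply: le_trans (norm1_line _ _ _) _.
by rewrite lerD2l ler_piMl ?norm1_ge0 // (le_trans cc') // (le_trans ch).
Qed.

Lemma measurable_eval e x : measurable_fun setT (eval e x).
Proof.
have mphase : measurable_fun setT (phase x).
  apply: measurable_funM => //; apply: measurable_funD => //; apply: measurable_sum => i.
  apply: measurable_funM => //; apply: measurable_funB => //; exact: measurable_row_coord.
elim: e => //= [i||||].
- exact: measurable_row_coord.
- by apply: (measurableT_comp _ mphase); apply: continuous_measurable_fun; exact: continuous_cos.
- by apply: (measurableT_comp _ mphase); apply: continuous_measurable_fun; exact: continuous_sin.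
- by move=> e1 m1 e2 m2; exact: measurable_funD.
- by move=> e1 m1 e2 m2; exact: measurable_funM.
Qed.

Lemma measurable_wave e x : measurable_fun setT (wave e x).
Proof.
apply: measurable_funM; first exact: measurable_eval.
exact: (measurableT_comp (measurable_gauss 2) (measurable_row_shift (- x.1.1))).
Qed.

(** * Waves as smooth families in the Hilbert space *)

Section Waves.
Variable n : nat.
Implicit Types (a b : {set 'I_n} -> symbol) (phi : superfun R m n).

Definition waves a b x : superfun R m n :=
  fun y I => Complex (wave (a I) x y) (wave (b I) x y).

Lemma hs_measurable_waves a b x : hs_measurable (waves a b x).
Proof. by move=> I; split; exact: measurable_wave. Qed.

(** [K] is the small parameter, the size of an increment: a pointwise bound linear in K becomes a
    squared norm of order K^2. *)
Lemma hs_envelope phi (C : {set 'I_n} -> R) (K : R) : hs_measurable phi ->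
  (forall q I, `|complex.Re (phi q I)| <= C I * K * gauss 2^-1 q /\
               `|complex.Im (phi q I)| <= C I * K * gauss 2^-1 q) ->
  hs phi /\
  (hs_norm2 phi <= (K ^+ 2 * ((\sum_I 2 * C I ^+ 2) * \int[lebesgue_row R m]_q gauss 1 q))%:E)%E.
Proof.
move=> mphi phiC; pose M := \sum_I 2 * C I ^+ 2.
have le q : hs_density phi q <= K ^+ 2 * M * gauss 1 q.
  rewrite /hs_density /hs_pair /M mulr_sumr mulr_suml; apply: ler_sum => I _.
  have [r i] := phiC q I.
  have -> : K ^+ 2 * (2 * C I ^+ 2) * gauss 1 q =
      (C I * K * gauss 2^-1 q) ^+ 2 + (C I * K * gauss 2^-1 q) ^+ 2.
    rewrite (_ : gauss 1 q = gauss 2^-1 q * gauss 2^-1 q); first by ring.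
    by rewrite /gauss -expRD; congr expR; field.
  rewrite -!expr2; apply: lerD; rewrite -[X in X <= _]ger0_norm ?sqr_ge0 // normrX;
  by rewrite lerXn2r ?nnegrE // (le_trans (normr_ge0 _) r).
have ig : (lebesgue_row R m).-integrable setT (EFin \o (fun q => K ^+ 2 * M * gauss 1 q)).
  exact: (integrableZl _ _ (integrable_gauss _ _)).
have hphi : hs phi by exact: hs_le ig le.
split=> //; rewrite hs_sqnormE // lee_fin mulrA -RintegralZl //; last exact: integrable_gauss.
by apply: le_Rintegral => //; case/hsP: hphi.
Qed.

Lemma hs_waves a b x : hs (waves a b x).
Proof.
have /choice [C CP] : forall I, exists C, forall y,
    `|wave (a I) x y| <= C * gauss 2^-1 y /\ `|wave (b I) x y| <= C * gauss 2^-1 y.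
  move=> I; have [C C0 aC] := wave_bound (a I) (norm1 x).
  have [D D0 bD] := wave_bound (b I) (norm1 x).
  exists (C + D) => y; have g0 := ltW (gauss_gt0 (2^-1) y); rewrite mulrDl; split.
    by apply: le_trans (aC x _ y) _; rewrite // lerDl mulr_ge0.
  by apply: le_trans (bD x _ y) _; rewrite // lerDr mulr_ge0.
have [] // := @hs_envelope (waves a b x) C 1 (hs_measurable_waves a b x).
by move=> q I; rewrite mulr1; exact: CP.
Qed.

Lemma cvg_norm1 x : norm1 (z - x) @[z --> x] --> 0.
Proof.
have norm0 (f : heis_body R m -> R) : f z @[z --> x] --> f x -> `|f z - f x| @[z --> x] --> (0 : R).
  move=> cf; rewrite -(normr0 R); apply: cvg_norm; rewrite -(subrr (f x)).
  by apply: cvgB => //; exact: cvg_cst.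
have sum0 (f : 'I_m -> heis_body R m -> R) : (forall i, f i z @[z --> x] --> f i x) ->
    \sum_i `|f i z - f i x| @[z --> x] --> (0 : R).
  move=> cf; elim: (index_enum _) => [|i s IH].
    by under eq_fun do rewrite big_nil; exact: cvg_cst.
  under eq_fun do rewrite big_cons.
  by have := cvgD (norm0 (f i) (cf i)) IH; rewrite addr0; apply.
have cq i : (fun z : heis_body R m => z.1.1 ord0 i) z @[z --> x] --> x.1.1 ord0 i.
  apply: (@cvg_comp _ _ _ (fun z : heis_body R m => z.1.1) (fun M : 'rV[R]_m => M ord0 i)).
    exact: (cvg_comp _ _ cvg_fst cvg_fst).
  exact: coord_continuous.
have cp i : (fun z : heis_body R m => z.1.2 ord0 i) z @[z --> x] --> x.1.2 ord0 i.
  apply: (@cvg_comp _ _ _ (fun z : heis_body R m => z.1.2) (fun M : 'rV[R]_m => M ord0 i)).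
    exact: (cvg_comp _ _ cvg_fst cvg_snd).
  exact: coord_continuous.
have ct : (fun z : heis_body R m => z.2 : R) z @[z --> x] --> (x.2 : R) by exact: cvg_snd.
rewrite (_ : (fun z => _) = fun z : heis_body R m => \sum_i `|z.1.1 ord0 i - x.1.1 ord0 i| +
    \sum_i `|z.1.2 ord0 i - x.1.2 ord0 i| + `|(z.2 : R) - (x.2 : R)|).
  by have := cvgD (cvgD (sum0 _ cq) (sum0 _ cp)) (norm0 _ ct); rewrite !addr0; apply.
by apply/funext => z; rewrite /norm1; congr (_ + _ + _); apply: eq_bigr => i _; rewrite !mxE.
Qed.

Let squeeze0 (T : Type) (G : set_system T) (FG : Filter G) (u : T -> \bar R) (k : T -> R) (M : R) :
  k @ G --> 0 -> (\forall z \near G, (0 <= u z <= (k z ^+ 2 * M)%:E)%E) -> u @ G --> 0%E.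
Proof.
move=> k0 le; apply: (@squeeze_cvge _ _ _ _ (cst 0%E) _ (fun z => (k z ^+ 2 * M)%:E)) => //.
  exact: cvg_cst.
apply: cvg_EFin; first exact: nearW.
rewrite -(mul0r M); apply: cvgM; last exact: cvg_cst.
by rewrite -(mul0r (0 : R)); exact: cvgM.
Qed.

Lemma hs_continuous_waves a b : hs_continuous (waves a b).
Proof.
move=> x; have /choice [C CP] : forall I, exists C, forall v, norm1 v <= 1 -> forall y,
    `|wave (a I) (x + v) y - wave (a I) x y| <= C * norm1 v * gauss 2^-1 y /\
    `|wave (b I) (x + v) y - wave (b I) x y| <= C * norm1 v * gauss 2^-1 y.
  move=> I; have [C C0 aC] := wave_lipschitz (a I) x.
  have [D D0 bD] := wave_lipschitz (b I) x.
  exists (C + D) => v v1 y; have g0 := ltW (gauss_gt0 (2^-1) y); rewrite !mulrDl; split.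
    by apply: le_trans (aC v v1 y) _; rewrite lerDl !mulr_ge0 ?norm1_ge0.
  by apply: le_trans (bD v v1 y) _; rewrite lerDr !mulr_ge0 ?norm1_ge0.
apply: (@squeeze0 _ (nbhs x) _ _ _
  ((\sum_I 2 * C I ^+ 2) * \int[lebesgue_row R m]_q gauss 1 q) (cvg_norm1 x)).
have /cvgr_norm_lt /(_ 1) := cvg_norm1 x; rewrite normr0 => /(_ ltr01).
apply: filterS => z; rewrite ger0_norm ?norm1_ge0 // => /ltW z1.
have [||hle le] := @hs_envelope (waves a b z - waves a b x) C (norm1 (z - x)).
- exact: hs_measurableB (hs_measurable_waves _ _ _) (hs_measurable_waves _ _ _).
- have zx : x + (z - x) = z by rewrite addrC subrK.
  by move=> q I; have := CP I (z - x) z1 q; rewrite zx.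
by rewrite hs_sqnormE // lee_fin hs_sqnorm_ge0 /= -hs_sqnormE.
Qed.

Lemma hs_derivative_waves v a b :
  hs_derivative v (waves a b) (waves (gder v \o a) (gder v \o b)).
Proof.
move=> x; have /choice [C CP] : forall I, exists C, forall h : R, h != 0 -> `|h| <= 1 -> forall y,
    `|h^-1 * (wave (a I) (x + h *: v) y - wave (a I) x y) - wave (gder v (a I)) x y| <= C * `|h| * gauss 2^-1 y /\
    `|h^-1 * (wave (b I) (x + h *: v) y - wave (b I) x y) - wave (gder v (b I)) x y| <= C * `|h| * gauss 2^-1 y.
  move=> I; have [C C0 aC] := wave_derivative (a I) x v.
  have [D D0 bD] := wave_derivative (b I) x v.
  exists (C + D) => h h0 h1 y; have g0 := ltW (gauss_gt0 (2^-1) y); rewrite !mulrDl; split.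
    by apply: le_trans (aC h h0 h1 y) _; rewrite lerDl !mulr_ge0.
  by apply: le_trans (bD h h0 h1 y) _; rewrite lerDr !mulr_ge0.
have c0 : `|h| @[h --> (0 : R)^'] --> `|0 : R|.
  by apply: cvg_within_filter; exact: norm_continuous.
rewrite normr0 in c0.
apply: (@squeeze0 _ (0 : R)^' _ _ _
  ((\sum_I 2 * C I ^+ 2) * \int[lebesgue_row R m]_q gauss 1 q) c0).
have small : \forall h \near (0 : R)^', h != 0 /\ `|h| <= 1.
  by near=> h; split; near: h; [exact: nbhs_dnbhs_neq|exact: dnbhs0_le].
apply: filterS small => h [h0 h1].
have [||hle le] := @hs_envelope ((fun q I => (h^-1)%:C%C * (waves a b (x + h *: v) - waves a b x) q I) -
   waves (gder v \o a) (gder v \o b) x) C `|h|.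
- apply: hs_measurableB (hs_measurable_waves _ _ _).
  apply: hs_measurableM => //.
  exact: hs_measurableB (hs_measurable_waves _ _ _) (hs_measurable_waves _ _ _).
- move=> q I; have := CP I h h0 h1 q; rewrite -[X in complex.Re X]/((h^-1)%:C%C * (waves a b (x + h *: v) q I - waves a b x q I) -
    waves (gder v \o a) (gder v \o b) x q I).
  by rewrite /waves /= !mul0r subr0 addr0.
by rewrite hs_sqnormE // lee_fin hs_sqnorm_ge0 /= -hs_sqnormE.
Unshelve. all: by end_near. Qed.

(** The derivative of a pair of symbols is again a pair of symbols, so the induction runs over all
    of them at once. *)
Lemma hs_Cn_waves N a b : hs_Cn N (waves a b).
Proof.
elim: N a b => [|N IH] a b /=; split=> //; try exact: hs_continuous_waves.
move=> v; exists (waves (gder v \o a) (gder v \o b)); split => //.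
- by move=> x; exact: hs_waves.
- exact: hs_derivative_waves.
Qed.

End Waves.

End Symbols.

(** * Graded-irreducibility *)

Section SchroedingerBody.
Variables (R : realType) (hbar : R) (m K L : nat).
Local Notation n := (qp_odd_dim K L + zeta_dim K L)%N.

Lemma schroedinger_body_gauss_tensor (v : {set 'I_n} -> R[i]) :
  (fun x => schroedinger_body hbar x (@gauss_tensor R m n v)) =
  waves hbar
    (fun I => Plus (Times (CosPhase R m) (Cst m (complex.Re (v I))))
                   (Times (Cst m (-1)) (Times (SinPhase R m) (Cst m (complex.Im (v I))))))
    (fun I => Plus (Times (CosPhase R m) (Cst m (complex.Im (v I))))
                   (Times (SinPhase R m) (Cst m (complex.Re (v I))))).
Proof.
apply/funext => -[[q p] t]; apply/funext => y; apply/funext => I.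
rewrite /schroedinger_body /gauss_tensor /waves /wave /packet /expC /= expR0.
rewrite -/(phase hbar (q, p, t) y); case: (v I) => a b.
by apply/eqP; rewrite eq_complex /=; apply/andP; split; apply/eqP; ring.
Qed.

Lemma smooth_gauss_tensor (v : {set 'I_n} -> R[i]) :
  smooth_vector (@schroedinger_body R hbar m K L) (gauss_tensor v).
Proof.
split=> [|N]; first exact: hs_gauss_tensor.
by rewrite schroedinger_body_gauss_tensor; exact: hs_Cn_waves.
Qed.

Lemma gauss_tensor_odd_action alpha beta gamma (v : {set 'I_n} -> R[i]) :
  @gauss_tensor R m n (odd_action hbar alpha beta gamma v) =
  fun q => odd_action hbar alpha beta gamma (gauss_tensor v q).
Proof.
apply/funext => q; apply/funext => I; rewrite /odd_action /gauss_tensor mulr_sumr.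
apply: eq_bigr => i _; rewrite /create /annihilate mulrBr.
by congr (_ - _); case: ifP => _; ring.
Qed.

Variable F : set (superfun R m n).
Hypothesis hbar0 : hbar != 0.
Hypothesis invF : forall g phi, F phi -> F (schroedinger_body hbar g phi).

(** The group element (0, p / hbar, t / hbar) acts by a pure modulation; dividing by hbar is where
    hbar must be nonzero. *)
Lemma schroedinger_modulation (p : 'rV[R]_m) (t : R) phi : F phi ->
  F (fun q I => expC (Complex 0 (t - \sum_i q ord0 i * p ord0 i)) * phi q I).
Proof.
move=> /(invF ((0, hbar^-1 *: p), hbar^-1 * t)); congr F.
apply/funext => q; apply/funext => I; rewrite /= subr0; congr (expC (Complex 0 _) * _).
rewrite mulrDr mulVKf // mulr_sumr -sumrN; congr (_ + _); apply: eq_bigr => i _.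
by rewrite !mxE mulr0 sub0r mulrCA mulVKf // mulNr.
Qed.

Lemma schroedinger_translation (a : 'rV[R]_m) phi : F phi -> F (fun q I => phi (q - a) I).
Proof.
move=> /(invF ((a, 0), 0)); congr F.
apply/funext => q; apply/funext => I; rewrite /= big1; last by move=> i _; rewrite mxE mulr0.
by rewrite addr0 mulr0 expC0 mul1r.
Qed.

End SchroedingerBody.

Theorem corollary5p14 (R : realType) (A : superalgebra R) (m k l : nat)
    (hbar : R) (sigma plus : bool) :
  odd (k + l) -> hbar != 0 -> schroedinger_choice sigma k l plus ->
  graded_irreducible (schroedinger_odd A hbar m k l plus).
Proof.
move=> kl hbar0 _ [F [closedF gradedF [[phi Fphi phi0] [psi hpsi npsi]] bodyF [_ oddF]]].
have modF := schroedinger_modulation hbar0 bodyF.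
have trF := schroedinger_translation bodyF.
(* Linearity, grading and odd invariance all pass from F to this subspace of the exterior
   algebra. *)
pose V v := F (gauss_tensor v).
have [Fhs F0 FP _] := closedF.
have V0 : V (fun=> 0).
  rewrite /V (_ : gauss_tensor _ = 0) //.
  by apply/funext => q; apply/funext => I; rewrite /gauss_tensor mulr0.
have VP c v w : V v -> V w -> V (fun I => c * v I + w I).
  rewrite /V => Vv Vw; have := FP c _ _ Vv Vw; congr F.
  apply/funext => q; apply/funext => I.
  by rewrite -[LHS]/(c * ((gauss 2 q)%:C%C * v I) + (gauss 2 q)%:C%C * w I) /gauss_tensor; ring.
have V_even v : V v -> V (fun I => if odd #|I| then 0 else v I).
  by move=> Vv; exact: gauss_tensor_even.
have V_action (d : odd_dir k l) v : V v -> V (odd_action hbar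
    (fun j => incl_q R d j) (fun j => incl_p R d j)
    (incl_xi R (over_plus k plus) (over_minus l plus) d) v).
  move=> Vv; have [] // := oddF d (gauss_tensor v) (gauss_tensor (odd_action hbar
    (fun j => incl_q R d j) (fun j => incl_p R d j)
    (incl_xi R (over_plus k plus) (over_minus l plus) d) v)).
    by split=> //; exact: smooth_gauss_tensor.
  split; first exact: hs_gauss_tensor.
  (* On Gaussian tensors the identity defining the odd generator holds at every real point, not just
     almost everywhere. *)
  move=> a oa; apply: aeW => q theta otheta.
  rewrite gauss_tensor_odd_action.
  exact: (schroedinger_super_odd_point hbar d _ q oa otheta).
have [v [I [Fv vI]]] := closed_subspace_gauss_tensor closedF modF trF Fphi phi0.
apply/npsi/(gauss_tensor_total closedF modF) => //.
exact: (clifford_irreducible kl hbar0 V0 VP V_even V_action Fv vI).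
Qed.
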